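(* Suppose the self-similar measure $\mu$ satisfies the standard technical assumptions. Let $I=\inf\{\dim\mu(x): x\text{ an essential, positive periodic point}\}$ and $S=\sup\{\dim\mu(x): x\text{ an essential, positive periodic point}\}$. Then $$\{\dim\mu(x): x\text{ essential},\ \dim\mu(x)\text{ exists}\}=[I,S].$$
   Context: Measure. Let $m\ge 1$, $0<\varrho<1$, $d_0<\dots<d_m$ real, $S_j(x)=\varrho x+d_j$, $\mathcal A=\{0,\dots,m\}$. For $\sigma=(j_1,\dots,j_n)\in\mathcal A^n$ put $S_\sigma=S_{j_1}\circ\cdots\circ S_{j_n}$. Given $p_j>0$ with $\sum_j p_j=1$, $\mu$ is the unique Borel probability measure with $\mu=\sum_{j=0}^m p_j\,\mu\circ S_j^{-1}$. It is of finite type if there is a finite set $F\subset[0,\infty)$ such that for all $n\ge1$ and $\sigma,\sigma'\in\mathcal A^n$ either $\varrho^{-n}|S_\sigma(0)-S_{\sigma'}(0)|>c$ or $\varrho^{-n}|S_\sigma(0)-S_{\sigma'}(0)|\in F$, where $c=(1-\varrho)^{-1}(d_m-d_0)$. Standard technical assumptions: $\mu$ is such a measure and is of finite type; $p_0=p_m=\min_j p_j$; and $\operatorname{supp}\mu=[0,1]$ (equivalently $d_0=0$, $d_m=1-\varrho$, $d_{i+1}-d_i\le\varrho$ for all $i$). Local dimension. $\dim\mu(x)=\lim_{r\to0^+}\frac{\log\mu([x-r,x+r])}{\log r}$ when the limit exists (it exists at every periodic point). Net intervals and characteristic vectors. For $n\ge1$ let $h_1<\dots<h_{s_n}$ be the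 distinct elements of $\{S_\sigma(0),S_\sigma(1):\sigma\in\mathcal A^n\}$; the net intervals of level $n$ are $\mathcal F_n=\{[h_j,h_{j+1}]:1\le j<s_n\}$, and $\mathcal F_0=\{[0,1]\}$. Each $\Delta\in\mathcal F_n$ ($n\ge1$) lies in a unique $\widehat\Delta\in\mathcal F_{n-1}$, its parent ($\Delta$ is a child of $\widehat\Delta$). For $\Delta=[a,b]\in\mathcal F_n$ put $\ell_n(\Delta)=\varrho^{-n}(b-a)$, and let $V_n(\Delta)=(a_1,\dots,a_k)$ be the increasing list of the distinct values $\varrho^{-n}(a-S_\sigma(0))$ over $\sigma\in\mathcal A^n$ with $\Delta\subseteq S_\sigma[0,1]$. Let $r_n(\Delta)$ be the position of $\Delta$, from left to right, among the children of $\widehat\Delta$ with the same $\ell_n$ and $V_n$. The characteristic vector is $\mathcal C_n(\Delta)=(\ell_n(\Delta),V_n(\Delta),r_n(\Delta))$, with $\mathcal C_0([0,1])=(1,(0),1)$. $\Omega$ is the (finite) set of all characteristic vectors. $\beta\in\Omega$ is a child of $\alpha\in\Omega$ (its parent) if $\alpha=\mathcal C_{n-1}(\widehat\Delta)$, $\beta=\mathcal C_n(\Delta)$ for some parent/child pair. An admissible path is a tuple $(\gamma_1,\dots,\gamma_n)$ in $\Omega$ with each $\gamma_j$ the parent of $\gamma_{j+1}$; its length is $n$. A symbolic representation of $x\in[0,1]$ is $[x]=(\mathcal C_0(\Delta_0),\mathcal C_1(\Delta_1),\dots)$, where $x\in\Delta_n\in\mathcal F_n$ and $\Delta_n$ is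 the parent of $\Delta_{n+1}$ for all $n$ (unique unless $x$ is an endpoint of a net interval, in which case there may be two). Transition matrices. For $\Delta=[a,b]\in\mathcal F_n$ with parent $\widehat\Delta=[c,d]$, $V_n(\Delta)=(a_1,\dots,a_K)$, $V_{n-1}(\widehat\Delta)=(c_1,\dots,c_J)$, the primitive transition matrix $T(\mathcal C_{n-1}(\widehat\Delta),\mathcal C_n(\Delta))$ is the $J\times K$ matrix with $(j,k)$ entry $p_0^{-1}p_\ell$ if $\ell\in\mathcal A$ satisfies $c-\varrho^{n-1}c_j+\varrho^{n-1}d_\ell=a-\varrho^na_k$, and $0$ if there is no such $\ell$ (it depends only on the two characteristic vectors). For an admissible path, $T(\gamma_1,\dots,\gamma_n)=T(\gamma_1,\gamma_2)\cdots T(\gamma_{n-1},\gamma_n)$. A matrix is positive if all entries are strictly positive. Loop and essential classes. A non-empty $\Omega'\subseteq\Omega$ is a loop class if for all $\alpha,\beta\in\Omega'$ there is an admissible path $(\gamma_1,\dots,\gamma_n)$, $n\ge2$, with all $\gamma_j\in\Omega'$, $\gamma_1=\alpha$, $\gamma_n=\beta$. The essential class $\Omega_0$ is the loop class with the further property that every child in $\Omega$ of an element of $\Omega_0$ is in $\Omega_0$; there is exactly one such class (a known result of Feng). A point $x$ is essential if it has a symbolic representation $(\gamma_0,\gamma_1,\dots)$ with $\gamma_j\in\Omega_0$ for all large $j$. Periodic points. $x$ is periodic with period $\theta$ if it has a symbolic representation $(\gamma_0,\dots,\gamma_s,\theta^-,\theta^-,\dots)$, where $\theta$ is an admissible cycle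 (a path of length at least 2 with equal first and last letters) and $\theta^-$ is $\theta$ with its last letter deleted. An essential, positive periodic point is one having such a period $\theta$ lying in $\Omega_0$ with $T(\theta)$ positive. *)

(* Defs.v *)
From HB Require Import structures.
From mathcomp Require Import all_boot all_order all_algebra.
From mathcomp Require Import all_classical all_reals all_analysis.
Set Implicit Arguments.
Unset Strict Implicit.
Unset Printing Implicit Defensive.
Import Order.TTheory GRing.Theory Num.Theory.
Import numFieldNormedType.Exports.
Local Open Scope classical_set_scope.
Local Open Scope ring_scope.

(* The contractions S_j(x) = rho * x + d_j, j = 0, ..., m, and the
   probabilities p_j. *)
Record weightedIFS (R : realType) := WeightedIFS {
  ifs_m : nat;
  ratio : R;
  shift : 'I_ifs_m.+1 -> R;
  weight : 'I_ifs_m.+1 -> R;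
  ifs_m_ge1 : (1 <= ifs_m)%N;
  ratio_gt0 : 0 < ratio;
  ratio_lt1 : ratio < 1;
  shift_increasing : forall i j : 'I_ifs_m.+1, (i < j)%N -> shift i < shift j;
  weight_gt0 : forall j, 0 < weight j;
  weight_sum1 : \sum_(j < ifs_m.+1) weight j = 1 }.

Section FiniteType.
Variables (R : realType) (W : weightedIFS R).

Local Notation rho := (ratio W).
Local Notation d := (@shift R W).
Local Notation p := (@weight R W).
Local Notation letter := 'I_(ifs_m W).+1.

Definition contraction (j : letter) (x : R) : R := rho * x + d j.

(* S_(j_1, ..., j_n) = S_(j_1) \o ... \o S_(j_n), the identity for n = 0. *)
Definition S_word (w : seq letter) (x : R) : R := foldr contraction x w.

Definition self_similar (mu : probability (measurableTypeR R) R) : Prop :=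
  forall A : set (measurableTypeR R), measurable A ->
    mu A = (\sum_(j < (ifs_m W).+1)
              (p j)%:E * mu (contraction j @^-1` A))%E.

Definition finite_type : Prop :=
  let c := (1 - rho)^-1 * (d ord_max - d ord0) in
  exists F : set R,
    [/\ finite_set F, (forall t, F t -> 0 <= t) &
        forall n : nat, (1 <= n)%N -> forall s s' : n.-tuple letter,
          let t := rho ^- n * `|S_word s 0 - S_word s' 0| in c < t \/ F t].

(* The complement of the largest open null set. *)
Definition supp (mu : probability (measurableTypeR R) R) : set R :=
  [set x | forall U : set R, open U -> U x -> (0 < mu U)%E].

Definition standard_assumptions (mu : probability (measurableTypeR R) R) :
    Prop :=
  [/\ self_similar mu,
      finite_type,
      p ord0 = p ord_max /\ (forall j, p ord0 <= p j) &
      supp mu = [set` `[0, 1]]].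

(* In the support of mu the measure of the interval is positive, so that the
   convention ln 0 = 0 is irrelevant there. *)
Definition has_local_dim (mu : probability (measurableTypeR R) R) (x v : R) :
    Prop :=
  ln (fine (mu [set` `[x - r, x + r]])) / ln r @[r --> 0^'+] --> v.

(* The interval [a, b] is encoded as the pair (a, b). *)
Definition itv_in (D E : R * R) : bool := (E.1 <= D.1) && (D.2 <= E.2).

Definition endpoints (n : nat) : seq R :=
  sort <=%R (undup ([seq S_word w 0 | w : n.-tuple letter] ++
                    [seq S_word w 1 | w : n.-tuple letter])).

(* The pairs (h_j, h_(j+1)), from left to right. *)
Definition net_intervals (n : nat) : seq (R * R) :=
  zip (endpoints n) (behead (endpoints n)).

Lemma enum_tuple0 : enum {: 0.-tuple letter} = [:: [tuple]].
Proof.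
have := cardE {: 0.-tuple letter}; rewrite card_tuple expn0.
by case: (enum _) => [//|w []//] _; rewrite (tuple0 w).
Qed.

Lemma net_intervals0 : net_intervals 0 = [:: (0, 1)].
Proof.
by rewrite /net_intervals /endpoints /image_mem enum_tuple0 /= inE eq_sym
  oner_eq0 /sort /= /path.sort /= ler01.
Qed.

(* The unique interval of level n containing D, for D of level n.+1; the
   default value of head is never reached when the support is [0, 1]. *)
Definition parent (n : nat) (D : R * R) : R * R :=
  head (0, 1) [seq E <- net_intervals n | itv_in D E].

Definition children (n : nat) (E : R * R) : seq (R * R) :=
  [seq D <- net_intervals n.+1 | parent n D == E].

Definition ell (n : nat) (D : R * R) : R := rho ^- n * (D.2 - D.1).

(* S_w [0, 1] = [S_w 0, S_w 1] since S_w is increasing. *)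
Definition V (n : nat) (D : R * R) : seq R :=
  sort <=%R (undup [seq rho ^- n * (D.1 - S_word w 0)
    | w : n.-tuple letter <- enum {: n.-tuple letter}
    & itv_in D (S_word w 0, S_word w 1)]).

(* Positions are counted from 1. *)
Definition position (n : nat) (D : R * R) : nat :=
  if n is k.+1 then
    (index D [seq D' <- children k (parent k D)
                | (ell n D' == ell n D) && (V n D' == V n D)]).+1
  else 1%N.

Definition charvec : Type := (R * seq R * nat)%type.

Definition cv_nbrs (alpha : charvec) : seq R := alpha.1.2.

Definition characteristic (n : nat) (D : R * R) : charvec :=
  (ell n D, V n D, position n D).

Lemma characteristic0 : characteristic 0 (0, 1) = (1, [:: 0], 1%N).
Proof.
rewrite /characteristic /ell /V enum_tuple0 /= /itv_in /= !lexx /=.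
by rewrite expr0 invr1 !subr0 !mul1r.
Qed.

Definition Omega : set charvec :=
  [set alpha | exists n D, D \in net_intervals n /\ alpha = characteristic n D].

(* D is an interval of level n.+1 whose characteristic vector is beta, and that
   of its parent is alpha. *)
Definition realizes (alpha beta : charvec) (nD : nat * (R * R)) : Prop :=
  [/\ nD.2 \in net_intervals nD.1.+1,
      characteristic nD.1 (parent nD.1 nD.2) = alpha &
      characteristic nD.1.+1 nD.2 = beta].

Definition is_child (alpha beta : charvec) : Prop :=
  exists nD, realizes alpha beta nD.

(* admissible alpha s : the tuple (alpha, s_1, ..., s_k) is an admissible
   path. *)
Definition admissible (alpha : charvec) (s : seq charvec) : Prop :=
  Omega alpha /\ path (fun a b => `[< is_child a b >]) alpha s.

(* The entries of T are read off an arbitrary interval realizing the pair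
   (alpha, beta), on which they do not depend; here D has level n.+1. *)
Definition transition (alpha beta : charvec) :
    'M[R]_(size (cv_nbrs alpha), size (cv_nbrs beta)) :=
  let: (n, D) := xget (0%N, (0, 1)) (realizes alpha beta) in
  let a := D.1 in
  let c := (parent n D).1 in
  \matrix_(j, k)
    if [pick l : letter | c - rho ^+ n * (cv_nbrs alpha)`_j + rho ^+ n * d l
                          == a - rho ^+ n.+1 * (cv_nbrs beta)`_k] is Some l
    then (p ord0)^-1 * p l else 0.

Fixpoint path_transition (alpha : charvec) (s : seq charvec) :
    'M[R]_(size (cv_nbrs alpha), size (cv_nbrs (last alpha s))) :=
  if s is beta :: s' then transition alpha beta *m path_transition beta s'
  else 1%:M.

Definition positive_mx (k l : nat) (M : 'M[R]_(k, l)) : Prop :=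
  forall i j, 0 < M i j.

Definition loop_class (C : set charvec) : Prop :=
  [/\ C !=set0, C `<=` Omega &
      forall alpha beta, C alpha -> C beta ->
        exists s : seq charvec,
          [/\ s != [::], admissible alpha s, last alpha s = beta &
              forall gamma, gamma \in s -> C gamma]].

Definition essential_loop_class (C : set charvec) : Prop :=
  loop_class C /\ (forall alpha beta, C alpha -> is_child alpha beta -> C beta).

(* Under the finite type assumption there is exactly one essential class, which
   is the one chosen here. *)
Definition Omega0 : set charvec := xget set0 essential_loop_class.

Definition symbolic_rep (x : R) (gamma : nat -> charvec) : Prop :=
  exists D : nat -> R * R,
    forall n, [/\ D n \in net_intervals n, x \in `[(D n).1, (D n).2],
                  D n = parent n (D n.+1) & gamma n = characteristic n (D n)].

Definition essential (x : R) : Prop :=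
  exists2 gamma, symbolic_rep x gamma &
    exists N : nat, forall j, (N <= j)%N -> Omega0 (gamma j).

(* The cycle theta is the tuple (alpha, s_1, ..., s_k), k >= 1, and theta^- is
   belast alpha s. *)
Definition cycle_path (alpha : charvec) (s : seq charvec) : Prop :=
  [/\ s != [::], admissible alpha s & last alpha s = alpha].

Definition periodic_with (alpha : charvec) (s : seq charvec) (x : R) : Prop :=
  let theta_minus := belast alpha s in
  cycle_path alpha s /\
  exists gamma (k : nat), symbolic_rep x gamma /\
    forall i, gamma (k.+1 + i)%N =
              nth alpha theta_minus (i %% size theta_minus)%N.

Definition essential_positive_periodic (x : R) : Prop :=
  exists alpha s,
    [/\ periodic_with alpha s x,
        (forall gamma, gamma \in alpha :: s -> Omega0 gamma) &
        positive_mx (path_transition alpha s)].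

End FiniteType.

(* Main.v *)
(* Write Q_n for the p-mass of the words of length n whose cylinder interval
   covers the level n net interval of x.  Since p_0 = p_m is minimal, the masses
   of adjacent net intervals differ at most by a factor O(n), so that the local
   dimension at x is v if and only if ln Q_n = n v ln rho + o(n).  Along a
   symbolic path, Q_n is comparable to p_0^n times the norm of the product of
   the transition matrices.

   Fix a vertex alpha of the essential class and a cycle P at alpha with
   positive matrix; such a P exists because an interval with the greatest
   possible number of neighbours, copied into the cylinder of one neighbour of
   an arbitrary interval, can only have neighbours inside that cylinder.  For
   cycles at alpha ending with P the logarithm of the norm is additive up to a
   constant.  Hence the mean logarithmic norm of such a cycle is, up to
   O(1/length), the dimension of the periodic point it generates; conversely the
   dimension at any essential point is a limit of such means, by closing up its
   initial paths inside the finite essential class.  This gives the inclusion in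
   [I, S].  For the other inclusion, cycles with means close to I and to S are
   concatenated greedily, with slowly increasing lengths, so as to keep the
   total close to the required linear growth. *)
From mathcomp Require Import all_boot all_order all_algebra.
From mathcomp Require Import all_classical all_reals all_analysis.
From mathcomp Require Import measurable_realfun ring lra.
Require Import Defs.
Set Implicit Arguments.
Unset Strict Implicit.
Unset Printing Implicit Defensive.
Import Order.TTheory GRing.Theory Num.Theory.
Import numFieldNormedType.Exports.
Local Open Scope classical_set_scope.
Local Open Scope ring_scope.

(** * Words *)

(** A small ball around a point of a net interval D meets, besides the word intervals covering D,
    only those touching D from outside at an end: endpoints of level n are separated by a fixed
    multiple of rho^n. The minimality of p_0 = p_m is spent on these touching words alone. Finite
    type is spent three times: on that separation, on the finiteness of the set of characteristic
    vectors, and on the existence of a greatest number of neighbours.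

    The constants in the norm estimates must not depend on the lengths of the paths.
    Submultiplicativity gives one side at once. The other side can fail for nonnegative matrices,
    but it holds across a fixed factor with positive entries, and also when one of the two factors
    is fixed, because no transition matrix has a zero row or column.

    In the greedy construction the cycles obey two opposite demands. Each must be long, so that the
    cost of a junction is small relative to its length, and short relative to what precedes it,
    because between two junctions only the monotonicity of Q_n controls the mass. *)

Record unit_cover (R : realType) (W : weightedIFS R) : Prop := UnitCover {
  unit_cover_first : @shift R W ord0 = 0;
  unit_cover_last : @shift R W ord_max = 1 - ratio W;
  unit_cover_gap : forall i j : 'I_(ifs_m W).+1, j = i.+1 :> nat ->
    shift j <= shift i + ratio W;
  unit_cover_weight_last : @weight R W ord_max = @weight R W ord0;
  unit_cover_weight_min : forall j, @weight R W ord0 <= @weight R W j;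
  unit_cover_finite_type : finite_type W }.

(** The combinatorial part involves no measure, so its hypotheses are bundled with the system. The
    coercion lets the final result apply as it stands to the given system. *)
Record coverIFS (R : realType) := CoverIFS {
  cover_ifs :> weightedIFS R;
  cover_ifsP : unit_cover cover_ifs }.

Lemma expr_small (R : realType) (x e : R) :
  0 < x < 1 -> 0 < e -> exists k, x ^+ k < e.
Proof.
case/andP=> x0 x1 e0; have /cvgrPdist_lt /(_ e e0) [k _ /(_ k (leqnn k))] :=
  @cvg_expr R x ltac:(by rewrite gtr0_norm).
by rewrite sub0r normrN gtr0_norm ?exprn_gt0 //; exists k.
Qed.

Section Words.
Context {R : realType} (W : coverIFS R).

Local Notation rho := (ratio W).
Local Notation d := (@shift R W).
Local Notation p := (@weight R W).
Local Notation letter := 'I_(ifs_m W).+1.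
Local Notation S := (@S_word R W).
Implicit Types (w u v : seq letter) (i j : letter) (n : nat).

Let rho_gt0 : 0 < rho := ratio_gt0 W.
Let rho_lt1 : rho < 1 := ratio_lt1 W.

Lemma shift_first : d ord0 = 0.
Proof. exact: unit_cover_first (cover_ifsP W). Qed.

Lemma shift_last : d ord_max = 1 - rho.
Proof. exact: unit_cover_last (cover_ifsP W). Qed.

Lemma shift_gap i j : j = i.+1 :> nat -> d j <= d i + rho.
Proof. exact: unit_cover_gap (cover_ifsP W) _ _. Qed.

Lemma weight_last : p ord_max = p ord0.
Proof. exact: unit_cover_weight_last (cover_ifsP W). Qed.

Lemma weight_min j : p ord0 <= p j.
Proof. exact: unit_cover_weight_min (cover_ifsP W) _. Qed.

Lemma rhoX_gt0 n : 0 < rho ^+ n.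
Proof. exact: exprn_gt0. Qed.

Lemma rhoX_le1 n : rho ^+ n <= 1.
Proof. by rewrite exprn_ile1 // ltW. Qed.

Lemma weight_le1 j : p j <= 1.
Proof.
rewrite -(weight_sum1 W) (bigD1 j) //= lerDl sumr_ge0 // => i _.
exact/ltW/weight_gt0.
Qed.

Lemma S_wordE w x : S w x = S w 0 + rho ^+ size w * x.
Proof.
elim: w => [|j w IH] /=; first by rewrite expr0 mul1r add0r.
by rewrite /contraction IH exprS; ring.
Qed.

Lemma S_word_cat u v x : S (u ++ v) x = S u (S v x).
Proof. by rewrite /S_word foldr_cat. Qed.

Lemma S_word_cat0 u v : S (u ++ v) 0 = S u 0 + rho ^+ size u * S v 0.
Proof. by rewrite S_word_cat S_wordE. Qed.

Lemma S_word_rcons w j : S (rcons w j) 0 = S w 0 + rho ^+ size w * d j.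
Proof. by rewrite -cats1 S_word_cat0 /= /contraction mulr0 add0r. Qed.

Lemma shift_ge0 j : 0 <= d j.
Proof.
rewrite -(shift_first).
have [->//|j0] := eqVneq j ord0; apply/ltW/shift_increasing.
by rewrite /= lt0n; apply: contra j0 => /eqP j0; apply/eqP/val_inj.
Qed.

Lemma shift_le j : d j <= 1 - rho.
Proof.
rewrite -(shift_last).
have [->//|jm] := eqVneq j ord_max; apply/ltW/shift_increasing => /=.
by rewrite ltn_neqAle -ltnS ltn_ord andbT.
Qed.

Lemma shift_inj : injective d.
Proof.
move=> i j dij; apply/val_inj; case: (ltngtP i j) => // /(@shift_increasing R W);
  by rewrite dij ltxx.
Qed.

Lemma S_word_ge0 w : 0 <= S w 0.
Proof.
by elim: w => //= j w IH; rewrite addr_ge0 ?shift_ge0 ?mulr_ge0 // ltW.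
Qed.

Lemma S_word_le1 w : S w 0 + rho ^+ size w <= 1.
Proof.
elim: w => [|j w IH] /=; first by rewrite expr0 add0r.
rewrite /contraction exprS; have := shift_le j.
suff : rho * (S w 0 + rho ^+ size w) <= rho * 1 by lra.
by rewrite ler_wpM2l // ltW.
Qed.

Lemma S_word_cat_ge u v : S u 0 <= S (u ++ v) 0.
Proof. by rewrite S_word_cat0 lerDl mulr_ge0 ?S_word_ge0 // ltW ?rhoX_gt0. Qed.

Lemma S_word_cat_le u v :
  S (u ++ v) 0 + rho ^+ size (u ++ v) <= S u 0 + rho ^+ size u.
Proof.
rewrite S_word_cat0 size_cat exprD -addrA -mulrDr lerD2l.
by rewrite -[leRHS]mulr1 ler_wpM2l ?S_word_le1 // ltW ?rhoX_gt0.
Qed.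

(** For the greatest letter with d j <= y, the next image starts beyond y, and consecutive images
    leave no gap. The half-open form selects an image containing a right neighbourhood of y;
    [cover_letter_left] is the mirror image. *)
Lemma cover_letter (y : R) : 0 <= y < 1 -> exists j, d j <= y < d j + rho.
Proof.
case/andP=> y0 y1.
have P0 : d (ord0 : letter) <= y by rewrite shift_first.
have [j Pj jmax] := @arg_maxnP _ ord0 (fun j => d j <= y) (fun j => j : nat) P0.
exists j; rewrite Pj /=.
have [jm|jm] := eqVneq j ord_max.
  by rewrite jm shift_last; lra.
have jm' : (j.+1 < (ifs_m W).+1)%N.
  rewrite ltnS ltn_neqAle -ltnS ltn_ord andbT.
  by apply: contra jm => /eqP jm; apply/eqP/val_inj.
apply: lt_le_trans (shift_gap (i := j) (j := Ordinal jm') erefl).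
by rewrite ltNge; apply/negP => /jmax /=; rewrite /= ltnn.
Qed.

Lemma cover_letter_left (y : R) : 0 < y <= 1 -> exists j, d j < y <= d j + rho.
Proof.
case/andP=> y0 y1.
have P0 : d (ord0 : letter) < y by rewrite shift_first.
have [j Pj jmax] := @arg_maxnP _ ord0 (fun j => d j < y) (fun j => j : nat) P0.
exists j; rewrite Pj /=.
have [jm|jm] := eqVneq j ord_max.
  by rewrite jm shift_last; lra.
have jm' : (j.+1 < (ifs_m W).+1)%N.
  rewrite ltnS ltn_neqAle -ltnS ltn_ord andbT.
  by apply: contra jm => /eqP jm; apply/eqP/val_inj.
apply: le_trans (shift_gap (i := j) (j := Ordinal jm') erefl).
by rewrite leNgt; apply/negP => /jmax /=; rewrite /= ltnn.
Qed.

Lemma cover_word n (y : R) : 0 <= y < 1 ->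
  exists w, size w = n /\ S w 0 <= y < S w 0 + rho ^+ n.
Proof.
elim: n y => [|n IH] y hy; first by exists [::]; rewrite expr0 add0r.
have [j /andP[j1 j2]] := cover_letter hy.
have /IH [w [sw /andP[w1 w2]]] : 0 <= (y - d j) / rho < 1.
  by rewrite divr_ge0 ?subr_ge0 ?(ltW rho_gt0) //= ltr_pdivrMr // mul1r; lra.
exists (j :: w); rewrite /= sw; split=> //; rewrite /contraction exprS.
move: w1 w2; rewrite ler_pdivlMr // ltr_pdivrMr //; nra.
Qed.

Lemma cover_word_left n (y : R) : 0 < y <= 1 ->
  exists w, size w = n /\ S w 0 < y <= S w 0 + rho ^+ n.
Proof.
elim: n y => [|n IH] y hy; first by exists [::]; rewrite expr0 add0r.
have [j /andP[j1 j2]] := cover_letter_left hy.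
have /IH [w [sw /andP[w1 w2]]] : 0 < (y - d j) / rho <= 1.
  by rewrite divr_gt0 ?subr_gt0 //= ler_pdivrMr // mul1r; lra.
exists (j :: w); rewrite /= sw; split=> //; rewrite /contraction exprS.
move: w1 w2; rewrite ltr_pdivlMr // ler_pdivrMr //; nra.
Qed.

(* The expectation of g (S_w 0) over random words w of length n. *)
Fixpoint wsum n (g : R -> R) : R :=
  if n is n'.+1 then \sum_j p j * wsum n' (g \o contraction j) else g 0.

Lemma wsum_le n (g h : R -> R) :
  (forall w, size w = n -> g (S w 0) <= h (S w 0)) -> wsum n g <= wsum n h.
Proof.
elim: n g h => [|n IH] g h gh /=; first exact: (gh [::]).
apply: ler_sum => j _; rewrite ler_wpM2l ?(ltW (weight_gt0 _)) //.
by apply: IH => w sw; apply: (gh (j :: w)); rewrite /= sw.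
Qed.

Lemma wsum_eq n (g h : R -> R) :
  (forall w, size w = n -> g (S w 0) = h (S w 0)) -> wsum n g = wsum n h.
Proof.
by move=> gh; apply/eqP; rewrite eq_le !wsum_le // => w /gh ->.
Qed.

Lemma wsum_sum n (I : Type) (r : seq I) (F : I -> R -> R) :
  wsum n (fun t => \sum_(i <- r) F i t) = \sum_(i <- r) wsum n (F i).
Proof.
elim: n F => [|n IH] F //=; rewrite exchange_big; apply: eq_bigr => j _.
by rewrite -mulr_sumr; congr (_ * _); exact: (IH (fun k => F k \o contraction j)).
Qed.

Lemma wsumZ n c (g : R -> R) : wsum n (fun t => c * g t) = c * wsum n g.
Proof.
elim: n g => [|n IH] g //=; rewrite mulr_sumr; apply: eq_bigr => j _.
by rewrite mulrCA; congr (_ * _); exact: (IH (g \o contraction j)).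
Qed.

Lemma wsumD n (g h : R -> R) :
  wsum n (fun t => g t + h t) = wsum n g + wsum n h.
Proof.
elim: n g h => [|n IH] g h //=; rewrite -big_split; apply: eq_bigr => j _ /=.
rewrite -mulrDr; congr (_ * _).
exact: (IH (g \o contraction j) (h \o contraction j)).
Qed.

Lemma wsum_cst n c : wsum n (fun=> c) = c.
Proof.
elim: n => //= n IH; rewrite -[RHS]mul1r -(weight_sum1 W) mulr_suml.
by apply: eq_bigr => j _; congr (_ * _); exact: IH.
Qed.

Lemma wsum_ge0 n (g : R -> R) : (forall w, size w = n -> 0 <= g (S w 0)) ->
  0 <= wsum n g.
Proof. by move=> g0; rewrite -(wsum_cst n 0) wsum_le. Qed.

(** [wsum] peels off first letters, as self-similarity does, whereas passing to the next net level
    appends a last letter. *)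
Lemma wsum_rcons n (g : R -> R) :
  wsum n.+1 g = wsum n (fun t => \sum_j p j * g (t + rho ^+ n * d j)).
Proof.
elim: n g => [|n IH] g.
  by apply: eq_bigr => j _; rewrite /= /contraction mulr0 !add0r mul1r.
transitivity (\sum_i p i * wsum n.+1 (g \o contraction i)); first by [].
rewrite [in RHS]/wsum -/wsum; apply: eq_bigr => i _; rewrite IH.
congr (_ * _); apply: wsum_eq => w _; apply: eq_bigr => j _ /=.
by congr (_ * g _); rewrite /contraction exprS; ring.
Qed.

Lemma wsum_ge n (g : R -> R) w : (forall u, size u = n -> 0 <= g (S u 0)) ->
  size w = n -> p ord0 ^+ n * g (S w 0) <= wsum n g.
Proof.
elim: n g w => [|n IH] g [|j w] //= g0; first by rewrite mul1r.
move=> [sw]; rewrite (bigD1 j) //= exprS -mulrA.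
have g0' (i : letter) u : size u = n -> 0 <= (g \o contraction i) (S u 0).
  by move=> su; exact: (g0 (i :: u) (congr1 succn su)).
have : p ord0 * (p ord0 ^+ n * (g \o contraction j) (S w 0)) <=
    p j * wsum n (g \o contraction j).
  apply: ler_pM; rewrite ?(ltW (weight_gt0 _)) ?weight_min //.
    by rewrite mulr_ge0 ?exprn_ge0 ?(ltW (weight_gt0 _)) //; apply: g0'.
  by apply: IH => // u; apply: g0'.
move/le_trans; apply; rewrite lerDl sumr_ge0 // => i _.
by rewrite mulr_ge0 ?(ltW (weight_gt0 _)) // wsum_ge0 //; apply: g0'.
Qed.

End Words.

(** * Mass of words at an endpoint *)

Section Germs.
Context {R : realType} (W : coverIFS R).

Local Notation rho := (ratio W).
Local Notation d := (@shift R W).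
Local Notation p := (@weight R W).
Local Notation letter := 'I_(ifs_m W).+1.
Local Notation S := (@S_word R W).
Implicit Types (w u v : seq letter) (j : letter) (n : nat).

Let rho_gt0 : 0 < rho := ratio_gt0 W.
Let p_ge0 j : 0 <= p j.
Proof. exact/ltW/weight_gt0. Qed.

(** For a net interval D, [left_mass] at D.2 and [right_mass] at D.1 both turn out to be the mass of
    the words covering D, while [start_mass] at D.2 and [end_mass] at D.1 belong to words touching D
    from outside. The half-open inequalities say that an image contains a one-sided
    neighbourhood. *)
Definition start_mass n b := wsum W n (fun t => (t == b)%:R).
Definition end_mass n a := wsum W n (fun t => (t + rho ^+ n == a)%:R).
Definition left_mass n b :=
  wsum W n (fun t => ((t < b) && (b <= t + rho ^+ n))%:R).
Definition right_mass n a :=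
  wsum W n (fun t => ((t <= a) && (a < t + rho ^+ n))%:R).

Lemma start_massS n b :
  start_mass n.+1 b = \sum_j p j * start_mass n ((b - d j) / rho).
Proof.
apply: eq_bigr => j _; congr (_ * _); apply: wsum_eq => w _ /=.
rewrite /contraction; congr (nat_of_bool _)%:R; apply/eqP/eqP => [<-|->].
  by rewrite addrK mulrC mulKf ?gt_eqF.
by rewrite mulrC divfK ?gt_eqF // subrK.
Qed.

Lemma end_massS n a :
  end_mass n.+1 a = \sum_j p j * end_mass n ((a - d j) / rho).
Proof.
apply: eq_bigr => j _; congr (_ * _); apply: wsum_eq => w _ /=.
rewrite /contraction exprS; congr (nat_of_bool _)%:R; apply/eqP/eqP => h.
  by apply: (mulfI (lt0r_neq0 rho_gt0)); rewrite [RHS]mulrC divfK ?gt_eqF //; lra.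
by rewrite addrAC -mulrDr h mulrC divfK ?gt_eqF // subrK.
Qed.

Lemma left_massS n b :
  left_mass n.+1 b = \sum_j p j * left_mass n ((b - d j) / rho).
Proof.
apply: eq_bigr => j _; congr (_ * _); apply: wsum_eq => w _ /=.
rewrite /contraction ltr_pdivlMr // ler_pdivrMr // ltrBrDr lerBlDr [S w 0 * _]mulrC.
by congr (nat_of_bool (_ && (_ <= _)))%:R; rewrite exprS; ring.
Qed.

Lemma right_massS n a :
  right_mass n.+1 a = \sum_j p j * right_mass n ((a - d j) / rho).
Proof.
apply: eq_bigr => j _; congr (_ * _); apply: wsum_eq => w _ /=.
rewrite /contraction ler_pdivlMr // ltr_pdivrMr // lerBrDr ltrBlDr [S w 0 * _]mulrC.
by congr (nat_of_bool (_ && (_ < _)))%:R; rewrite exprS; ring.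
Qed.

Lemma start_mass_lt0 n b : b < 0 -> start_mass n b = 0.
Proof.
move=> b0; rewrite -(wsum_cst W n 0); apply: wsum_eq => w _.
by rewrite gt_eqF // (lt_le_trans b0) // S_word_ge0.
Qed.

Lemma end_mass_gt1 n a : 1 < a -> end_mass n a = 0.
Proof.
move=> a1; rewrite -(wsum_cst W n 0); apply: wsum_eq => w sw.
by rewrite lt_eqF // (le_lt_trans _ a1) // -sw S_word_le1.
Qed.

Lemma start_mass0 n : start_mass n 0 = p ord0 ^+ n.
Proof.
elim: n => [|n IH]; first by rewrite /start_mass /= eqxx.
rewrite start_massS (bigD1 ord0) //= shift_first subr0 mul0r IH big1 ?addr0 -?exprS //.
move=> j j0; rewrite start_mass_lt0 ?mulr0 // sub0r pmulr_llt0 ?invr_gt0 //.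
rewrite oppr_lt0 -(shift_first W); apply: shift_increasing.
by rewrite /= lt0n; apply: contra j0 => /eqP j0; apply/eqP/val_inj.
Qed.

Lemma end_mass1 n : end_mass n 1 = p ord0 ^+ n.
Proof.
elim: n => [|n IH]; first by rewrite /end_mass /= add0r eqxx.
rewrite end_massS (bigD1 ord_max) //= shift_last opprB addrCA subrr addr0.
rewrite divff ?gt_eqF // IH weight_last big1 ?addr0 -?exprS //.
move=> j jm; rewrite end_mass_gt1 ?mulr0 // ltr_pdivlMr // mul1r.
have : d j < d ord_max.
  apply: shift_increasing; rewrite /= ltn_neqAle -ltnS ltn_ord andbT.
  by apply: contra jm => /eqP jm; apply/eqP/val_inj.
by rewrite shift_last; lra.
Qed.

Lemma left_mass_ge n b : 0 < b <= 1 -> p ord0 ^+ n <= left_mass n b.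
Proof.
move=> /(cover_word_left W n)[w [sw wb]].
by apply: le_trans (wsum_ge _ sw) => [|u _]; rewrite ?ler0n // wb mulr1.
Qed.

Lemma right_mass_ge n a : 0 <= a < 1 -> p ord0 ^+ n <= right_mass n a.
Proof.
move=> /(cover_word W n)[w [sw wa]].
by apply: le_trans (wsum_ge _ sw) => [|u _]; rewrite ?ler0n // wa mulr1.
Qed.

Lemma left_mass_ge0 n b : 0 <= left_mass n b.
Proof. by apply: wsum_ge0 => w _; rewrite ler0n. Qed.

Lemma right_mass_ge0 n b : 0 <= right_mass n b.
Proof. by apply: wsum_ge0 => w _; rewrite ler0n. Qed.

(* A word of length n.+1 starting at b either has its tail starting at an
   interior point of [0, 1], or is j 0 ... 0 with j > 0; in the latter case the
   image of [0, 1] under the letter j - 1 contains a left neighbourhood of b,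
   and the mass p_j p_0^n is minimal up to the factor p_j / p_(j-1). *)
Lemma start_mass_le n b :
  0 < b -> start_mass n b <= n%:R / p ord0 * left_mass n b.
Proof.
have p0 : 0 < p ord0 by exact: weight_gt0.
elim: n b => [|n IH] b b0.
  by rewrite mul0r mul0r /start_mass /= lt_eqF.
have split_sum : start_mass n.+1 b <=
    \sum_j p j * (n%:R / p ord0 * left_mass n ((b - d j) / rho)) +
    \sum_j p j * ((b == d j)%:R * p ord0 ^+ n).
  rewrite -big_split start_massS; apply: ler_sum => j _ /=; rewrite -mulrDr.
  apply: ler_wpM2l => //.
  case: (ltgtP b (d j)) => [bd|bd|->].
  - rewrite start_mass_lt0; last by rewrite pmulr_llt0 ?invr_gt0 // subr_lt0.
    rewrite mul0r addr0 mulr_ge0 ?left_mass_ge0 //.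
    by rewrite divr_ge0 ?ler0n // ltW.
  - by rewrite mul0r addr0 IH // divr_gt0 // subr_gt0.
  - rewrite subrr mul0r start_mass0 mul1r lerDr mulr_ge0 ?left_mass_ge0 //.
    by rewrite divr_ge0 ?ler0n // ltW.
apply: (le_trans split_sum).
rewrite -natr1 !mulrDl mul1r.
apply: lerD.
  by rewrite left_massS mulr_sumr; apply: ler_sum => j _; rewrite mulrCA.
case: (pickP (fun j => b == d j)) => [j /eqP bj|nob]; last first.
  rewrite big1 ?mulr_ge0 ?invr_ge0 ?left_mass_ge0 1?ltW //.
  by move=> j _; rewrite nob mul0r mulr0.
rewrite (bigD1 j) //= bj eqxx mul1r big1 ?addr0; last first.
  move=> i ij; case: eqP => [/shift_inj ji|]; last by rewrite mul0r mulr0.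
  by rewrite ji eqxx in ij.
rewrite ler_pdivlMl //.
have j_gt0 : (0 < j)%N.
  rewrite lt0n; apply: contraTneq b0 => j0.
  by rewrite bj (_ : j = ord0) ?shift_first ?ltxx //; apply: val_inj.
have jp : (j.-1 < (ifs_m W).+1)%N by rewrite (leq_ltn_trans (leq_pred j)) ?ltn_ord.
pose i : letter := Ordinal jp.
have ij : j = i.+1 :> nat by rewrite /= prednK.
have lm : p ord0 ^+ n <= left_mass n ((d j - d i) / rho).
  apply: left_mass_ge; rewrite divr_gt0 ?subr_gt0 //=; last first.
    by apply: shift_increasing; rewrite ij.
  by rewrite ler_pdivrMr // mul1r lerBlDl shift_gap.
rewrite left_massS (bigD1 i) //=.
rewrite -[leLHS]addr0 lerD ?sumr_ge0 //; last first.
  by move=> k _; rewrite mulr_ge0 ?left_mass_ge0.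
rewrite ler_pM ?weight_min ?mulr_ge0 ?exprn_ge0 //.
by apply: le_trans lm; rewrite -[leRHS]mul1r ler_wpM2r ?exprn_ge0 ?weight_le1.
Qed.

(** Mirror image of [start_mass_le]: the exceptional words are j m ... m, of mass p_j p_m^n with p_m
    = p_0, and the letter j + 1 supplies the right neighbourhood. *)
Lemma end_mass_le n a :
  a < 1 -> end_mass n a <= n%:R / p ord0 * right_mass n a.
Proof.
have p0 : 0 < p ord0 by exact: weight_gt0.
elim: n a => [|n IH] a a1.
  by rewrite mul0r mul0r /end_mass /= add0r gt_eqF.
have split_sum : end_mass n.+1 a <=
    \sum_j p j * (n%:R / p ord0 * right_mass n ((a - d j) / rho)) +
    \sum_j p j * ((a == d j + rho)%:R * p ord0 ^+ n).
  rewrite -big_split end_massS; apply: ler_sum => j _ /=; rewrite -mulrDr.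
  apply: ler_wpM2l => //.
  case: (ltgtP a (d j + rho)) => [ad|ad|->].
  - by rewrite mul0r addr0 IH // ltr_pdivrMr // mul1r ltrBlDl.
  - rewrite end_mass_gt1; last by rewrite ltr_pdivlMr // mul1r ltrBrDl.
    rewrite mul0r addr0 mulr_ge0 ?right_mass_ge0 //.
    by rewrite divr_ge0 ?ler0n // ltW.
  - rewrite addrC addKr divff ?gt_eqF // end_mass1 mul1r lerDr.
    by rewrite mulr_ge0 ?right_mass_ge0 // divr_ge0 ?ler0n // ltW.
apply: (le_trans split_sum).
rewrite -natr1 !mulrDl mul1r.
apply: lerD.
  by rewrite right_massS mulr_sumr; apply: ler_sum => j _; rewrite mulrCA.
case: (pickP (fun j => a == d j + rho)) => [j /eqP bj|nob]; last first.
  rewrite big1 ?mulr_ge0 ?invr_ge0 ?right_mass_ge0 1?ltW //.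
  by move=> j _; rewrite nob mul0r mulr0.
rewrite (bigD1 j) //= bj eqxx mul1r big1 ?addr0; last first.
  move=> i ij; case: eqP => [/addIr/shift_inj ji|]; last by rewrite mul0r mulr0.
  by rewrite ji eqxx in ij.
rewrite ler_pdivlMl //.
have jp : (j.+1 < (ifs_m W).+1)%N.
  rewrite ltnS ltn_neqAle -ltnS ltn_ord andbT.
  apply: contraTneq a1 => jm; rewrite bj (_ : j = ord_max) ?shift_last ?subrK ?ltxx //.
  exact: val_inj.
pose i : letter := Ordinal jp.
have dij : d j < d i by apply: shift_increasing.
have gap : d i <= d j + rho by apply: shift_gap.
have lm : p ord0 ^+ n <= right_mass n ((d j + rho - d i) / rho).
  apply: right_mass_ge; rewrite divr_ge0 ?subr_ge0 ?(ltW rho_gt0) //=.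
  by rewrite ltr_pdivrMr // mul1r; lra.
rewrite right_massS (bigD1 i) //=.
rewrite -[leLHS]addr0 lerD ?sumr_ge0 //; last first.
  by move=> k _; rewrite mulr_ge0 ?right_mass_ge0.
rewrite ler_pM ?weight_min ?mulr_ge0 ?exprn_ge0 //.
by apply: le_trans lm; rewrite -[leRHS]mul1r ler_wpM2r ?exprn_ge0 ?weight_le1.
Qed.

End Germs.

(** * Geometry of the support *)

Section Support.
Context {R : realType} (W : weightedIFS R).
Variable mu : probability (measurableTypeR R) R.

Local Notation rho := (ratio W).
Local Notation d := (@shift R W).
Local Notation p := (@weight R W).
Local Notation letter := 'I_(ifs_m W).+1.

Let rho_gt0 : 0 < rho := ratio_gt0 W.

Lemma continuous_affine (a b : R) : continuous (fun x : R => a * x + b).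
Proof.
move=> x; apply: cvgD; last exact: cvg_cst.
by apply: cvgM; [exact: cvg_cst|exact: cvg_id].
Qed.

Lemma measurable_preimage (a b : R) (A : set (measurableTypeR R)) :
  measurable A -> measurable ((fun x : R => a * x + b) @^-1` A).
Proof.
move=> mA; rewrite -[_ @^-1` _]setTI.
exact: (continuous_measurable_fun (@continuous_affine a b)).
Qed.

Lemma mu_fineK (A : set (measurableTypeR R)) :
  measurable A -> ((fine (mu A))%:E = mu A)%E.
Proof. by move=> mA; rewrite fineK // fin_num_measure. Qed.

Lemma mu_fine_ge0 (A : set (measurableTypeR R)) : 0 <= fine (mu A).
Proof. exact/fine_ge0/measure_ge0. Qed.

Lemma mu_fine_le1 (A : set (measurableTypeR R)) : measurable A ->
  fine (mu A) <= 1.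
Proof. by move=> mA; rewrite -lee_fin mu_fineK // probability_le1. Qed.

(** The null neighbourhoods of the points off the support may be uncountably many; the rational
    balls inside them are countably many and still cover the complement. *)
Lemma supp_compl_null (A : set R) : open (~` A) -> supp mu = A -> mu (~` A) = 0%E.
Proof.
move=> oA suppA.
pose B (k : rat * rat) : set (measurableTypeR R) := ball (ratr k.1 : R) (ratr k.2).
have mB k : measurable (B k) by apply: open_measurable; exact: ball_open.
pose F (k : nat) : set (measurableTypeR R) :=
  if @unpickle (rat * rat)%type k is Some q then
    if `[< mu (B q) = 0%E >] then B q else set0
  else set0.
have FE q : mu (B q) = 0%E -> F (pickle q) = B q.
  by move=> q0; rewrite /F pickleK; case: asboolP.
have Fneg k : mu.-negligible (F k).
  rewrite /F; case: unpickle => [q|]; last exact: negligible_set0.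
  case: asboolP => [q0|_]; last exact: negligible_set0.
  exact/negligibleP.
clearbody F; have sub : ~` A `<=` \bigcup_k F k.
  move=> x; rewrite -suppA /supp /= => /existsNP[U /not_implyP[oU /not_implyP[Ux]]].
  move=> /negP; rewrite -leNgt => U0.
  have [c [r /= [xB BU]]] := open_subball_rat oU (mem_set Ux).
  exists (pickle (c, r)); first by [].
  rewrite FE; first exact: set_mem.
  apply/eqP; rewrite eq_le measure_ge0 andbT (le_trans _ U0) // le_measure ?inE //.
  exact: open_measurable.
apply: (measure_negligible (mu := mu)); first exact: open_measurable.
have := negligible_bigcup Fneg. exact: negligibleS.
Qed.

Hypothesis std : standard_assumptions W mu.

Let I01 : set R := [set` `[0, 1]].

Lemma mu_outside (A : set (measurableTypeR R)) : measurable A ->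
  (forall x, A x -> ~ (0 <= x <= 1)) -> mu A = 0%E.
Proof.
case: std => _ _ _ suppI mA Aout.
have null : mu (~` I01) = 0%E.
  apply: supp_compl_null suppI; apply: closed_openC; exact: interval_closed.
apply/eqP; rewrite eq_le measure_ge0 andbT -null.
apply: le_measure; rewrite ?inE //; exact: measurableC (measurable_itv _).
Qed.

Lemma open_contraction (j : letter) (U : set R) :
  open U -> open (contraction j @^-1` U).
Proof.
by move=> oU; apply: open_comp => // x _; exact: continuous_affine.
Qed.

Lemma mu_self A : measurable A ->
  fine (mu A) = \sum_j p j * fine (mu (contraction j @^-1` A)).
Proof.
case: std => ss _ _ _ mA; apply: EFin_inj; rewrite mu_fineK // ss // -sumEFin.
apply: eq_bigr => j _; rewrite EFinM mu_fineK //.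
exact: measurable_preimage.
Qed.

(** If all images of [0, 1] missed U, every term of the self-similarity relation for U would be the
    measure of a set outside [0, 1]. *)
Lemma supp_meets (U : set R) (x : R) : open U -> 0 <= x <= 1 -> U x ->
  exists (j : letter) y, 0 <= y <= 1 /\ U (contraction j y : R).
Proof.
case: (std) => _ _ _ suppI oU x01 Ux.
have mU0 : (0 < mu U)%E.
  by have : supp mu x by [rewrite suppI /= in_itv /=|]; apply.
apply: contrapT => /forallNP none; move: mU0; rewrite lt_neqAle => /andP[/eqP + _].
apply; rewrite -mu_fineK; last exact: open_measurable.
rewrite mu_self; last exact: open_measurable.
rewrite big1 // => j _; rewrite mu_outside ?mulr0 //.
  by apply: open_measurable; apply: open_contraction.
by move=> y Uy y01; apply: (none j); exists y.
Qed.

(** A neighbourhood of the image has measure at least p_j times that of its preimage, which is a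
    neighbourhood of x. *)
Lemma supp_contraction (j : letter) (x : R) : 0 <= x <= 1 ->
  0 <= (contraction j x : R) <= 1.
Proof.
case: (std) => ss _ _ suppI x01.
suff : supp mu (contraction j x) by rewrite suppI /= in_itv.
move=> U oU Ux; rewrite ss; last exact: open_measurable.
have : supp mu x by rewrite suppI /= in_itv.
move=> /(_ _ (open_contraction (j := j) oU) Ux) U0.
rewrite (bigD1 j) //= lte_paddr //.
  by apply: sume_ge0 => i _; rewrite mule_ge0 // lee_fin; apply/ltW/weight_gt0.
by rewrite mule_gt0 // lte_fin; apply: weight_gt0.
Qed.

Lemma shift_mono (i j : letter) : (i <= j)%N -> d i <= d j.
Proof.
rewrite leq_eqVlt => /predU1P[/val_inj ->//|ij].
exact/ltW/shift_increasing.
Qed.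

(** That the images lie in [0, 1] gives one inequality at each end. If the opposite one, or the gap
    condition, failed, an open set meeting [0, 1] would be missed by every image. *)
Lemma standard_unit_cover : unit_cover W.
Proof.
have d0ge : 0 <= d ord0.
  by have := @supp_contraction ord0 0; rewrite /contraction mulr0 add0r lexx ler01
    => /(_ erefl)/andP[].
have dmle : d ord_max <= 1 - rho.
  have := @supp_contraction ord_max 1; rewrite /contraction mulr1 lexx ler01
    => /(_ erefl)/andP[_]; lra.
have d0 : d ord0 = 0.
  apply/eqP; rewrite eq_le d0ge andbT leNgt; apply/negP => d0gt.
  have [j [y [/andP[y0 _] /=]]] :
      exists (j : letter) y, 0 <= y <= 1 /\ `]-oo, d ord0[%classic (contraction j y : R).
    by apply: (@supp_meets _ 0); rewrite ?lexx ?ler01 //= in_itv.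
  rewrite in_itv /= /contraction => h.
  have := shift_mono (leq0n j : (ord0 <= j)%N).
  have : 0 <= rho * y by rewrite mulr_ge0 // ltW.
  by lra.
have dm : d ord_max = 1 - rho.
  apply/eqP; rewrite eq_le dmle leNgt; apply/negP => dm.
  have [j [y [/andP[_ y1] /=]]] :
      exists (j : letter) y, 0 <= y <= 1 /\ `]d ord_max + rho, +oo[%classic (contraction j y : R).
    by apply: (@supp_meets _ 1); rewrite ?lexx ?ler01 //= in_itv /= andbT; lra.
  rewrite in_itv /= andbT /contraction => h.
  have := shift_mono (leq_ord j : (j <= (ord_max : letter))%N).
  have : rho * y <= rho * 1 by rewrite ler_wpM2l // ltW.
  by lra.
case: (std) => ss ft [pm pmin] suppI; split=> // i j ij.
rewrite leNgt; apply/negP => gap; have r0 := rho_gt0.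
have i0 := shift_mono (leq0n i : (ord0 <= i)%N).
have j1 := shift_mono (leq_ord j : (j <= (ord_max : letter))%N).
have [l [y [/andP[y0 y1] /=]]] :
    exists (l : letter) y, 0 <= y <= 1 /\ `]d i + rho, d j[%classic (contraction l y : R).
  apply: (@supp_meets _ ((d i + rho + d j) / 2)) => //=.
    by apply/andP; split; lra.
  by rewrite in_itv /=; apply/andP; split; lra.
rewrite in_itv /= /contraction => /andP[h1 h2].
have ry0 : 0 <= rho * y by rewrite mulr_ge0 // ltW.
have ry1 : rho * y <= rho * 1 by rewrite ler_wpM2l // ltW.
have [li|il] := leqP l i.
  by have := shift_mono li; lra.
by have jl : (j <= l)%N by [rewrite ij]; have := shift_mono jl; lra.
Qed.

End Support.

Section Iterate.
Context {R : realType} (W : coverIFS R).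
Variable mu : probability (measurableTypeR R) R.
Hypothesis std : standard_assumptions W mu.

Local Notation rho := (ratio W).

Lemma mu_wsum n A : measurable A ->
  fine (mu A) = wsum W n (fun t => fine (mu [set x | A (t + rho ^+ n * x)])).
Proof.
elim: n A => [|n IH] A mA.
  by congr (fine (mu _)); apply/seteqP; split=> x /=; rewrite expr0 mul1r add0r.
rewrite (mu_self std) //; apply: eq_bigr => j _; congr (_ * _).
rewrite IH; last exact: measurable_preimage.
apply: wsum_eq => w _ /=; congr (fine (mu _)).
by apply/seteqP; split=> x /=; rewrite /contraction exprS mulrDr mulrA addrAC.
Qed.

End Iterate.

(** * Net intervals *)

Section Consecutive.
Context {R : realType}.
Implicit Types (s : seq R) (D : R * R).

Lemma consecutiveP s D : sorted <%R s ->
  D \in zip s (behead s) <->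
  [/\ D.1 \in s, D.2 \in s, D.1 < D.2 &
      forall e, e \in s -> e <= D.1 \/ D.2 <= e].
Proof.
case: D => a b /=; elim: s => [|x [|y s] IH] /=.
- by move=> _; split=> // -[].
- by move=> _; split=> // -[]; rewrite !inE => /eqP -> /eqP ->; rewrite ltxx.
case/andP=> xy ys; have ysort : sorted <%R (y :: s) by [].
have ymin e : e \in y :: s -> y <= e.
  rewrite inE => /predU1P[->//|]; move: ys; rewrite (path_sortedE lt_trans).
  by case/andP=> /allP ya _ /ya /ltW.
have [{}IH1 IH2] := IH ysort; rewrite /= in_cons; split.
  case/predU1P=> [[-> ->]|/IH1[a1 b1 ab H]].
    split=> //; rewrite ?inE ?eqxx ?orbT // => e.
    by rewrite inE => /predU1P[->|/ymin]; [left|right].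
  split=> //; rewrite ?[_ \in x :: _]inE ?a1 ?b1 ?orbT // => e.
  rewrite inE => /predU1P[->|/H//]; left.
  exact: le_trans (ltW xy) (ymin _ a1).
case; rewrite in_cons => /predU1P[->|a1].
  rewrite in_cons => /predU1P[->|b1]; first by rewrite ltxx.
  move=> xb H; have [yx|by'] := H y ltac:(by rewrite !inE eqxx orbT).
    by have := lt_le_trans xy yx; rewrite ltxx.
  by rewrite (@le_anti _ _ b y) ?eqxx // by' ymin.
rewrite in_cons => /predU1P[->|b1] ab H.
  by have := lt_le_trans (lt_trans ab xy) (ymin _ a1); rewrite ltxx.
apply/orP; right; apply: IH2; split=> // e es; apply: H.
by rewrite inE es orbT.
Qed.

Lemma consecutive_sorted s : sorted <%R s ->
  sorted (fun D D' : R * R => D.1 < D'.1) (zip s (behead s)).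
Proof.
elim: s => [|x [|y [|z s]] IH] //= /andP[xy ys].
by rewrite xy; apply: IH.
Qed.

Lemma seq_max_le s (y : R) : (exists2 e, e \in s & e <= y) ->
  exists e, [/\ e \in s, e <= y & forall e', e' \in s -> e' <= y -> e' <= e].
Proof.
elim: s => [|x s IH]; first by case.
case: (boolP (has (fun e => e <= y) s)) => [/hasP hs _|/hasPn hs [e]].
  have [e [es ey em]] := IH hs.
  have [xy|yx] := leP x y; last first.
    exists e; rewrite inE es orbT; split=> // e'.
    by rewrite inE => /predU1P[->|/em//]; rewrite leNgt yx.
  have [xe|ex] := leP x e.
    exists e; rewrite inE es orbT; split=> // e'.
    by rewrite inE => /predU1P[->|/em].
  exists x; rewrite inE eqxx; split=> // e'.
  rewrite inE => /predU1P[->//|e's e'y]; apply: le_trans (ltW ex); exact: em.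
rewrite inE => /predU1P[->|/hs /negP//] xy.
exists x; rewrite inE eqxx; split=> // e'.
by rewrite inE => /predU1P[->//|/hs /negP].
Qed.

Lemma seq_min_gt s (y : R) : (exists2 e, e \in s & y < e) ->
  exists e, [/\ e \in s, y < e & forall e', e' \in s -> y < e' -> e <= e'].
Proof.
elim: s => [|x s IH]; first by case.
case: (boolP (has (fun e => y < e) s)) => [/hasP hs _|/hasPn hs [e]].
  have [e [es ey em]] := IH hs.
  have [xy|yx] := leP x y.
    exists e; rewrite inE es orbT; split=> // e'.
    by rewrite inE => /predU1P[->|/em//]; rewrite ltNge xy.
  have [xe|ex] := leP x e; last first.
    exists e; rewrite inE es orbT; split=> // e'.
    by rewrite inE => /predU1P[-> _|/em//]; apply: ltW.
  exists x; rewrite inE eqxx; split=> // e'.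
  rewrite inE => /predU1P[->//|e's e'y]; apply: le_trans xe _; exact: em.
rewrite inE => /predU1P[->|/hs /negP//] xy.
exists x; rewrite inE eqxx; split=> // e'.
by rewrite inE => /predU1P[->//|/hs /negP].
Qed.

Lemma seq_pos_min s :
  exists2 delta, 0 < delta & forall x, x \in s -> 0 < x -> delta <= x.
Proof.
elim: s => [|x s [e e0 eP]]; first by exists 1.
have [x0|x0] := ltP 0 x.
  exists (Num.min x e); first by rewrite lt_min x0.
  move=> y; rewrite inE => /predU1P[->|/eP + y0]; first by rewrite ge_min lexx.
  by move=> /(_ y0); rewrite ge_min orbC => ->.
exists e => // y; rewrite inE => /predU1P[->|/eP//].
by rewrite ltNge x0.
Qed.

End Consecutive.

Section NetIntervals.
Context {R : realType} (W : coverIFS R).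

Local Notation rho := (ratio W).
Local Notation d := (@shift R W).
Local Notation letter := 'I_(ifs_m W).+1.
Local Notation S := (@S_word R W).
Local Notation net := (net_intervals W).
Implicit Types (w u v : seq letter) (n : nat) (D E : R * R).

Let rho_lt1 : rho < 1 := ratio_lt1 W.
Let rX n : 0 < rho ^+ n := rhoX_gt0 W n.

Lemma endpointsP n e : e \in endpoints W n <->
  exists w, size w = n /\ (e = S w 0 \/ e = S w 0 + rho ^+ n).
Proof.
rewrite /endpoints mem_sort mem_undup mem_cat; split.
  by case/orP=> /mapP[w _ ->]; exists w; rewrite size_tuple; split=> //;
    [left|right; rewrite S_wordE size_tuple mulr1].
case=> w [sw]; have sw' : size w == n by apply/eqP.
case=> ->; apply/orP; [left|right]; apply/mapP; exists (Tuple sw');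
  rewrite ?mem_enum //=.
by rewrite [RHS]S_wordE sw mulr1.
Qed.

Lemma endpoints_sorted n : sorted <%R (endpoints W n).
Proof. by rewrite /endpoints sort_lt_sorted undup_uniq. Qed.

Lemma net_intervalsP n D : D \in net n <->
  [/\ D.1 \in endpoints W n, D.2 \in endpoints W n, D.1 < D.2 &
      forall e, e \in endpoints W n -> e <= D.1 \/ D.2 <= e].
Proof. exact/consecutiveP/endpoints_sorted. Qed.

Lemma net_intervals_sorted n :
  sorted (fun D D' : R * R => D.1 < D'.1) (net n).
Proof. exact/consecutive_sorted/endpoints_sorted. Qed.

Lemma endpoints_ge0 n e : e \in endpoints W n -> 0 <= e <= 1.
Proof.
case/endpointsP=> w [sw ew]; have := S_word_ge0 w; have := S_word_le1 w.
have := rX n; rewrite sw => r0 h1 h2.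
by case: ew => ->; apply/andP; split; lra.
Qed.

Lemma net_itv01 n D : D \in net n -> [/\ 0 <= D.1, D.1 < D.2 & D.2 <= 1].
Proof.
case/net_intervalsP=> /endpoints_ge0 /andP[a0 a1] /endpoints_ge0 /andP[b0 b1].
by split.
Qed.

Lemma endpointsS n e : e \in endpoints W n -> e \in endpoints W n.+1.
Proof.
case/endpointsP=> w [sw [->|->]]; apply/endpointsP.
  exists (rcons w ord0); rewrite size_rcons sw; split=> //; left.
  by rewrite S_word_rcons shift_first mulr0 addr0.
exists (rcons w ord_max); rewrite size_rcons sw; split=> //; right.
by rewrite S_word_rcons shift_last sw exprS; ring.
Qed.

Lemma endpoints_add n k e : e \in endpoints W n -> e \in endpoints W (n + k).
Proof. by elim: k => [|k IH]; rewrite ?addn0 // addnS => /IH/endpointsS. Qed.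

Lemma endpoints_mono n m e : (n <= m)%N ->
  e \in endpoints W n -> e \in endpoints W m.
Proof. by move=> /subnKC <-; exact: endpoints_add. Qed.

Lemma endpoint0 n : 0 \in endpoints W n.
Proof.
apply: (@endpoints_mono 0%N) => //; apply/endpointsP.
by exists [::]; split=> //; left.
Qed.

Lemma endpoint1 n : 1 \in endpoints W n.
Proof.
apply: (@endpoints_mono 0%N) => //; apply/endpointsP.
by exists [::]; split=> //; right; rewrite expr0 add0r.
Qed.

Lemma net_at n (y : R) : 0 <= y < 1 -> exists2 D, D \in net n & D.1 <= y < D.2.
Proof.
case/andP=> y0 y1.
have [a [aE ay amax]] : exists e, [/\ e \in endpoints W n, e <= y &
    forall e', e' \in endpoints W n -> e' <= y -> e' <= e].
  by apply: seq_max_le; exists 0 => //; apply: endpoint0.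
have [b [bE yb bmin]] : exists e, [/\ e \in endpoints W n, y < e &
    forall e', e' \in endpoints W n -> y < e' -> e <= e'].
  by apply: seq_min_gt; exists 1 => //; apply: endpoint1.
exists (a, b); last by rewrite /= ay.
apply/net_intervalsP; split=> //=; first exact: le_lt_trans yb.
by move=> e eE; have [ey|ye] := leP e y; [left; apply: amax|right; apply: bmin].
Qed.

Lemma net_endpoint n m D e : (n <= m)%N -> D \in net m ->
  e \in endpoints W n -> e <= D.1 \/ D.2 <= e.
Proof.
move=> nm /net_intervalsP[_ _ _ H] /(endpoints_mono nm); exact: H.
Qed.

Lemma word_start n w : size w = n -> S w 0 \in endpoints W n.
Proof. by move=> sw; apply/endpointsP; exists w; split=> //; left. Qed.

Lemma word_end n w : size w = n -> S w 0 + rho ^+ n \in endpoints W n.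
Proof. by move=> sw; apply/endpointsP; exists w; split=> //; right. Qed.

Definition covers n w D := (S w 0 <= D.1) && (D.2 <= S w 0 + rho ^+ n).

(** Endpoints of level n persist at later levels, so none lies inside D, and an image overlapping D
    must contain it. Later on, covering is mostly established by checking a mere overlap. *)
Lemma covers_meet n m w D : (n <= m)%N -> D \in net m -> size w = n ->
  S w 0 < D.2 -> D.1 < S w 0 + rho ^+ n -> covers n w D.
Proof.
move=> nm Dm sw wD Dw; apply/andP; split.
  by case: (net_endpoint nm Dm (word_start sw)) => // h; rewrite leNgt wD in h.
case: (net_endpoint nm Dm (word_end sw)) => // h.
by rewrite leNgt Dw in h.
Qed.

Lemma net_covered n D : D \in net n -> exists2 w, size w = n & covers n w D.
Proof.
move=> Dn; have [a0 ab b1] := net_itv01 Dn.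
have [w [sw /andP[wa aw]]] := cover_word W n (y := D.1)
  ltac:(by rewrite a0 (lt_le_trans ab b1)).
by exists w => //; apply: (covers_meet (leqnn n)) => //; apply: le_lt_trans ab.
Qed.

Lemma covers_cat n k u v D : size u = n -> size v = k ->
  covers (n + k) (u ++ v) D -> covers n u D.
Proof.
move=> su sv /andP[h1 h2]; have := S_word_cat_ge u v; have := S_word_cat_le u v.
rewrite size_cat su sv => g1 g2; apply/andP; split; lra.
Qed.

Lemma covers_rcons n u j D : size u = n ->
  covers n.+1 (rcons u j) D -> covers n u D.
Proof. by move=> su; rewrite -cats1 -[n.+1]addn1; apply: covers_cat. Qed.

Lemma net_overlap n m D E : (n <= m)%N -> E \in net n -> D \in net m ->
  D.1 < E.2 -> E.1 < D.2 -> itv_in D E.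
Proof.
move=> nm En Dm h1 h2; case/net_intervalsP: En => e1 e2 _ _; apply/andP; split.
  by case: (net_endpoint nm Dm e1) => // h; rewrite leNgt h2 in h.
by case: (net_endpoint nm Dm e2) => // h; rewrite leNgt h1 in h.
Qed.

Lemma net_overlap_eq n D E : E \in net n -> D \in net n ->
  D.1 < E.2 -> E.1 < D.2 -> D = E.
Proof.
move=> En Dn h1 h2.
have /andP[a1 a2] := net_overlap (leqnn n) En Dn h1 h2.
have /andP[b1 b2] := net_overlap (leqnn n) Dn En h2 h1.
case: D E a1 a2 b1 b2 {h1 h2 En Dn} => a b [a' b'] /= *.
by congr (_, _); apply: le_anti; apply/andP.
Qed.

Lemma net_in_uniq n m D E E' : (n <= m)%N -> D \in net m ->
  E \in net n -> E' \in net n -> itv_in D E -> itv_in D E' -> E = E'.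
Proof.
rewrite /itv_in => nm /net_itv01[_ ab _] En En' /andP[a1 a2] /andP[b1 b2].
by apply: (net_overlap_eq En' En); lra.
Qed.

Lemma net_ancestor n m D : (n <= m)%N -> D \in net m ->
  exists2 E, E \in net n & itv_in D E.
Proof.
move=> nm Dm; have [a0 ab b1] := net_itv01 Dm.
have [E En /andP[h1 h2]] := net_at n (y := D.1)
  ltac:(by rewrite a0 (lt_le_trans ab b1)).
by exists E => //; apply: net_overlap En Dm _ _ => //; apply: le_lt_trans ab.
Qed.

Lemma parentP n D : D \in net n.+1 ->
  parent W n D \in net n /\ itv_in D (parent W n D).
Proof.
move=> Dn; have [E En DE] := net_ancestor (leqnSn n) Dn.
suff : parent W n D \in [seq E <- net n | itv_in D E].
  by rewrite mem_filter => /andP[].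
rewrite /parent; have : E \in [seq E <- net n | itv_in D E].
  by rewrite mem_filter DE.
by case: [seq E <- net n | itv_in D E] => //= *; rewrite inE eqxx.
Qed.

Lemma parent_eq n D E : D \in net n.+1 -> E \in net n -> itv_in D E ->
  parent W n D = E.
Proof.
move=> Dn En DE; have [Pn DP] := parentP Dn.
exact: net_in_uniq (leqnSn n) Dn Pn En DP DE.
Qed.

Lemma childrenP n D E : E \in net n ->
  D \in children W n E <-> D \in net n.+1 /\ itv_in D E.
Proof.
move=> En; rewrite mem_filter; split.
  by case/andP=> /eqP <- Dn; split=> //; have [] := parentP Dn.
by case=> Dn DE; rewrite Dn andbT; apply/eqP/parent_eq.
Qed.

Lemma children_sorted n E :
  sorted (fun D D' : R * R => D.1 < D'.1) (children W n E).
Proof.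
apply: sorted_filter (net_intervals_sorted _).
by move=> x y z; apply: lt_trans.
Qed.

Lemma mem_V n D y : y \in V W n D <->
  exists w, [/\ size w = n, covers n w D & y = rho ^- n * (D.1 - S w 0)].
Proof.
rewrite /V mem_sort mem_undup; split.
  case/mapP=> w; rewrite mem_filter => /andP[cw _] ->.
  exists w; rewrite size_tuple; split=> //.
  by move: cw; rewrite /itv_in /= /covers [in X in _ && X -> _]S_wordE size_tuple mulr1.
case=> w [sw cw ->]; have sw' : size w == n by apply/eqP.
apply/mapP; exists (Tuple sw') => //; rewrite mem_filter mem_enum andbT.
by rewrite /itv_in /= [X in _ && (_ <= X)]S_wordE sw mulr1.
Qed.

Lemma V_sorted n D : sorted <%R (V W n D).
Proof. by rewrite /V sort_lt_sorted undup_uniq. Qed.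

Lemma V_uniq n D : uniq (V W n D).
Proof. by rewrite /V sort_uniq undup_uniq. Qed.

(** After the normalization the constant c of finite type is 1, so relative positions in [0, 1] fall
    into F. Finite type only compares starting points; if e is the end of a word interval, its
    position is 1 minus such a difference. *)
Lemma finite_positions : exists Gs : seq R, forall n w e, size w = n ->
  e \in endpoints W n -> 0 <= e - S w 0 <= rho ^+ n ->
  rho ^- n * (e - S w 0) \in Gs.
Proof.
have [F [/finite_seqP[s Fs] F0 FP]] := unit_cover_finite_type (cover_ifsP W).
have c1 : (1 - rho)^-1 * (d ord_max - d ord0) = 1.
  by rewrite shift_last shift_first subr0 mulVf // gt_eqF // subr_gt0.
have key n w w' : size w = n -> size w' = n -> 0 <= S w 0 - S w' 0 <= rho ^+ n ->
    rho ^- n * (S w 0 - S w' 0) \in 0 :: s.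
  (* Finite type says nothing at level 0, where the position is 0; hence the 0 in front of [s]. *)
  case: n => [|n] sw sw' /andP[h0 h1].
    by rewrite (size0nil sw) (size0nil sw') subrr mulr0 inE eqxx.
  have sw1 : size w == n.+1 by apply/eqP.
  have sw1' : size w' == n.+1 by apply/eqP.
  have := FP n.+1 (ltn0Sn n) (Tuple sw1) (Tuple sw1'); rewrite /= c1 ger0_norm //.
  case; last by rewrite Fs /= inE => ->; rewrite orbT.
  by rewrite ltr_pdivlMl // mulr1 ltNge h1.
exists ((0 :: s) ++ [seq 1 - g | g <- 0 :: s]) => n w e sw /endpointsP[w' [sw' ee]] h.
rewrite mem_cat; case: ee => ee; apply/orP; [left|right].
  by rewrite ee; apply: key; rewrite -?ee.
apply/mapP; exists (rho ^- n * (S w 0 - S w' 0)).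
  by apply: key => //; move: h; rewrite ee => /andP[? ?]; apply/andP; split; lra.
by rewrite ee -[1](mulVf (lt0r_neq0 (rX n))) -mulrBr; congr (_ * _); ring.
Qed.

(* Both points are compared with a word interval containing e; if it does not
   contain e', it ends before e'. *)
Lemma endpoint_gap : exists2 delta, 0 < delta &
  forall n e e', e \in endpoints W n -> e' \in endpoints W n -> e < e' ->
  delta * rho ^+ n <= e' - e.
Proof.
have [Gs GP] := finite_positions.
have [delta d0 dP] := seq_pos_min [seq g' - g | g <- Gs, g' <- 1 :: Gs].
exists delta => // n e e' eE e'E ee'.
have /andP[e0 _] := endpoints_ge0 eE; have /andP[_ e1] := endpoints_ge0 e'E.
have [w [sw /andP[we ew]]] := cover_word W n (y := e)
  ltac:(by rewrite e0 (lt_le_trans ee' e1)).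
have g1 := GP n w e sw eE ltac:(by apply/andP; split; lra).
have [e'w|we'] := leP e' (S w 0 + rho ^+ n).
  have g2 := GP n w e' sw e'E ltac:(by apply/andP; split; lra).
  have := dP _ (allpairs_f (fun g g' => g' - g) g1 (mem_behead (s := 1 :: Gs) g2)).
  rewrite -mulrBr -ler_pdivlMr // [_ / rho ^+ n]mulrC.
  have -> : e' - S w 0 - (e - S w 0) = e' - e by ring.
  by apply; rewrite mulr_gt0 ?invr_gt0 // subr_gt0.
have := dP _ (allpairs_f (fun g g' => g' - g) g1 (mem_head 1 Gs)).
have -> : 1 - rho ^- n * (e - S w 0) = rho ^- n * (S w 0 + rho ^+ n - e).
  by rewrite -[1](mulVf (lt0r_neq0 (rX n))) -mulrBr; congr (_ * _); ring.
move=> /(_ _)/wrap[]; first by rewrite mulr_gt0 ?invr_gt0 // subr_gt0.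
by rewrite [rho ^- n * _]mulrC ler_pdivlMr // => h; apply: (le_trans h); lra.
Qed.

End NetIntervals.

(** * Translation invariance of the net structure *)

Section Transfer.
Context {R : realType} (W : coverIFS R).

Local Notation rho := (ratio W).
Local Notation d := (@shift R W).
Local Notation p := (@weight R W).
Local Notation letter := 'I_(ifs_m W).+1.
Local Notation S := (@S_word R W).
Local Notation net := (net_intervals W).
Implicit Types (w u v : seq letter) (n : nat) (D E : R * R).

Let rho_gt0 : 0 < rho := ratio_gt0 W.
Let rho_lt1 : rho < 1 := ratio_lt1 W.
Let rX n : 0 < rho ^+ n := rhoX_gt0 W n.
Let rX0 n : rho ^+ n != 0.
Proof. exact: lt0r_neq0. Qed.

(** In this coordinate the subdivision of E depends only on its length and its neighbours. A
    neighbour y of E is a word starting at - y. *)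
Definition rel_pos n E (x : R) := rho ^- n * (x - E.1).

Lemma rel_posK n E x : E.1 + rho ^+ n * rel_pos n E x = x.
Proof. by rewrite /rel_pos mulVKf // addrC subrK. Qed.

Lemma rel_pos_le n E x y : (rel_pos n E x <= rel_pos n E y) = (x <= y).
Proof. by rewrite /rel_pos ler_pM2l ?invr_gt0 // lerD2r. Qed.

Lemma rel_pos_lt n E x y : (rel_pos n E x < rel_pos n E y) = (x < y).
Proof. by rewrite /rel_pos ltr_pM2l ?invr_gt0 // ltrD2r. Qed.

Lemma rel_pos_start n E : rel_pos n E E.1 = 0.
Proof. by rewrite /rel_pos subrr mulr0. Qed.

Lemma rel_pos_end n E : rel_pos n E E.2 = ell W n E.
Proof. by []. Qed.

Lemma V_word n E y : y \in V W n E ->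
  exists w, [/\ size w = n, covers n w E & S w 0 = E.1 - rho ^+ n * y].
Proof.
case/mem_V=> w [sw cw ->]; exists w; split=> //.
by rewrite mulVKf //; ring.
Qed.

Lemma word_V n E w : size w = n -> covers n w E ->
  - rel_pos n E (S w 0) \in V W n E.
Proof.
by move=> sw cw; apply/mem_V; exists w; split=> //; rewrite /rel_pos; ring.
Qed.

Lemma word_rel_pos n E w : S w 0 = E.1 - rho ^+ n * - rel_pos n E (S w 0).
Proof. by rewrite mulrN opprK rel_posK. Qed.

(** The endpoints of level n + 1 inside E in the coordinate [rel_pos]: a neighbour y starts at - y,
    so its image under the letter j is the interval from d j - y to d j - y + rho. *)
Definition rel_endpoint (l : R) (s : seq R) (z : R) : Prop :=
  [\/ z = 0, z = l |
      exists y (j : letter), y \in s /\ (z = d j - y \/ z = d j - y + rho)].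

Lemma rel_endpointP n E x : E \in net n -> E.1 <= x <= E.2 ->
  x \in endpoints W n.+1 <-> rel_endpoint (ell W n E) (V W n E) (rel_pos n E x).
Proof.
move=> En /andP[Ex xE]; split; last first.
  have /net_intervalsP[e1 e2 _ _] := En.
  case=> [z0|zl|[y [j [/V_word[w [sw cw yw]] zy]]]].
  - by rewrite -(rel_posK n E x) z0 mulr0 addr0; apply: endpointsS.
  - rewrite -(rel_posK n E x) zl -rel_pos_end rel_posK; exact: endpointsS.
  apply/endpointsP; exists (rcons w j); rewrite size_rcons sw; split=> //.
  rewrite -(rel_posK n E x) S_word_rcons yw sw exprS.
  by case: zy => ->; [left|right]; ring.
case/endpointsP=> w' [sw' ee].
have [->|xE1] := eqVneq x E.1; first by rewrite rel_pos_start; constructor 1.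
have [->|xE2] := eqVneq x E.2; first by constructor 2.
have Ex' : E.1 < x by rewrite lt_neqAle eq_sym xE1.
have xE' : x < E.2 by rewrite lt_neqAle xE2.
constructor 3; case/lastP: w' sw' ee => // w j; rewrite size_rcons => -[sw].
have r1 : rho ^+ n.+1 <= rho ^+ n.
  by rewrite exprS -[leRHS]mul1r ler_wpM2r ?exprn_ge0 // ltW.
have wj0 := S_word_cat_ge w [:: j]; have wj1 := S_word_cat_le w [:: j].
rewrite cats1 size_rcons sw in wj0 wj1 *.
(* The interval of w contains x, an interior point of E, and so overlaps E. *)
move=> ee; have cw : covers n w E.
  by apply: (covers_meet (leqnn n)) => //; have := rX n.+1; case: ee => ee; lra.
exists (- rel_pos n E (S w 0)), j; split; first exact: word_V.
rewrite /rel_pos opprK; case: ee => ->; [left|right];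
  by rewrite S_word_rcons sw ?exprS; move: (rho ^+ n) (rX0 n) => q q0; field.
Qed.

(** The right-hand side mentions E and D only through V and [rel_pos], so that it can be carried
    over to any interval of the same shape. *)
Lemma V_child n E D y : E \in net n -> D \in net n.+1 -> itv_in D E ->
  y \in V W n.+1 D <-> exists x (j : letter), [/\ x \in V W n E,
    rho * y = rel_pos n E D.1 + x - d j, 0 <= y &
    rel_pos n E D.2 <= d j - x + rho].
Proof.
move=> En Dn DE; split.
  case/mem_V=> w' [sw' cw' ->]; case/lastP: w' sw' cw' => // w j.
  rewrite size_rcons => -[sw] cw; have := covers_rcons sw cw.
  move=> /andP[w1 w2]; have [D1 D2 D3] := net_itv01 Dn.
  move/andP: (DE) => [DE1 DE2].
  have cwE : covers n w E by apply: (covers_meet (leqnn n)) => //; lra.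
  exists (- rel_pos n E (S w 0)), j; case/andP: cw => c1 c2; split.
  - exact: word_V.
  - rewrite S_word_rcons sw /rel_pos exprS.
    move: (rho ^+ n) (rX0 n) => q q0; field.
    by rewrite q0 lt0r_neq0.
  - by rewrite mulr_ge0 ?invr_ge0 ?subr_ge0 // ltW.
  rewrite opprK -(ler_pM2l (rX n)) -(lerD2l E.1) rel_posK (le_trans c2) //.
  rewrite S_word_rcons sw /rel_pos exprS.
  rewrite le_eqVlt; apply/orP; left; apply/eqP.
  by move: (rho ^+ n) (rX0 n) => q q0; field.
case=> x [j [/V_word[w [sw cw xw]] yE y0 h]].
have yE' : rho ^+ n.+1 * y = D.1 - E.1 + rho ^+ n * (x - d j).
  rewrite exprSr -mulrA yE /rel_pos.
  by move: (rho ^+ n) (rX0 n) => q q0; field.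
have wj : S (rcons w j) 0 = D.1 - rho ^+ n.+1 * y.
  by rewrite S_word_rcons sw xw yE'; ring.
apply/mem_V; exists (rcons w j); rewrite size_rcons sw; split=> //.
  rewrite /covers wj; apply/andP; split.
    by rewrite gerBl mulr_ge0 // ltW.
  rewrite -(ler_pM2l (rX n)) -(lerD2l E.1) rel_posK in h.
  by apply: (le_trans h); rewrite yE' exprS; lra.
by rewrite wj opprB addrC subrK mulKf.
Qed.

Section Move.
Variables (n1 n2 : nat) (E1 E2 : R * R).

Definition move_pt (x : R) : R := E2.1 + rho ^+ n2 * rel_pos n1 E1 x.

Definition move_itv (D : R * R) : R * R := (move_pt D.1, move_pt D.2).

Lemma rel_pos_move x : rel_pos n2 E2 (move_pt x) = rel_pos n1 E1 x.
Proof. by rewrite /move_pt {1}/rel_pos [E2.1 + _]addrC addrK mulKf. Qed.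

Lemma move_pt_le x y : (move_pt x <= move_pt y) = (x <= y).
Proof. by rewrite -(rel_pos_le n2 E2) !rel_pos_move rel_pos_le. Qed.

Lemma move_pt_lt x y : (move_pt x < move_pt y) = (x < y).
Proof. by rewrite -(rel_pos_lt n2 E2) !rel_pos_move rel_pos_lt. Qed.

Lemma move_pt_inj : injective move_pt.
Proof.
move=> x y xy; apply/eqP.
by rewrite eq_le -(move_pt_le x y) -(move_pt_le y x) xy lexx.
Qed.

Lemma move_itv_inj : injective move_itv.
Proof. by case=> a b [a' b'] [/move_pt_inj -> /move_pt_inj ->]. Qed.

End Move.

Lemma move_ptK n1 n2 E1 E2 x : move_pt n2 n1 E2 E1 (move_pt n1 n2 E1 E2 x) = x.
Proof. by rewrite {1}/move_pt rel_pos_move rel_posK. Qed.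

Lemma move_itvK n1 n2 E1 E2 D : move_itv n2 n1 E2 E1 (move_itv n1 n2 E1 E2 D) = D.
Proof. by case: D => a b; rewrite /move_itv /= !move_ptK. Qed.

Definition same_shape n1 E1 n2 E2 :=
  [/\ E1 \in net n1, E2 \in net n2, ell W n1 E1 = ell W n2 E2 &
      V W n1 E1 = V W n2 E2].

Lemma same_shape_sym n1 E1 n2 E2 :
  same_shape n1 E1 n2 E2 -> same_shape n2 E2 n1 E1.
Proof. by case=> *; split. Qed.

Section SameShape.
Variables (n1 n2 : nat) (E1 E2 : R * R).
Hypothesis shE : same_shape n1 E1 n2 E2.
Local Notation mpt := (move_pt n1 n2 E1 E2).

Let E1n : E1 \in net n1. Proof. by case: shE. Qed.
Let E2n : E2 \in net n2. Proof. by case: shE. Qed.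

Lemma move_pt_start : mpt E1.1 = E2.1.
Proof. by rewrite /move_pt rel_pos_start mulr0 addr0. Qed.

Lemma move_pt_end : mpt E1.2 = E2.2.
Proof.
by case: shE => _ _ h _; rewrite /move_pt rel_pos_end h -rel_pos_end rel_posK.
Qed.

Lemma move_pt_in x : (E2.1 <= mpt x <= E2.2) = (E1.1 <= x <= E1.2).
Proof. by rewrite -move_pt_start -move_pt_end !move_pt_le. Qed.

Lemma move_endpoint x : E1.1 <= x <= E1.2 ->
  x \in endpoints W n1.+1 -> mpt x \in endpoints W n2.+1.
Proof.
move=> xE /(rel_endpointP E1n xE) h; apply/(rel_endpointP E2n).
  by rewrite move_pt_in.
by rewrite rel_pos_move; case: shE => _ _ <- <-.
Qed.

End SameShape.

Lemma move_child n1 E1 n2 E2 D : same_shape n1 E1 n2 E2 ->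
  D \in children W n1 E1 -> move_itv n1 n2 E1 E2 D \in children W n2 E2.
Proof.
move=> sh; have sh' := same_shape_sym sh; have [E1n E2n _ _] := sh.
case/(childrenP _ E1n)=> /net_intervalsP[D1 D2 DD H] /andP[h1 h2].
have in1 : E1.1 <= D.1 <= E1.2 by apply/andP; split; lra.
have in2 : E1.1 <= D.2 <= E1.2 by apply/andP; split; lra.
apply/(childrenP _ E2n); split; last first.
  rewrite /itv_in /=; rewrite -(move_pt_in sh) in in1.
  by rewrite -(move_pt_in sh) in in2; case/andP: in1 => ->; case/andP: in2.
apply/net_intervalsP; split=> /=.
- exact: move_endpoint.
- exact: move_endpoint.
- by rewrite move_pt_lt.
move=> e eE; have [h|h] := leP e (move_pt n1 n2 E1 E2 D.1); first by left.
have [h'|h'] := leP (move_pt n1 n2 E1 E2 D.2) e; first by right.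
have ein : E2.1 <= e <= E2.2.
  rewrite -(move_pt_in sh) in in1; rewrite -(move_pt_in sh) in in2.
  by case/andP: in1; case/andP: in2 => ? ? ? ?; apply/andP; split; lra.
have := H _ (move_endpoint sh' ein eE).
rewrite -(move_pt_le n1 n2 E1 E2 _ D.1) -(move_pt_le n1 n2 E1 E2 D.2).
by rewrite !move_ptK !leNgt h h' => -[].
Qed.

(** Equality of lists, not only of sets, is needed because positions are indices; both lists are
    sorted by left ends and the affine map is increasing. *)
Lemma children_move n1 E1 n2 E2 : same_shape n1 E1 n2 E2 ->
  children W n2 E2 = [seq move_itv n1 n2 E1 E2 D | D <- children W n1 E1].
Proof.
move=> sh; apply: (irr_sorted_eq (leT := fun D D' : R * R => D.1 < D'.1)).
- by move=> x y z; apply: lt_trans.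
- by move=> x; rewrite ltxx.
- exact: children_sorted.
- rewrite sorted_map; apply: sub_sorted (children_sorted _ _ _) => D D'.
  by rewrite /= move_pt_lt.
move=> D; apply/idP/mapP => [DE|[D' DE ->]]; last exact: move_child.
exists (move_itv n2 n1 E2 E1 D); last by rewrite move_itvK.
exact: move_child (same_shape_sym sh) DE.
Qed.

Lemma move_ell n1 E1 n2 E2 D :
  ell W n2.+1 (move_itv n1 n2 E1 E2 D) = ell W n1.+1 D.
Proof.
rewrite /ell /move_itv /move_pt /rel_pos /= !exprS.
have := rX0 n1; have := rX0 n2; move: (rho ^+ n1) (rho ^+ n2) => a b b0 a0.
by field; rewrite a0 b0 lt0r_neq0.
Qed.

Lemma move_V n1 E1 n2 E2 D : same_shape n1 E1 n2 E2 ->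
  D \in children W n1 E1 ->
  V W n2.+1 (move_itv n1 n2 E1 E2 D) = V W n1.+1 D.
Proof.
move=> sh DE; have DE' := move_child sh DE; have [E1n E2n _ VE] := sh.
move/(childrenP _ E1n): DE => [Dn DE]; move/(childrenP _ E2n): DE' => [Dn' DE'].
apply: lt_sorted_eq; rewrite ?V_sorted // => y; apply/idP/idP.
  move/(V_child _ E2n Dn' DE') => h; apply/(V_child _ E1n Dn DE).
  by rewrite VE; move: h; rewrite /= !rel_pos_move.
move/(V_child _ E1n Dn DE) => h; apply/(V_child _ E2n Dn' DE').
by rewrite -VE /= !rel_pos_move.
Qed.

Lemma childP n E D : D \in children W n E -> parent W n D = E.
Proof. by rewrite mem_filter => /andP[/eqP]. Qed.

Lemma move_characteristic n1 E1 n2 E2 D : same_shape n1 E1 n2 E2 ->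
  D \in children W n1 E1 ->
  characteristic W n2.+1 (move_itv n1 n2 E1 E2 D) = characteristic W n1.+1 D.
Proof.
move=> sh DE; have DE' := move_child sh DE.
rewrite /characteristic move_ell move_V //; congr (_, _, _).
rewrite /position (childP DE) (childP DE') (children_move sh) filter_map.
rewrite index_map; last exact: move_itv_inj.
congr (index _ _).+1; apply: eq_in_filter => D' D'E /=.
by rewrite !move_ell !move_V.
Qed.

(** This is the purpose of the third component of a characteristic vector: it numbers the siblings
    of equal length and neighbours, so that a vector singles out one child. *)
Lemma child_characteristic_inj n E D D' : D \in children W n E ->
  D' \in children W n E ->
  characteristic W n.+1 D = characteristic W n.+1 D' -> D = D'.
Proof.
move=> DE D'E [el vv]; rewrite /position (childP DE) (childP D'E) el vv.
set L := seq.filter _ _ => ii.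
have DL : D \in L by rewrite mem_filter el vv !eqxx.
have D'L : D' \in L by rewrite mem_filter !eqxx.
by rewrite -(nth_index D DL) ii nth_index.
Qed.

Lemma characteristic_shape n1 E1 n2 E2 : E1 \in net n1 -> E2 \in net n2 ->
  characteristic W n1 E1 = characteristic W n2 E2 -> same_shape n1 E1 n2 E2.
Proof. by move=> ? ? []. Qed.

Lemma realizesP alpha beta n D : realizes W alpha beta (n, D) <->
  exists E, [/\ E \in net n, D \in children W n E,
    characteristic W n E = alpha & characteristic W n.+1 D = beta].
Proof.
split=> [[/= Dn Pa Db]|[E [En DE Ea Db]]].
  have [Pn DP] := parentP Dn; exists (parent W n D); split=> //.
  exact/childrenP.
have [Dn DE'] := (childrenP _ En).1 DE.
by split=> //=; rewrite (childP DE).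
Qed.

Lemma realizes_transfer alpha beta n1 D1 n2 E2 :
  realizes W alpha beta (n1, D1) -> E2 \in net n2 ->
  characteristic W n2 E2 = alpha ->
  exists D2, [/\ realizes W alpha beta (n2, D2), D2 \in children W n2 E2 &
    forall x, rel_pos n2 E2 (move_pt n1 n2 (parent W n1 D1) E2 x) =
              rel_pos n1 (parent W n1 D1) x /\
              D2 = move_itv n1 n2 (parent W n1 D1) E2 D1].
Proof.
case/realizesP=> E1 [E1n DE1 Ea Db] E2n E2a.
have sh : same_shape n1 E1 n2 E2 by apply: characteristic_shape; rewrite ?Ea.
exists (move_itv n1 n2 E1 E2 D1); rewrite (childP DE1); split.
- apply/realizesP; exists E2; split=> //; first exact: move_child.
  by rewrite move_characteristic.
- exact: move_child.
- by move=> x; rewrite rel_pos_move.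
Qed.

(** Independence of the chosen realization, hence the well-definedness of the transition matrix. *)
Lemma realizes_rel_pos alpha beta n1 D1 n2 D2 :
  realizes W alpha beta (n1, D1) -> realizes W alpha beta (n2, D2) ->
  rel_pos n1 (parent W n1 D1) D1.1 = rel_pos n2 (parent W n2 D2) D2.1.
Proof.
case/realizesP=> E1 [E1n DE1 Ea Db] /realizesP[E2 [E2n DE2 Ea2 Db2]].
have sh : same_shape n1 E1 n2 E2 by apply: characteristic_shape; rewrite ?Ea.
rewrite (childP DE1) (childP DE2).
suff -> : D2 = move_itv n1 n2 E1 E2 D1 by rewrite /= rel_pos_move.
apply: child_characteristic_inj DE2 (move_child sh DE1) _.
by rewrite move_characteristic // Db Db2.
Qed.

(* The transition matrix, indexed by the neighbours themselves instead of their
   positions. *)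
Definition kernel (alpha beta : charvec R) (x z : R) : R :=
  let: (n, D) := xget (0%N, (0, 1)) (realizes W alpha beta) in
  if [pick l : letter | (parent W n D).1 - rho ^+ n * x + rho ^+ n * d l
                        == D.1 - rho ^+ n.+1 * z] is Some l
  then (p ord0)^-1 * p l else 0.

Lemma transitionE alpha beta i j :
  transition W alpha beta i j = kernel alpha beta (cv_nbrs alpha)`_i (cv_nbrs beta)`_j.
Proof. by rewrite /transition /kernel; case: xget => n D; rewrite mxE. Qed.

(** The shifts are distinct, so at most one letter contributes and the choice becomes a sum, the
    form that arises when the last letter of a word is summed out. *)
Lemma kernelE alpha beta n D x z : realizes W alpha beta (n, D) ->
  kernel alpha beta x z =
  \sum_l p l / p ord0 * (d l - x == rel_pos n (parent W n D) D.1 - rho * z)%:R.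
Proof.
move=> rD; rewrite /kernel; case: xgetP => [[n' D'] _ rD'|/(_ (n, D))//].
rewrite (realizes_rel_pos rD rD').
have eqv l : ((parent W n' D').1 - rho ^+ n' * x + rho ^+ n' * d l
    == D'.1 - rho ^+ n'.+1 * z) = (d l - x == rel_pos n' (parent W n' D') D'.1 - rho * z).
  rewrite -[in LHS](rel_posK n' (parent W n' D') D'.1) exprSr.
  apply/eqP/eqP => h; last first.
    have := congr1 ( *%R (rho ^+ n')) h; lra.
  by apply: (mulfI (rX0 n')); lra.
case: pickP => [l0 /=|nol]; last by rewrite big1 // => l _; rewrite -eqv nol mulr0.
rewrite eqv => h; rewrite (bigD1 l0) //= h mulr1 mulrC big1 ?addr0 // => l ll0.
case: eqP => [hl|]; last by rewrite mulr0.
by move: ll0; rewrite (shift_inj (addIr (- x) (etrans hl (esym (eqP h))))) eqxx.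
Qed.

End Transfer.

(** * Path kernels and masses of words *)

Section PathKernel.
Context {R : realType} (W : coverIFS R).

Local Notation rho := (ratio W).
Local Notation d := (@shift R W).
Local Notation p := (@weight R W).
Local Notation letter := 'I_(ifs_m W).+1.
Local Notation S := (@S_word R W).
Local Notation net := (net_intervals W).
Local Notation chr := (characteristic W).
Implicit Types (w u v : seq letter) (n : nat) (D E : R * R).
Implicit Types (alpha beta : charvec R) (s : seq (charvec R)).

Let rho_gt0 : 0 < rho := ratio_gt0 W.
Let rX n : 0 < rho ^+ n := rhoX_gt0 W n.
Let rX0 n : rho ^+ n != 0.
Proof. exact: lt0r_neq0. Qed.
Let p_gt0 j : 0 < p j := weight_gt0 j.

Definition step alpha beta : bool := `[< is_child W alpha beta >].

(** Products of kernels have real numbers as indices, whereas the type of [path_transition] depends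
    on the path; concatenation is therefore painless here. *)
Fixpoint pker alpha s (x y : R) : R :=
  if s is beta :: s' then
    \sum_(z <- cv_nbrs beta) kernel W alpha beta x z * pker beta s' z y
  else (x == y)%:R.

Lemma kernel_ge0 alpha beta x z : 0 <= kernel W alpha beta x z.
Proof.
rewrite /kernel; case: xget => n D; case: pickP => // l _.
by rewrite mulr_ge0 ?invr_ge0 // ltW.
Qed.

Lemma pker_ge0 alpha s x y : 0 <= pker alpha s x y.
Proof.
elim: s alpha x => [|beta s IH] alpha x /=; first by rewrite ler0n.
by apply: sumr_ge0 => z _; rewrite mulr_ge0 ?kernel_ge0.
Qed.

Lemma path_transitionE alpha s i j : uniq (cv_nbrs (last alpha s)) ->
  path_transition W alpha s i j =
  pker alpha s (cv_nbrs alpha)`_i (cv_nbrs (last alpha s))`_j.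
Proof.
elim: s alpha i j => [|beta s IH] alpha i j /= us.
  by rewrite mxE nth_uniq.
rewrite mxE (big_nth 0) big_mkord; apply: eq_bigr => k _.
by rewrite transitionE IH.
Qed.

Lemma step_shape alpha beta : step alpha beta -> uniq (cv_nbrs beta).
Proof. by move/asboolP=> [nD [_ _ <-]]; exact: V_uniq. Qed.

Lemma Omega_uniq alpha : Omega W alpha -> uniq (cv_nbrs alpha).
Proof. by case=> n [D [_ ->]]; exact: V_uniq. Qed.

Lemma step_Omega alpha beta : step alpha beta -> Omega W beta.
Proof. by move/asboolP=> [[n D] [/= Dn _ <-]]; exists n.+1, D. Qed.

Lemma pker_cat alpha s s' x y :
  path step alpha s -> uniq (cv_nbrs alpha) -> x \in cv_nbrs alpha ->
  pker alpha (s ++ s') x y =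
  \sum_(z <- cv_nbrs (last alpha s)) pker alpha s x z * pker (last alpha s) s' z y.
Proof.
elim: s alpha x => [|beta s IH] alpha x /= => [_ ua xa|/andP[ab bs] ua xa].
  rewrite (bigD1_seq x) //= eqxx mul1r big1 ?addr0 // => z /negPf xz.
  by rewrite eq_sym xz mul0r.
under [RHS]eq_bigr do rewrite mulr_suml.
rewrite exchange_big /= big_seq [RHS]big_seq; apply: eq_bigr => z zb.
rewrite IH ?(step_shape ab) // mulr_sumr.
by apply: eq_bigr => z' _; rewrite mulrA.
Qed.

Fixpoint desc n D s D' : Prop :=
  if s is beta :: s' then
    exists D1, [/\ D1 \in children W n D, chr n.+1 D1 = beta & desc n.+1 D1 s' D']
  else D' = D.

Lemma child_step n E D : E \in net n -> D \in children W n E ->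
  step (chr n E) (chr n.+1 D).
Proof.
by move=> En DE; apply/asboolP; exists (n, D); apply/realizesP; exists E.
Qed.

Lemma step_child n E beta : E \in net n -> step (chr n E) beta ->
  exists2 D, D \in children W n E & chr n.+1 D = beta.
Proof.
move=> En /asboolP[[n1 D1] rD1].
have [D2 [/realizesP[E' [_ _ _ <-]] DE _]] := realizes_transfer rD1 En erefl.
by exists D2.
Qed.

Lemma descP n D s D' : D \in net n -> desc n D s D' ->
  [/\ path step (chr n D) s, D' \in net (n + size s), itv_in D' D &
      chr (n + size s) D' = last (chr n D) s].
Proof.
elim: s n D => [|beta s IH] n D Dn /=.
  by move=> ->; rewrite addn0 /itv_in !lexx.
case=> D1 [D1D <- DD']; have [D1n DD1] := (childrenP _ Dn).1 D1D.
have [ps D'n D'D ee] := IH _ _ D1n DD'; rewrite addnS -addSn; split=> //.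
  by rewrite (child_step Dn D1D).
move: D'D DD1; rewrite /itv_in => /andP[? ?] /andP[? ?].
by apply/andP; split; lra.
Qed.

Lemma desc_ancestor n D k D' : D \in net n -> D' \in net (n + k) ->
  itv_in D' D -> exists2 s, size s = k & desc n D s D'.
Proof.
elim: k n D => [|k IH] n D Dn.
  rewrite addn0 => D'n DD'; exists [::] => //=; have [_ ab _] := net_itv01 D'n.
  by apply: (net_in_uniq (leqnn n) D'n D'n Dn) => //; rewrite /itv_in !lexx.
rewrite addnS -addSn => D'n DD'.
have [D1 D1n D'D1] := net_ancestor (leq_addr k n.+1) D'n.
have [s sk ds] := IH _ _ D1n D'n D'D1.
exists (chr n.+1 D1 :: s) => /=; first by rewrite sk.
exists D1; split=> //; apply/(childrenP _ Dn); split=> //.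
have [_ ab _] := net_itv01 D'n; move: DD' D'D1; rewrite /itv_in.
move=> /andP[? ?] /andP[? ?].
by apply: (net_overlap (leqnSn n) Dn D1n); lra.
Qed.

(* The substitute for mu D: the masses of the neighbours of D, without the
   weights mu S_w^-1 D. *)
Definition cover_mass n D :=
  wsum W n (fun t => ((t <= D.1) && (D.2 <= t + rho ^+ n))%:R).

(** The mass of the single neighbour y, since all words of length n starting at the same point have
    the same image. *)
Definition nbr_mass n D y := wsum W n (fun t => (t == D.1 - rho ^+ n * y)%:R).

Lemma nbr_mass_ge0 n D y : 0 <= nbr_mass n D y.
Proof. by apply: wsum_ge0 => w _; rewrite ler0n. Qed.

Lemma nbr_mass_gt0 n D y : y \in V W n D -> 0 < nbr_mass n D y.
Proof.
case/V_word=> w [sw cw ee].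
apply: lt_le_trans (wsum_ge (w := w) _ sw) => [|u _]; last by rewrite ler0n.
by rewrite ee eqxx mulr1 exprn_gt0.
Qed.

Lemma eq_rel_pos n D w y :
  (S w 0 == D.1 - rho ^+ n * y) = (y == - rel_pos W n D (S w 0)).
Proof.
rewrite [in LHS](word_rel_pos n D w) (inj_eq (addrI _)) (inj_eq oppr_inj).
by rewrite (inj_eq (mulfI (rX0 n))) eq_sym.
Qed.

Lemma cover_massE n D :
  cover_mass n D = \sum_(y <- V W n D) nbr_mass n D y.
Proof.
rewrite /nbr_mass -wsum_sum; apply: wsum_eq => w sw.
under eq_bigr do rewrite eq_rel_pos.
have [cw|ncw] := boolP (covers n w D).
  rewrite -[_ && _]/(covers n w D) cw (bigD1_seq (- rel_pos W n D (S w 0))) //=.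
  - by rewrite eqxx big1 ?addr0 // => y /negPf ->.
  - exact: word_V.
  - exact: V_uniq.
rewrite -[_ && _]/(covers n w D) (negPf ncw) big_seq big1 // => y.
case: eqP => // -> /V_word[u [su cu ee]]; case/negP: ncw.
by move: cu; rewrite /covers ee -word_rel_pos.
Qed.

Lemma kernel_word n E D w j : E \in net n -> D \in children W n E ->
  size w = n -> covers n.+1 (rcons w j) D ->
  p j / p ord0 <= kernel W (chr n E) (chr n.+1 D) (- rel_pos W n E (S w 0))
    (- rel_pos W n.+1 D (S (rcons w j) 0)).
Proof.
move=> En DE sw cw.
have rD : realizes W (chr n E) (chr n.+1 D) (n, D) by apply/realizesP; exists E.
rewrite (kernelE _ _ rD) (childP DE) (bigD1 j) //=.
have -> : d j - - rel_pos W n E (S w 0) ==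
    rel_pos W n E D.1 - rho * - rel_pos W n.+1 D (S (rcons w j) 0).
  rewrite S_word_rcons /rel_pos sw exprS; apply/eqP.
  by move: (rho ^+ n) (rX0 n) => q q0; field; rewrite q0 lt0r_neq0.
rewrite mulr1 lerDl sumr_ge0 // => l _.
by rewrite !mulr_ge0 ?invr_ge0 // ltW.
Qed.

(** A word of length n + 1 representing z covers D, hence without its last letter it covers E and
    represents some neighbour x; the last letter is the one read off by the kernel. The factor p_0
    undoes the normalization of the matrices. *)
Lemma nbr_massS n E D z : E \in net n -> D \in children W n E ->
  z \in V W n.+1 D ->
  nbr_mass n.+1 D z = p ord0 *
  \sum_(x <- V W n E) nbr_mass n E x * kernel W (chr n E) (chr n.+1 D) x z.
Proof.
move=> En DE zV; have [Dn DE'] := (childrenP _ En).1 DE.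
have rD : realizes W (chr n E) (chr n.+1 D) (n, D) by apply/realizesP; exists E.
have -> : \sum_(x <- V W n E) nbr_mass n E x * kernel W (chr n E) (chr n.+1 D) x z
    = wsum W n (fun t => \sum_(x <- V W n E)
        kernel W (chr n E) (chr n.+1 D) x z * (t == E.1 - rho ^+ n * x)%:R).
  by rewrite wsum_sum; apply: eq_bigr => x _; rewrite wsumZ mulrC.
rewrite -wsumZ {1}/nbr_mass wsum_rcons; apply: wsum_eq => w sw.
under [in RHS]eq_bigr do rewrite eq_rel_pos.
set xw := - rel_pos W n E (S w 0).
have lhs : \sum_j p j * (S w 0 + rho ^+ n * d j == D.1 - rho ^+ n.+1 * z)%:R =
    p ord0 * kernel W (chr n E) (chr n.+1 D) xw z.
  rewrite (kernelE _ _ rD) (childP DE) mulr_sumr; apply: eq_bigr => j _.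
  rewrite mulrA [p j / _]mulrC mulVKf ?lt0r_neq0 //; congr (_ * (nat_of_bool _)%:R).
  rewrite -[in LHS](rel_posK W n E D.1) [in LHS](word_rel_pos n E w) -/xw exprSr.
  apply/eqP/eqP => h; last first.
    have := congr1 ( *%R (rho ^+ n)) h; lra.
  by apply: (mulfI (rX0 n)); lra.
have [xV|xV] := boolP (xw \in V W n E).
  rewrite lhs (bigD1_seq xw) ?V_uniq //= eqxx mulr1 big1 ?addr0 // => x /negPf ->.
  by rewrite mulr0.
rewrite [in RHS]big_seq [in RHS]big1 ?mulr0; last first.
  by move=> x xV'; case: eqP xV' xV => [->->//|]; rewrite mulr0.
apply: big1 => j _; case: eqP => [|]; last by rewrite mulr0.
move=> ee; case/negP: xV; apply: word_V => //.
have [u [su cu eu]] := V_word zV.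
have cwj : covers n.+1 (rcons w j) D.
  by rewrite /covers S_word_rcons sw ee -eu.
have /andP[c1 c2] := covers_rcons sw cwj.
have [_ ab _] := net_itv01 Dn; case/andP: DE' => h1 h2.
by apply: (covers_meet (leqnn n)) => //; lra.
Qed.

Lemma nbr_mass_path n D s D' y : D \in net n -> desc n D s D' ->
  y \in V W (n + size s) D' ->
  nbr_mass (n + size s) D' y = p ord0 ^+ size s *
  \sum_(x <- V W n D) nbr_mass n D x * pker (chr n D) s x y.
Proof.
elim: s n D => [|beta s IH] n D Dn /=.
  move=> ->; rewrite addn0 => yV; rewrite mul1r (bigD1_seq y) ?V_uniq //=.
  rewrite eqxx mulr1 big1 ?addr0 // => x /negPf ->; by rewrite mulr0.
case=> D1 [D1D <- DD'] yV; have [D1n _] := (childrenP _ Dn).1 D1D.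
move: yV; rewrite addnS -addSn => yV; rewrite (IH _ _ D1n DD' yV).
rewrite exprSr -mulrA; congr (_ * _).
under [in RHS]eq_bigr do rewrite mulr_sumr.
rewrite exchange_big /= mulr_sumr big_seq [RHS]big_seq.
apply: eq_bigr => z zV; rewrite (nbr_massS Dn D1D zV) -mulrA; congr (_ * _).
by rewrite mulr_suml; apply: eq_bigr => x _; rewrite mulrA.
Qed.

Lemma cover_mass_path n D s D' : D \in net n -> desc n D s D' ->
  cover_mass (n + size s) D' = p ord0 ^+ size s *
  \sum_(x <- V W n D) \sum_(y <- V W (n + size s) D')
    nbr_mass n D x * pker (chr n D) s x y.
Proof.
move=> Dn DD'; rewrite cover_massE exchange_big /= mulr_sumr big_seq.
rewrite [RHS]big_seq; apply: eq_bigr => y yV.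
by rewrite (nbr_mass_path Dn DD' yV).
Qed.

Lemma kernel_word_gt0 n E D w j : E \in net n -> D \in children W n E ->
  size w = n -> covers n.+1 (rcons w j) D ->
  0 < kernel W (chr n E) (chr n.+1 D) (- rel_pos W n E (S w 0))
    (- rel_pos W n.+1 D (S (rcons w j) 0)).
Proof.
move=> En DE sw cw; apply: lt_le_trans (kernel_word En DE sw cw).
by rewrite divr_gt0.
Qed.

Lemma covers_in n E D w : E \in net n -> D \in net n.+1 -> itv_in D E ->
  size w = n -> covers n w D -> covers n w E.
Proof.
move=> En Dn /andP[h1 h2] sw /andP[c1 c2]; have [_ ab _] := net_itv01 Dn.
by apply: (covers_meet (leqnn n)) => //; lra.
Qed.

(** No zero row: a word covering E contains D, and one of its images by a further letter contains a
    right neighbourhood of D.1, hence covers D. *)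
Lemma kernel_row alpha beta x : step alpha beta -> x \in cv_nbrs alpha ->
  exists2 z, z \in cv_nbrs beta & 0 < kernel W alpha beta x z.
Proof.
move=> /asboolP[[n D] /realizesP[E [En DE <- <-]]] /V_word[w [sw /andP[c1 c2] xw]].
have [Dn /andP[h1 h2]] := (childrenP _ En).1 DE.
have [_ ab _] := net_itv01 Dn.
have [j /andP[j1 j2]] : exists j, d j <= (D.1 - S w 0) / rho ^+ n < d j + rho.
  apply: cover_letter; rewrite divr_ge0 ?subr_ge0 ?(ltW (rX n)) //=; last by lra.
  by rewrite ltr_pdivrMr // mul1r; lra.
have cw : covers n.+1 (rcons w j) D.
  move: j1 j2; rewrite ler_pdivlMr // ltr_pdivrMr // => j1 j2.
  apply: (covers_meet (leqnn _)); rewrite ?size_rcons ?sw ?S_word_rcons ?sw //.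
    by lra.
  by rewrite exprS; lra.
exists (- rel_pos W n.+1 D (S (rcons w j) 0)).
  by apply: word_V; rewrite ?size_rcons ?sw.
have -> : x = - rel_pos W n E (S w 0) by apply/eqP; rewrite -eq_rel_pos xw.
exact: kernel_word_gt0.
Qed.

(** No zero column: the last letter of a word covering D is deleted. *)
Lemma kernel_col alpha beta z : step alpha beta -> z \in cv_nbrs beta ->
  exists2 x, x \in cv_nbrs alpha & 0 < kernel W alpha beta x z.
Proof.
move=> /asboolP[[n D] /realizesP[E [En DE <- <-]]] /V_word[w' [sw' cw' zw]].
case/lastP: w' sw' cw' zw => // w j; rewrite size_rcons => -[sw] cw zw.
have [Dn DE'] := (childrenP _ En).1 DE.
have cwE : covers n w E by apply: covers_in DE' _ _ => //; apply: covers_rcons cw.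
exists (- rel_pos W n E (S w 0)); first exact: word_V.
have -> : z = - rel_pos W n.+1 D (S (rcons w j) 0).
  by apply/eqP; rewrite -eq_rel_pos zw.
exact: kernel_word_gt0.
Qed.

Lemma pker_row alpha s x : path step alpha s -> x \in cv_nbrs alpha ->
  exists2 z, z \in cv_nbrs (last alpha s) & 0 < pker alpha s x z.
Proof.
elim: s alpha x => [|beta s IH] alpha x /=.
  by move=> _ xa; exists x; rewrite ?eqxx.
case/andP=> ab ps /(kernel_row ab)[z zb xz].
have [y yl zy] := IH _ _ ps zb; exists y => //.
rewrite (bigD1_seq z) ?(step_shape ab) //= ltr_pwDl ?mulr_gt0 //.
by rewrite sumr_ge0 // => t _; rewrite mulr_ge0 ?kernel_ge0 ?pker_ge0.
Qed.

Lemma pker_col alpha s z : path step alpha s -> uniq (cv_nbrs alpha) ->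
  z \in cv_nbrs (last alpha s) ->
  exists2 x, x \in cv_nbrs alpha & 0 < pker alpha s x z.
Proof.
elim: s alpha => [|beta s IH] alpha /=.
  by move=> _ _ xa; exists z; rewrite ?eqxx.
case/andP=> ab ps _ zl; have [y yb yz] := IH _ ps (step_shape ab) zl.
have [x xa xy] := kernel_col ab yb; exists x => //.
rewrite (bigD1_seq y) ?(step_shape ab) //= ltr_pwDl ?mulr_gt0 //.
by rewrite sumr_ge0 // => t _; rewrite mulr_ge0 ?kernel_ge0 ?pker_ge0.
Qed.

Lemma pker_word n D s D' w v : D \in net n -> desc n D s D' ->
  size w = n -> size v = size s -> covers (n + size s) (w ++ v) D' ->
  0 < pker (chr n D) s (- rel_pos W n D (S w 0))
    (- rel_pos W (n + size s) D' (S (w ++ v) 0)).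
Proof.
elim: s n D w v => [|beta s IH] n D w v Dn /=.
  by move=> -> sw /size0nil ->; rewrite addn0 cats0 eqxx.
case: v => // j v [D1 [D1D <- DD']] sw [sv]; rewrite addnS -addSn -cat_rcons => cw.
have [D1n DD1] := (childrenP _ Dn).1 D1D.
have swj : size (rcons w j) = n.+1 by rewrite size_rcons sw.
have [_ D'n D'D1 _] := descP D1n DD'.
have cwj : covers n.+1 (rcons w j) D1.
  have /andP[c1 c2] := covers_cat swj sv cw; have [_ ab _] := net_itv01 D'n.
  by case/andP: D'D1 => h1 h2; apply: (covers_meet (leqnn _)) => //; lra.
have := IH _ _ _ _ D1n DD' swj sv cw.
have := kernel_word_gt0 Dn D1D sw cwj.
set x := - rel_pos W n D _; set z := - rel_pos W n.+1 D1 _ => xz zy.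
have zV : z \in V W n.+1 D1 by apply: word_V.
rewrite (bigD1_seq z) ?V_uniq //= ltr_pwDl ?mulr_gt0 //.
by rewrite sumr_ge0 // => t _; rewrite mulr_ge0 ?kernel_ge0 ?pker_ge0.
Qed.

End PathKernel.

(** * The essential class *)

Section EssentialClass.
Context {R : realType} (W : coverIFS R).

Local Notation rho := (ratio W).
Local Notation d := (@shift R W).
Local Notation letter := 'I_(ifs_m W).+1.
Local Notation S := (@S_word R W).
Local Notation net := (net_intervals W).
Local Notation chr := (characteristic W).
Local Notation step := (step W).
Local Notation pker := (pker W).
Implicit Types (w u v : seq letter) (n : nat) (D E : R * R).
Implicit Types (alpha beta : charvec R) (s : seq (charvec R)).

Let rho_gt0 : 0 < rho := ratio_gt0 W.
Let rho_lt1 : rho < 1 := ratio_lt1 W.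
Let rX n : 0 < rho ^+ n := rhoX_gt0 W n.
Let rX0 n : rho ^+ n != 0.
Proof. exact: lt0r_neq0. Qed.

(** Everything is a relative position in the finite list [Gs]: lengths are differences of two of
    them, neighbour lists are sublists, and the number of children is bounded because their relative
    left ends lie in the finite list [H]. *)
Lemma finite_Omega : finite_set (Omega W).
Proof.
have [Gs GP] := finite_positions W.
pose g := sort <=%R (undup Gs).
pose ells : seq R := [seq a - b | a <- Gs, b <- Gs].
(* Neighbour lists are increasing, so they are sublists of the sorted list [g], enumerated by bit
   masks. *)
pose Vs : seq (seq R) := [seq mask (val m) g | m <- enum {: (size g).-tuple bool}].
pose H1 : seq R := [seq rho * a + d j | a <- Gs, j <- enum {: letter}].
pose H : seq R := [seq a - b | a <- H1, b <- Gs].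
have pos n E w : E \in net n -> size w = n -> covers n w E ->
    rho ^- n * (E.1 - S w 0) \in Gs /\ rho ^- n * (E.2 - S w 0) \in Gs.
  move=> /net_intervalsP[e1 e2 ab _] sw /andP[c1 c2].
  by split; apply: GP => //; apply/andP; split; lra.
have VG n E y : E \in net n -> y \in V W n E -> y \in Gs.
  by move=> En /mem_V[w [sw cw ->]]; have [] := pos _ _ _ En sw cw.
have chH n E D : E \in net n -> D \in children W n E -> rel_pos W n E D.1 \in H.
  move=> En DE; have [Dn DE'] := (childrenP _ En).1 DE.
  have [w' sw' cw'] := net_covered Dn.
  case/lastP: w' sw' cw' => // w j; rewrite size_rcons => -[sw] cw.
  have cwE : covers n w E by apply: covers_in En Dn DE' sw (covers_rcons sw cw).
  have [g1 _] := pos _ _ _ En sw cwE.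
  have [|g2 _] := pos _ _ (rcons w j) Dn _ cw; first by rewrite size_rcons sw.
  apply/allpairsP; exists (rho * (rho ^- n.+1 * (D.1 - S (rcons w j) 0)) + d j,
    rho ^- n * (E.1 - S w 0)); split=> //=.
    by apply: allpairs_f => //; rewrite mem_enum.
  rewrite /rel_pos S_word_rcons sw exprS.
  by move: (rho ^+ n) (rX0 n) => q q0; field; rewrite q0 lt0r_neq0.
have sub : Omega W `<=` [set` ells] `*` [set` Vs] `*` [set` iota 0 (size H).+2].
  move=> _ [n [E [En ->]]]; split; first split=> /=.
  - have [w sw cw] := net_covered En; have [g1 g2] := pos _ _ _ En sw cw.
    apply/allpairsP; exists (rho ^- n * (E.2 - S w 0), rho ^- n * (E.1 - S w 0)).
    by split=> //=; rewrite /ell -mulrBr; congr (_ * _); ring.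
  - have -> : V W n E = [seq y <- g | y \in V W n E].
      apply: lt_sorted_eq; first exact: V_sorted.
        apply: sorted_filter; first exact: lt_trans.
        by rewrite sort_lt_sorted undup_uniq.
      move=> y; rewrite mem_filter; apply/idP/andP => [yV|[]//]; split=> //.
      by rewrite /g mem_sort mem_undup (VG _ _ _ En yV).
    have /subseqP[m sm ->] := filter_subseq (mem (V W n E)) g.
    have sm' : size m == size g by apply/eqP.
    by apply/mapP; exists (Tuple sm'); rewrite ?mem_enum.
  change (position W n E \in iota 0 (size H).+2).
  rewrite mem_iota add0n /= /position; case: n En => // n En; rewrite !ltnS.
  apply: leq_trans (index_size _ _) _; rewrite size_filter.
  apply: leq_trans (count_size _ _) _.
  have [Pn _] := parentP En; set P := parent W n E in Pn *.
  rewrite -(size_map (fun D => rel_pos W n P D.1)); apply: uniq_leq_size.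
    apply: (sorted_uniq (leT := <%R)); [exact: lt_trans|exact: ltxx|].
    rewrite sorted_map; apply: sub_sorted (children_sorted _ _ _) => D D'.
    by rewrite /= rel_pos_lt.
  by move=> _ /mapP[D DP ->]; apply: chH.
apply: sub_finite_set sub _; apply: finite_setX; first apply: finite_setX.
all: by apply/finite_seqP; eexists.
Qed.

Definition reach alpha beta : Prop :=
  exists s, [/\ s != [::], path step alpha s & last alpha s = beta].

Lemma reach_trans alpha beta gamma :
  reach alpha beta -> reach beta gamma -> reach alpha gamma.
Proof.
move=> [s [s0 ps <-]] [s' [s'0 ps' <-]]; exists (s ++ s').
by rewrite cat_path ps ps' last_cat; split=> //; case: s s0 {ps ps'}.
Qed.

Lemma reach_path alpha s beta : path step alpha s -> beta \in s ->
  reach alpha beta.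
Proof.
move=> + bs; case/splitPr: bs => s1 s2; rewrite -cat_rcons cat_path.
case/andP=> p1 _; exists (rcons s1 beta); rewrite last_rcons; split=> //.
by case: s1 {p1}.
Qed.

Lemma reach_Omega alpha beta : reach alpha beta -> Omega W beta.
Proof.
case=> s []; case/lastP: s => // s b _; rewrite rcons_path last_rcons.
by case/andP=> _ /step_Omega + <-.
Qed.

Lemma Omega_step alpha : Omega W alpha -> exists beta, step alpha beta.
Proof.
case=> n [E [En ->]]; have [a0 ab b1] := net_itv01 En.
have [D Dn /andP[h1 h2]] := net_at W n.+1 (y := E.1)
  ltac:(by rewrite a0 (lt_le_trans ab b1)).
exists (chr n.+1 D); apply: child_step => //; apply/(childrenP _ En).
by split=> //; exact: (net_overlap (leqnSn n) En Dn (le_lt_trans h1 ab) h2).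
Qed.

Lemma root_net : (0, 1) \in net 0.
Proof. by rewrite net_intervals0 inE. Qed.

Lemma root_path alpha : Omega W alpha ->
  exists2 s, path step (chr 0 (0, 1)) s & last (chr 0 (0, 1)) s = alpha.
Proof.
case=> n [D [Dn ->]]; have [a0 ab b1] := net_itv01 Dn.
have DD : itv_in D (0, 1) by rewrite /itv_in a0.
have [s sn ds] := desc_ancestor root_net (Dn : D \in net (0 + n)) DD.
have [ps _ _] := descP root_net ds; rewrite add0n sn => ->.
by exists s.
Qed.

(* A vertex with the fewest descendants generates a closed class. *)
Lemma essential_class_exists : exists C, essential_loop_class W C.
Proof.
have [L0 LP0] := (finite_seqP _).1 finite_Omega.
pose L := undup L0.
have LP beta : Omega W beta <-> beta \in L by rewrite LP0 /= mem_undup.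
pose f alpha := [seq beta <- L | `[< reach alpha beta >]].
have mem_f alpha beta : beta \in f alpha <-> reach alpha beta.
  rewrite mem_filter; split=> [/andP[/asboolP]//|ab].
  by apply/andP; split; [exact/asboolP|apply/LP; apply: reach_Omega ab].
have Uf alpha : uniq (f alpha) by rewrite filter_uniq ?undup_uniq.
pose P k := `[< exists2 alpha, Omega W alpha & size (f alpha) = k >].
have exP : exists k, P k.
  exists (size (f (chr 0 (0, 1)))); apply/asboolP; exists (chr 0 (0, 1)) => //.
  by exists 0%N, (0, 1); split=> //; exact: root_net.
have [k /asboolP[alpha Oa fa] kmin] := ex_minnP exP.
have same beta gamma : reach alpha beta -> reach alpha gamma -> reach beta gamma.
  move=> ab ag; have sub : {subset f beta <= f alpha}.
    by move=> x /mem_f bx; apply/mem_f; apply: reach_trans ab bx.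
  have sz : (size (f alpha) <= size (f beta))%N.
    by rewrite fa; apply: kmin; apply/asboolP; exists beta => //; apply: reach_Omega ab.
  have [_ eqf] := uniq_min_size (Uf beta) sub sz.
  by apply/mem_f; rewrite eqf; apply/mem_f.
have step1 beta gamma : step beta gamma -> reach beta gamma.
  by move=> bg; exists [:: gamma]; rewrite /= bg.
exists (reach alpha); split; last first.
  move=> beta gamma ab bg; apply: reach_trans ab _; apply: step1; exact/asboolP.
split.
- have [beta ab] := Omega_step Oa; exists beta; exact: step1.
- by move=> beta; apply: reach_Omega.
move=> beta gamma ab ag; have [s [s0 ps ls]] := same _ _ ab ag.
exists s; split=> //; first by split=> //; apply: reach_Omega ab.
by move=> x xs; apply: reach_trans ab _; apply: reach_path xs.
Qed.

Local Notation Om0 := (Omega0 W).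

Lemma Omega0_essential : essential_loop_class W Om0.
Proof. by rewrite /Omega0; case: xgetP => [C _ //|/(_ _)]; have [C] := essential_class_exists => + /(_ C). Qed.

Lemma Omega0_Omega alpha : Om0 alpha -> Omega W alpha.
Proof. by case: Omega0_essential => -[_ h _] _; apply: h. Qed.

Lemma Omega0_path alpha s : Om0 alpha -> path step alpha s ->
  forall beta, beta \in s -> Om0 beta.
Proof.
elim: s alpha => // b s IH alpha Oa /= /andP[/asboolP ab ps] beta.
have Ob : Om0 b by case: Omega0_essential => _ h; apply: h ab.
by rewrite inE => /predU1P[->//|]; apply: IH ps _.
Qed.

Lemma Omega0_last alpha s : Om0 alpha -> path step alpha s -> Om0 (last alpha s).
Proof.
move=> Oa ps; have := mem_last alpha s; rewrite inE => /predU1P[->//|].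
exact: Omega0_path ps _.
Qed.

Lemma Omega0_connect alpha beta : Om0 alpha -> Om0 beta ->
  exists s, [/\ s != [::], path step alpha s & last alpha s = beta].
Proof.
move=> Oa Ob; case: Omega0_essential => -[_ _ h] _.
by have [s [s0 [_ ps] ls _]] := h _ _ Oa Ob; exists s.
Qed.

Lemma max_nbrs : exists n D, D \in net n /\
  forall m E, E \in net m -> (size (V W m E) <= size (V W n D))%N.
Proof.
have [Gs GP] := finite_positions W.
pose P k := `[< exists n D, D \in net n /\ size (V W n D) = k >].
have exP : exists k, P k.
  by exists (size (V W 0 (0, 1))); apply/asboolP; exists 0%N, (0, 1); rewrite root_net.
have bP k : P k -> (k <= size Gs)%N.
  case/asboolP=> n [D [Dn <-]]; apply: uniq_leq_size; first exact: V_uniq.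
  move=> y /mem_V[w [sw /andP[c1 c2] ->]]; case/net_intervalsP: Dn => e1 e2 ab _.
  by apply: GP => //; apply/andP; split; lra.
have [k /asboolP[n [D [Dn sk]]] kmax] := ex_maxnP exP bP.
exists n, D; split=> // m E En; rewrite sk; apply: kmax; apply/asboolP.
by exists m, E.
Qed.

(* An interval with the greatest number of neighbours, transported by a word
   starting with u, can only have neighbours starting with u. *)
Lemma full_row_net n D x : D \in net n -> x \in V W n D ->
  exists s D', desc W n D s D' /\
    forall z, z \in V W (n + size s) D' -> 0 < pker (chr n D) s x z.
Proof.
move=> Dn /V_word[u [su cu ux]]; have [N [M [MN Mmax]]] := max_nbrs.
have -> : x = - rel_pos W n D (S u 0) by apply/eqP; rewrite -eq_rel_pos ux.
have [D0 DD D1] := net_itv01 Dn; have [M0 MM M1] := net_itv01 MN.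
have /andP[cu1 cu2] := cu.
(* A word u v of length n + k1 whose image contains the midpoint of D is shorter than half of D, so
   this image lies strictly inside D. *)
have [k1 k1P] := @expr_small R rho ((D.2 - D.1) / 2)
  ltac:(by rewrite rho_gt0) ltac:(by rewrite divr_gt0 // subr_gt0).
pose y0 := (D.1 + D.2) / 2.
have [v [sv /andP[v1 v2]]] := cover_word W k1 (y := (y0 - S u 0) / rho ^+ n)
  ltac:(by rewrite divr_ge0 ?subr_ge0 ?(ltW (rX n)) //= ?ltr_pdivrMr // ?mul1r /y0; lra).
rewrite ler_pdivlMr // in v1; rewrite ltr_pdivrMr // in v2.
set q := rho ^+ (n + k1).
have qE : q = rho ^+ n * rho ^+ k1 by rewrite /q exprD.
have q0 : 0 < q by exact: rX.
have qk : q <= rho ^+ k1 by rewrite qE ler_piMl ?rhoX_le1 // ltW.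
have uv : S (u ++ v) 0 = S u 0 + rho ^+ n * S v 0 by rewrite S_word_cat0 su.
(* y is the image under S_(u v) of the midpoint of M. The interval D' of level n + k1 + N at y is
   covered by u v e for every e covering M, since y is interior to the image of u v e. *)
pose mid := (M.1 + M.2) / 2; pose y := S (u ++ v) 0 + q * mid.
have uvD1 : D.1 < S (u ++ v) 0 by rewrite uv; move: v1 v2 k1P; rewrite /y0; nra.
have uvD2 : S (u ++ v) 0 + q < D.2 by rewrite uv; move: v1 v2 k1P; rewrite /y0; nra.
have mid0 : 0 < mid by rewrite /mid; lra.
have mid1 : mid < 1 by rewrite /mid; lra.
have qm0 : 0 < q * mid by rewrite mulr_gt0.
have qm1 : q * mid < q by rewrite gtr_pMr.
have [D' D'n /andP[D'1 D'2]] := net_at W (n + k1 + N) (y := y)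
  ltac:(by rewrite /y; apply/andP; split; lra).
have D'D : itv_in D' D.
  have nm : (n <= n + k1 + N)%N by rewrite -addnA leq_addr.
  apply: (net_overlap nm Dn D'n).
    by apply: le_lt_trans D'1 _; rewrite /y; lra.
  by apply: lt_trans D'2; rewrite /y; lra.
have D'n' : D' \in net (n + (k1 + N)) by rewrite addnA.
have [s ss ds] := desc_ancestor Dn D'n' D'D.
exists s, D'; split=> // z; rewrite ss => zV.
pose f t := - rel_pos W (n + k1 + N) D' (S (u ++ v) 0 + q * (M.1 - rho ^+ N * t)).
have wordM t : t \in V W N M -> exists2 e, size e = N &
    S (u ++ v ++ e) 0 = S (u ++ v) 0 + q * (M.1 - rho ^+ N * t) /\
    covers (n + (k1 + N)) (u ++ v ++ e) D'.
  case/V_word=> e [se /andP[ce1 ce2] et]; exists e => //.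
  have ee : S (u ++ v ++ e) 0 = S (u ++ v) 0 + q * S e 0.
    by rewrite catA S_word_cat0 size_cat su sv.
  split; first by rewrite ee et.
  apply: (covers_meet (leqnn _)) => //.
  - by rewrite !size_cat su sv se.
  - apply: le_lt_trans D'2; rewrite ee /y lerD2l ler_wpM2l ?(ltW q0) //.
    by rewrite /mid; lra.
  rewrite ee addnA exprD -/q; apply: le_lt_trans D'1 _.
  rewrite /y -addrA -mulrDr ltrD2l ltr_pM2l // /mid; lra.
have fV t : t \in V W N M -> f t \in V W (n + k1 + N) D'.
  case/wordM=> e se [ee ce]; rewrite /f -ee; apply: word_V.
    by rewrite !size_cat su sv se addnA.
  by rewrite -addnA.
have f_inj : injective f.
  move=> t t' /oppr_inj; rewrite /rel_pos => /(mulfI (invr_neq0 (rX0 _))).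
  move=> /addIr /addrI /(mulfI (lt0r_neq0 q0)) /addrI /oppr_inj.
  exact: mulfI.
(* [f] sends neighbours of M injectively to neighbours of D'. As M has the greatest number of them,
   [f] reaches all, so every neighbour of D' comes from a word starting with u. *)
have [_ feq] : (size [seq f t | t <- V W N M] = size (V W (n + k1 + N) D')) *
    ([seq f t | t <- V W N M] =i V W (n + k1 + N) D').
  apply: uniq_min_size.
  - by rewrite map_inj_uniq ?V_uniq.
  - by move=> _ /mapP[t tV ->]; apply: fV.
  - by rewrite size_map; apply: Mmax.
move: (zV); rewrite addnA -feq => /mapP[t /wordM[e se [ee ce]] ->].
rewrite /f -ee -addnA -ss.
by apply: (pker_word Dn ds su); rewrite ?size_cat ?sv ?se ?ss.
Qed.

Lemma full_row alpha x : Omega W alpha -> x \in cv_nbrs alpha ->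
  exists s, path step alpha s /\
    forall z, z \in cv_nbrs (last alpha s) -> 0 < pker alpha s x z.
Proof.
case=> n [D [Dn ->]] xV; have [s [D' [ds H]]] := full_row_net Dn xV.
by have [ps _ _ ls] := descP Dn ds; exists s; rewrite -ls.
Qed.

Lemma pker_cat_ge alpha s s' x z y : Omega W alpha -> path step alpha s ->
  x \in cv_nbrs alpha -> z \in cv_nbrs (last alpha s) ->
  pker alpha s x z * pker (last alpha s) s' z y <= pker alpha (s ++ s') x y.
Proof.
move=> Oa ps xa zl; rewrite pker_cat ?(Omega_uniq Oa) // (big_rem z) //= lerDl.
by rewrite sumr_ge0 // => t _; rewrite mulr_ge0 ?pker_ge0.
Qed.

Lemma path_Omega alpha s : Omega W alpha -> path step alpha s ->
  Omega W (last alpha s).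
Proof.
elim: s alpha => //= b s IH alpha _ /andP[/step_Omega Ob ps]; exact: IH.
Qed.

(** Rows are made positive one at a time. To fill the row of x, continue from some z0 already joined
    to x by a path with a positive row at z0; rows filled before stay positive, as there are no zero
    columns. *)
Lemma positive_path alpha : Omega W alpha -> exists s, path step alpha s /\
  forall x z, x \in cv_nbrs alpha -> z \in cv_nbrs (last alpha s) ->
    0 < pker alpha s x z.
Proof.
move=> Oa.
suff key (X : seq R) : exists s, path step alpha s /\
    forall x z, x \in X -> x \in cv_nbrs alpha ->
    z \in cv_nbrs (last alpha s) -> 0 < pker alpha s x z.
  by have [s [ps H]] := key (cv_nbrs alpha); exists s; split=> // x z xa; apply: H.
elim: X => [|x X [s [ps H]]]; first by exists [::].
have [xa|xa] := boolP (x \in cv_nbrs alpha); last first.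
  exists s; split=> // x' z; rewrite inE => /predU1P[->|]; last exact: H.
  by move=> xa'; rewrite xa' in xa.
have [z0 z0l xz0] := pker_row ps xa.
have [s' [ps' H']] := full_row (path_Omega Oa ps) z0l.
exists (s ++ s'); rewrite cat_path ps ps' last_cat; split=> // x' z.
rewrite inE => /predU1P[->|x'X] x'a zl.
  by apply: lt_le_trans (pker_cat_ge _ _ Oa ps xa z0l); rewrite mulr_gt0 // H'.
have [z1 z1l z1z] := pker_col ps' (Omega_uniq (path_Omega Oa ps)) zl.
apply: lt_le_trans (pker_cat_ge _ _ Oa ps x'a z1l); rewrite mulr_gt0 //.
exact: H.
Qed.

Definition pos_pker alpha s := forall x z, x \in cv_nbrs alpha ->
  z \in cv_nbrs (last alpha s) -> 0 < pker alpha s x z.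

Lemma pos_pker_catr alpha s s' : Omega W alpha -> path step alpha (s ++ s') ->
  pos_pker alpha s -> pos_pker alpha (s ++ s').
Proof.
move=> Oa; rewrite cat_path => /andP[ps ps'] H x z xa; rewrite last_cat => zl.
have [z1 z1l z1z] := pker_col ps' (Omega_uniq (path_Omega Oa ps)) zl.
apply: lt_le_trans (pker_cat_ge _ _ Oa ps xa z1l); rewrite mulr_gt0 //.
exact: H.
Qed.

Lemma pos_pker_catl alpha s s' : Omega W alpha -> path step alpha (s ++ s') ->
  pos_pker (last alpha s) s' -> pos_pker alpha (s ++ s').
Proof.
move=> Oa; rewrite cat_path => /andP[ps ps'] H x z xa; rewrite last_cat => zl.
have [z1 z1l xz1] := pker_row ps xa.
apply: lt_le_trans (pker_cat_ge _ _ Oa ps xa z1l); rewrite mulr_gt0 //.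
exact: H.
Qed.

Lemma positive_cycle alpha : Om0 alpha -> exists s,
  [/\ s != [::], path step alpha s, last alpha s = alpha & pos_pker alpha s].
Proof.
move=> Oa; have Oa' := Omega0_Omega Oa.
have [s [ps H]] := positive_path Oa'.
have [s' [s'0 ps' ls']] := Omega0_connect (Omega0_last Oa ps) Oa.
have pss' : path step alpha (s ++ s') by rewrite cat_path ps.
exists (s ++ s'); rewrite last_cat; split=> //.
  by case: s s' s'0 {ps H ps' ls' pss'} => // -[].
exact: pos_pker_catr.
Qed.

End EssentialClass.

(** * Local dimension and growth of masses *)

Section Growth.
Context {R : realType}.
Implicit Types (a : nat -> R) (L : R).

(** That is, a n = n L + o(n); [M] absorbs the initial terms, so that no threshold on n is carried
    along. *)
Definition lin_growth a L := forall e : R, 0 < e ->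
  exists M, forall n, `|a n - n%:R * L| <= e * n%:R + M.

Lemma lin_growth_ev a L :
  (forall e : R, 0 < e -> exists N M, forall n, (N <= n)%N ->
     `|a n - n%:R * L| <= e * n%:R + M) -> lin_growth a L.
Proof.
move=> H e e0; have [N [M HM]] := H e e0.
exists (`|M| + \sum_(i < N) `|a i - i%:R * L|) => n.
have en : 0 <= e * n%:R by rewrite mulr_ge0 // ltW.
have sum0 : 0 <= \sum_(i < N) `|a i - i%:R * L| by apply: sumr_ge0.
have [Nn|nN] := leqP N n.
  by apply: (le_trans (HM n Nn)); have := ler_norm M; lra.
rewrite (bigD1 (Ordinal nN)) //=.
have : 0 <= \sum_(i < N | i != Ordinal nN) `|a i - i%:R * L| by apply: sumr_ge0.
by have := normr_ge0 M; lra.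
Qed.

Lemma ln_growth (e : R) : 0 < e -> exists M, forall n, ln n.+1%:R <= e * n%:R + M.
Proof.
(* From the bound of ln t by t at t = e (n + 1). *)
move=> e0; exists (e - ln e) => n.
have n0 : 0 < n.+1%:R :> R by rewrite ltr0n.
have := @ln_sublinear R (e * n.+1%:R) ltac:(by rewrite mulr_gt0).
by rewrite lnM ?posrE // -natr1; lra.
Qed.

Lemma cvg_right0P (f : R -> R) (v : R) :
  (f r @[r --> 0^'+] --> v) <->
  (forall e : R, 0 < e -> exists2 eta : R, 0 < eta &
     forall r : R, 0 < r < eta -> `|f r - v| <= e).
Proof.
split=> [/cvgrPdist_le H e e0|H].
  have [eta /= eta0 He] := H e e0; exists eta => // r /andP[r0 re].
  rewrite distrC; apply: He => //=; by rewrite sub0r normrN gtr0_norm.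
apply/cvgrPdist_le => e e0; have [eta eta0 He] := H e e0.
exists eta => //= r /=; rewrite sub0r normrN => re r0; rewrite distrC.
by apply: He; rewrite r0 -(gtr0_norm r0).
Qed.

(* The local dimension of a function r |-> m r can be computed from any sequence
   comparable, up to a polynomial factor and a bounded shift of the index, to
   its values along the powers of rho. *)
Section Compare.
Variables (rho C : R) (h : nat) (m : R -> R) (Q : nat -> R).
Hypotheses (rho_gt0 : 0 < rho) (rho_lt1 : rho < 1) (C_gt0 : 0 < C).
Hypothesis m_homo : forall r r' : R, 0 < r -> r <= r' -> m r <= m r'.
Hypothesis Q_gt0 : forall n, 0 < Q n.
Hypothesis Q_le : forall n, Q n <= m (rho ^+ n).
Hypothesis le_Q : forall n, m (rho ^+ (n + h)) <= C * n.+1%:R * Q n.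

Let rX n : 0 < rho ^+ n. Proof. exact: exprn_gt0. Qed.
Let l := - ln rho.
Let l_gt0 : 0 < l. Proof. by rewrite oppr_gt0 ln_lt0 // rho_gt0. Qed.
Let ln_rX n : ln (rho ^+ n) = - (n%:R * l).
Proof. by rewrite lnXn // /l mulrN opprK mulr_natl. Qed.

Let ln_le_Q n : ln (m (rho ^+ (n + h))) <= ln C + ln n.+1%:R + ln (Q n).
Proof.
rewrite -!lnM ?posrE ?mulr_gt0 ?ltr0n // ler_ln ?posrE ?mulr_gt0 ?ltr0n //.
exact: lt_le_trans (Q_gt0 _) (Q_le _).
Qed.

Let ln_Q_le n : ln (Q n) <= ln (m (rho ^+ n)).
Proof. by rewrite ler_ln ?posrE // (lt_le_trans (Q_gt0 _) (Q_le _)). Qed.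

Lemma growth_of_cvg (v : R) : (ln (m r) / ln r @[r --> 0^'+] --> v) ->
  lin_growth (fun n => ln (Q n)) (v * ln rho).
Proof.
move=> /cvg_right0P H; apply: lin_growth_ev => e e0.
have e2 : 0 < e / 2 by rewrite divr_gt0.
(* At r = rho^n the denominator is - n l, so the tolerance is divided by l beforehand. The other
   half of e is for the logarithm of n + 1. *)
have [eta eta0 Heta] := H (e / 2 / l) ltac:(by rewrite divr_gt0).
have [N HN] := @expr_small R rho eta ltac:(by rewrite rho_gt0) eta0.
have near_m n : (N.+1 <= n)%N ->
    `|ln (m (rho ^+ n)) - n%:R * (v * ln rho)| <= e / 2 * n%:R.
  move=> Nn; have n0 : 0 < n%:R :> R by rewrite ltr0n (leq_trans _ Nn).
  have := Heta (rho ^+ n); rewrite rX /= => /(_ _)/wrap[].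
    by apply: le_lt_trans HN; rewrite ler_wiXn2l ?(ltW rho_gt0) ?(ltW rho_lt1) // ltnW.
  rewrite ln_rX; set X := (_ - v) => HX; have nl := mulr_gt0 n0 l_gt0.
  have -> : ln (m (rho ^+ n)) - n%:R * (v * ln rho) = - (X * (n%:R * l)).
    have -> : ln rho = - l by rewrite /l opprK.
    by rewrite /X; field; rewrite !lt0r_neq0.
  rewrite normrN normrM (gtr0_norm nl).
  apply: le_trans (ler_wpM2r (ltW nl) HX) _.
  by rewrite le_eqVlt; apply/orP; left; apply/eqP; field; rewrite lt0r_neq0.
have [M2 HM2] := ln_growth e2.
exists N.+1, (`|h%:R * (v * ln rho)| + e / 2 * h%:R + `|ln C| + `|M2|) => n Nn.
have := near_m n Nn; have := near_m (n + h)%N (leq_trans Nn (leq_addr _ _)).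
have h1 := ln_le_Q n; have h2 := ln_Q_le n; have h3 := HM2 n.
rewrite natrD mulrDl mulrDr !ler_norml => /andP[g1 g2] /andP[g3 g4].
have := ler_norm (ln C); have := ler_norm M2.
have hL := ler_norm (- (h%:R * (v * ln rho))); rewrite normrN in hL.
have := normr_ge0 (h%:R * (v * ln rho)).
have := normr_ge0 (ln C); have := normr_ge0 M2.
have eh : 0 <= e / 2 * h%:R by rewrite mulr_ge0 // ltW.
have en : 0 <= e / 2 * n%:R by rewrite mulr_ge0 // ltW.
by move=> *; apply/andP; split; lra.
Qed.

Lemma cvg_of_growth (v : R) : lin_growth (fun n => ln (Q n)) (v * ln rho) ->
  (ln (m r) / ln r @[r --> 0^'+] --> v).
Proof.
move=> H; apply/cvg_right0P => e e0.
(* With y = ln r / ln rho the deviation of ln (m r) will be at most 4 e1 y = e y l: once e1 y for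
   the growth of Q, once for the factor n + 1, and 2 e1 y for the constant B. *)
pose e1 := e * l / 4; have e10 : 0 < e1 by rewrite divr_gt0 ?mulr_gt0.
have [M HM] := H _ e10; have [M2 HM2] := ln_growth e10.
pose L := v * ln rho.
(* The terms in L pay for replacing the real exponent y by n + 1 and by n - h. *)
pose B := `|M| + `|M2| + `|ln C| + (h%:R + 2) * `|L| + e1.
have B0 : 0 <= B by rewrite !addr_ge0 ?mulr_ge0 ?addr_ge0 // ltW.
have [K HK] : exists K, B / (e1 * 2) <= K%:R.
  exists (Num.truncn (B / (e1 * 2))).+1; apply/ltW/truncnS_gt.
exists (rho ^+ (maxn K h).+1) => // r /andP[r0 rK].
(* The least exponent with rho^n' < r is n' = n + 1, whence rho^(n + 1) < r <= rho^n; the bound on r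
   forces n to be at least K and h. *)
have exn := @expr_small R rho r ltac:(by rewrite rho_gt0) r0.
have [n' n'r nmin] := ex_minnP exn.
have Kn' : ((maxn K h).+1 < n')%N.
  by rewrite ltnNge; apply/negP => hh; move: (lt_trans n'r rK);
    rewrite ltNge ler_wiXn2l ?(ltW rho_gt0) ?(ltW rho_lt1) // ltnW.
case: n' n'r nmin Kn' => // n nr nmin Kn.
have rn : r <= rho ^+ n.
  by rewrite leNgt; apply/negP => /nmin; rewrite ltnn.
have Kn' : (K <= n)%N by rewrite (leq_trans (leq_maxl K h)) // ltnW.
have hn : (h <= n)%N by rewrite (leq_trans (leq_maxr K h)) // ltnW.
set y := ln r / ln rho.
have lnrho : ln rho = - l by rewrite /l opprK.
have lnr : ln r = - (y * l) by rewrite /y lnrho; field; rewrite lt0r_neq0.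
have yn : n%:R <= y.
  have : ln r <= ln (rho ^+ n) by rewrite ler_ln ?posrE.
  by rewrite ln_rX lnr lerN2 ler_pM2r.
have yn1 : y <= n%:R + 1.
  have : ln (rho ^+ n.+1) <= ln r by rewrite ler_ln ?posrE // ltW.
  by rewrite ln_rX lnr lerN2 ler_pM2r // natr1.
have lo : ln (Q n.+1) <= ln (m r).
  apply: le_trans (ln_Q_le _) _; rewrite ler_ln ?posrE; first exact/m_homo/ltW.
    exact: lt_le_trans (Q_le _).
  exact: lt_le_trans (Q_gt0 n.+1) (le_trans (Q_le _) (m_homo _ (ltW nr))).
have up : ln (m r) <= ln C + ln (n - h).+1%:R + ln (Q (n - h)%N).
  apply: le_trans (ln_le_Q _); rewrite subnK // ler_ln ?posrE; first exact: m_homo.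
    exact: lt_le_trans (Q_gt0 n.+1) (le_trans (Q_le _) (m_homo _ (ltW nr))).
  exact: lt_le_trans (Q_le _).
have main : `|ln (m r) - y * L| <= 2 * e1 * y + B.
  have := HM n.+1; have := HM (n - h)%N; have := HM2 (n - h)%N.
  rewrite natrB // -[n.+1%:R]natr1 !ler_norml -/L => g0 /andP[g1 g2] /andP[g3 g4].
  have yL : `|(y - n%:R) * L| <= `|L|.
    by rewrite normrM ler_piMl // ger0_norm; lra.
  have hL : `|h%:R * L| = h%:R * `|L| by rewrite normrM ger0_norm.
  have := ler_norm (h%:R * L); have := ler_norm (- (h%:R * L)).
  have := ler_norm L; have := ler_norm (- L); rewrite !normrN hL.
  move: yL; rewrite ler_norml => /andP[y1 y2].
  have := ler_norm M; have := ler_norm M2; have := ler_norm (ln C).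
  have := normr_ge0 M; have := normr_ge0 M2; have := normr_ge0 (ln C).
  have := normr_ge0 L.
  have eh : 0 <= e1 * h%:R by rewrite mulr_ge0 // ltW.
  have en : e1 * n%:R <= e1 * y by rewrite ler_wpM2l // ltW.
  have en0 : 0 <= e1 * n%:R by rewrite mulr_ge0 // ltW.
  have hL0 : 0 <= h%:R * `|L| by rewrite mulr_ge0.
  rewrite /B; move=> *; apply/andP; split; lra.
have y0 : 0 < y.
  apply: lt_le_trans yn; rewrite ltr0n lt0n; apply: contraTneq Kn => ->.
  by rewrite ltnS ltn0.
have By : B <= 2 * e1 * y.
  have : K%:R <= y by apply: le_trans yn; rewrite ler_nat.
  move/(le_trans HK); rewrite ler_pdivrMr ?mulr_gt0 //; lra.
have -> : ln (m r) / ln r - v = - ((ln (m r) - y * L) / (y * l)).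
  by rewrite lnr /L lnrho; field; rewrite !lt0r_neq0.
have yl : 0 < y * l by exact: mulr_gt0.
rewrite normrN normrM normfV (gtr0_norm yl).
rewrite (ler_pdivrMr _ _ yl); apply: (le_trans main).
have : 4 * e1 * y = e * (y * l) by rewrite /e1; field.
lra.
Qed.

End Compare.

End Growth.

Section LocalDimension.
Context {R : realType} (W : coverIFS R).
Variable mu : probability (measurableTypeR R) R.
Hypothesis std : standard_assumptions W mu.

Local Notation rho := (ratio W).
Local Notation p := (@weight R W).
Local Notation letter := 'I_(ifs_m W).+1.
Local Notation S := (@S_word R W).
Local Notation net := (net_intervals W).
Implicit Types (w u v : seq letter) (n : nat) (D E : R * R).

Let rho_gt0 : 0 < rho := ratio_gt0 W.
Let rho_lt1 : rho < 1 := ratio_lt1 W.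
Let rX n : 0 < rho ^+ n := rhoX_gt0 W n.
Let p0 : 0 < p ord0 := weight_gt0 ord0.

Definition ball_mass (x r : R) : R := fine (mu [set` `[x - r, x + r]]).

Let mball x r : measurable ([set` `[x - r, x + r]] : set (measurableTypeR R)).
Proof. exact: measurable_itv. Qed.

Lemma measurable_rescaled x r t n :
  measurable ([set z | [set` `[x - r, x + r]] (t + rho ^+ n * z)] :
    set (measurableTypeR R)).
Proof.
have := measurable_preimage (rho ^+ n) t (mball x r).
by congr measurable; apply/seteqP; split=> z /=; rewrite addrC.
Qed.

Lemma mu_full (A : set (measurableTypeR R)) : measurable A ->
  (forall x, 0 <= x <= 1 -> A x) -> fine (mu A) = 1.
Proof.
move=> mA HA; have : mu (~` A) = 0%E.
  apply: (mu_outside std); first exact: measurableC.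
  by move=> x Ax /HA.
rewrite probability_setC // -(mu_fineK mu mA) -EFinB => -[]; lra.
Qed.

(** The image of a word covering D contains x and has length rho^n, so it lies in the ball. *)
Lemma cover_mass_le_ball n D x : D.1 <= x <= D.2 ->
  cover_mass W n D <= ball_mass x (rho ^+ n).
Proof.
case/andP=> x1 x2; rewrite /ball_mass (mu_wsum std n) //; apply: wsum_le => w sw.
have [/andP[c1 c2]|_] := boolP (_ && _); last by rewrite mu_fine_ge0.
 rewrite mu_full //; first exact: measurable_rescaled.
move=> z /andP[z0 z1] /=; rewrite in_itv /=.
have zr : rho ^+ n * z <= rho ^+ n * 1 by rewrite ler_wpM2l // ltW.
have zr0 : 0 <= rho ^+ n * z by rewrite mulr_ge0 // ltW.
by apply/andP; split; lra.
Qed.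

Lemma cover_mass_ge n D : D \in net n -> p ord0 ^+ n <= cover_mass W n D.
Proof.
move=> /net_covered[w sw cw].
apply: le_trans (wsum_ge _ sw) => [|u _]; last by rewrite ler0n.
by rewrite -[_ && _]/(covers n w D) cw mulr1.
Qed.

Lemma cover_mass_gt0 n D : D \in net n -> 0 < cover_mass W n D.
Proof. by move/cover_mass_ge; apply: lt_le_trans; rewrite exprn_gt0. Qed.

Lemma left_mass_net n D : D \in net n -> left_mass W n D.2 = cover_mass W n D.
Proof.
move=> Dn; have [_ ab _] := net_itv01 Dn; apply: wsum_eq => w sw.
congr (nat_of_bool _)%:R; apply/andP/andP => -[h1 h2]; last first.
  by split=> //; apply: le_lt_trans ab.
have /andP[] // : covers n w D.
by apply: (covers_meet (leqnn n)) => //; apply: lt_le_trans h2.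
Qed.

Lemma right_mass_net n D : D \in net n -> right_mass W n D.1 = cover_mass W n D.
Proof.
move=> Dn; have [_ ab _] := net_itv01 Dn; apply: wsum_eq => w sw.
congr (nat_of_bool _)%:R; apply/andP/andP => -[h1 h2]; last first.
  by split=> //; apply: lt_le_trans h2.
have /andP[] // : covers n w D.
by apply: (covers_meet (leqnn n)) => //; apply: le_lt_trans ab.
Qed.

(** With rho^h below the separation constant, the ball reaches no endpoint of level n outside D. An
    image that meets it either covers D, or starts exactly at D.2, or ends exactly at D.1; the last
    two masses are O(n) times the first. *)
Lemma ball_le_cover_mass : exists h, forall n D x, D \in net n ->
  D.1 <= x <= D.2 -> ball_mass x (rho ^+ (n + h)) <=
  (1 + 2 / p ord0) * n.+1%:R * cover_mass W n D.
Proof.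
have [delta d0 gap] := endpoint_gap W; have [h hd] := @expr_small R rho delta ltac:(by rewrite rho_gt0) d0.
exists h => n D x Dn /andP[x1 x2].
have /net_intervalsP[e1 e2 ab _] := Dn; have [a0 _ b1] := net_itv01 Dn.
have hn : rho ^+ (n + h) < delta * rho ^+ n by rewrite addnC exprD ltr_pM2r.
have Q0 := cover_mass_gt0 Dn.
have start : start_mass W n D.2 <= n%:R / p ord0 * cover_mass W n D.
  by rewrite -(left_mass_net Dn); apply: start_mass_le; lra.
have final : end_mass W n D.1 <= n%:R / p ord0 * cover_mass W n D.
  by rewrite -(right_mass_net Dn); apply: end_mass_le; lra.
suff key : ball_mass x (rho ^+ (n + h)) <=
    cover_mass W n D + start_mass W n D.2 + end_mass W n D.1.
  apply: (le_trans key).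
  have : 0 <= (1 * n%:R + 2 / p ord0) * cover_mass W n D.
    by rewrite mulr_ge0 ?addr_ge0 ?mulr_ge0 ?invr_ge0 // ltW.
  by rewrite -natr1; lra.
rewrite /ball_mass (mu_wsum std n) // -!wsumD; apply: wsum_le => w sw.
have mle := mu_fine_le1 mu (measurable_rescaled x (rho ^+ (n + h)) (S w 0) n).
have [cw|ncw] := boolP (covers n w D).
  rewrite -[X in _ <= X%:R + _ + _]/(nat_of_bool (covers n w D)) cw.
  by apply: (le_trans mle); rewrite -addrA lerDl addr_ge0 ?ler0n.
have [s2|s2] := eqVneq (S w 0) D.2.
  by apply: (le_trans mle); rewrite -addrA addrCA lerDl addr_ge0 ?ler0n.
have [s1|s1] := eqVneq (S w 0 + rho ^+ n) D.1.
  by apply: (le_trans mle); rewrite lerDr addr_ge0 ?ler0n.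
rewrite (mu_outside std); rewrite ?addr_ge0 ?ler0n //.
  exact: measurable_rescaled.
move=> z /=; rewrite in_itv /= => /andP[z1 z2] /andP[z3 z4].
have zr : rho ^+ n * z <= rho ^+ n * 1 by rewrite ler_wpM2l // ltW.
have zr0 : 0 <= rho ^+ n * z by rewrite mulr_ge0 // ltW.
case/negP: ncw; apply: (covers_meet (leqnn n)) => //.
  rewrite ltNge le_eqVlt eq_sym (negPf s2) /=; apply/negP => lt2.
  by have := gap _ _ _ e2 (word_start sw) lt2; lra.
rewrite ltNge le_eqVlt (negPf s1) /=; apply/negP => lt1.
by have := gap _ _ _ (word_end sw) e1 lt1; lra.
Qed.

Lemma local_dim_growth (x : R) (D : nat -> R * R) (v : R) :
  (forall n, D n \in net n /\ (D n).1 <= x <= (D n).2) ->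
  has_local_dim mu x v <->
  lin_growth (fun n => ln (cover_mass W n (D n))) (v * ln rho).
Proof.
move=> DP; have [h Hh] := ball_le_cover_mass.
have C0 : 0 < 1 + 2 / p ord0 by rewrite addr_gt0 ?divr_gt0.
have homo (r r' : R) : 0 < r -> r <= r' -> ball_mass x r <= ball_mass x r'.
  move=> r0 rr'; rewrite -lee_fin !mu_fineK // le_measure ?inE //.
  by move=> z /=; rewrite !in_itv /= => /andP[? ?]; apply/andP; split; lra.
have Q0 n : 0 < cover_mass W n (D n) by apply: cover_mass_gt0; case: (DP n).
have Q1 n : cover_mass W n (D n) <= ball_mass x (rho ^+ n).
  by apply: cover_mass_le_ball; case: (DP n).
have Q2 n : ball_mass x (rho ^+ (n + h)) <=
    (1 + 2 / p ord0) * n.+1%:R * cover_mass W n (D n).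
  by apply: Hh; case: (DP n).
split=> H.
- exact: (growth_of_cvg rho_gt0 rho_lt1 C0 Q0 Q1 Q2).
- exact: (cvg_of_growth rho_gt0 rho_lt1 C0 homo Q0 Q1 Q2).
Qed.

End LocalDimension.

(** * Logarithmic norms of paths *)

Section PathNorm.
Context {R : realType} (W : coverIFS R).

Local Notation p := (@weight R W).
Local Notation net := (net_intervals W).
Local Notation chr := (characteristic W).
Local Notation step := (step W).
Local Notation pker := (pker W).
Implicit Types (alpha beta : charvec R) (s u : seq (charvec R)).

Let p0 : 0 < p ord0 := weight_gt0 ord0.

Lemma seq_lower_bound (T : eqType) (X : seq T) (F : T -> R) :
  (forall x, x \in X -> 0 < F x) ->
  exists2 c, 0 < c & forall x, x \in X -> c <= F x.
Proof.
move=> F0; have [c c0 cP] := seq_pos_min (map F X); exists c => // x xX.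
by apply: cP; [exact: map_f|exact: F0].
Qed.

Lemma finite_uniform (T : choiceType) (A : set T) (Phi : T -> R -> Prop) :
  finite_set A -> (forall a c c', c <= c' -> Phi a c -> Phi a c') ->
  (forall a, A a -> exists c, Phi a c) -> exists c, forall a, A a -> Phi a c.
Proof.
case/finite_seqP=> X -> mono; elim: X => [_|x X IH H]; first by exists 0.
have [|c cP] := IH _.
  by move=> a aX; apply: H; rewrite /= inE; apply/orP; right.
have [|c' c'P] := H x; first by rewrite /= inE eqxx.
exists (Num.max c c') => a; rewrite /= inE => /predU1P[->|aX].
  by apply: mono c'P; rewrite le_max lexx orbT.
by apply: mono (cP _ aX); rewrite le_max lexx.
Qed.

Definition row_sum alpha s x := \sum_(y <- cv_nbrs (last alpha s)) pker alpha s x y.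
Definition col_sum alpha s y := \sum_(x <- cv_nbrs alpha) pker alpha s x y.
(** The sum of the entries of T. *)
Definition pnorm alpha s := \sum_(x <- cv_nbrs alpha) row_sum alpha s x.

Definition wpath alpha s := Omega W alpha /\ path step alpha s.

Lemma wpath_cat alpha s s' :
  wpath alpha (s ++ s') <-> wpath alpha s /\ wpath (last alpha s) s'.
Proof.
rewrite /wpath cat_path; split=> [[Oa /andP[ps ps']]|[[Oa ps] [_ ps']]].
  by split=> //; split=> //; apply: path_Omega ps.
by rewrite ps.
Qed.

Lemma row_sum_gt0 alpha s x : wpath alpha s -> x \in cv_nbrs alpha ->
  0 < row_sum alpha s x.
Proof.
case=> Oa ps xa; have [y yl xy] := pker_row ps xa.
rewrite /row_sum (big_rem y) //= ltr_pwDl // sumr_ge0 // => z _.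
exact: pker_ge0.
Qed.

Lemma col_sum_gt0 alpha s y : wpath alpha s -> y \in cv_nbrs (last alpha s) ->
  0 < col_sum alpha s y.
Proof.
case=> Oa ps yl; have [x xa xy] := pker_col ps (Omega_uniq Oa) yl.
rewrite /col_sum (big_rem x) //= ltr_pwDl // sumr_ge0 // => z _.
exact: pker_ge0.
Qed.

Lemma row_sum_ge0 alpha s x : 0 <= row_sum alpha s x.
Proof. by apply: sumr_ge0 => y _; apply: pker_ge0. Qed.

Lemma col_sum_ge0 alpha s x : 0 <= col_sum alpha s x.
Proof. by apply: sumr_ge0 => y _; apply: pker_ge0. Qed.

Lemma pnorm_col alpha s :
  pnorm alpha s = \sum_(y <- cv_nbrs (last alpha s)) col_sum alpha s y.
Proof. exact: exchange_big. Qed.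

Lemma nbr_exists alpha : Omega W alpha -> exists x, x \in cv_nbrs alpha.
Proof.
case=> n [D [Dn ->]]; have [w sw cw] := net_covered Dn.
by exists (- rel_pos W n D (S_word w 0)); apply: word_V.
Qed.

Lemma pnorm_gt0 alpha s : wpath alpha s -> 0 < pnorm alpha s.
Proof.
move=> ws; have [x xa] := nbr_exists ws.1; rewrite /pnorm (big_rem x) //=.
rewrite ltr_pwDl ?row_sum_gt0 // sumr_ge0 // => y _; exact: row_sum_ge0.
Qed.

(** The norm of a product becomes an inner product of column sums and row sums at the joint vertex;
    the norm bounds for concatenations rest on this form. *)
Lemma pnorm_cat alpha s s' : wpath alpha s ->
  pnorm alpha (s ++ s') = \sum_(z <- cv_nbrs (last alpha s))
    col_sum alpha s z * row_sum (last alpha s) s' z.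
Proof.
case=> Oa ps; rewrite /pnorm /row_sum /col_sum last_cat.
under [RHS]eq_bigr do rewrite mulr_suml.
rewrite [RHS]exchange_big /= big_seq [RHS]big_seq; apply: eq_bigr => x xa.
under [RHS]eq_bigr do rewrite mulr_sumr.
rewrite [RHS]exchange_big /=; apply: eq_bigr => y _.
by rewrite pker_cat ?(Omega_uniq Oa).
Qed.

Lemma sum_prod_le (X : seq R) (F H : R -> R) : (forall x, 0 <= F x) ->
  (forall x, 0 <= H x) ->
  \sum_(x <- X) F x * H x <= (\sum_(x <- X) F x) * (\sum_(x <- X) H x).
Proof.
move=> F0 H0; rewrite mulr_suml big_seq [leRHS]big_seq.
apply: ler_sum => x xX; rewrite ler_wpM2l // (big_rem x) //= lerDl.
by apply: sumr_ge0.
Qed.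

Lemma pnorm_cat_le alpha s s' : wpath alpha s ->
  pnorm alpha (s ++ s') <= pnorm alpha s * pnorm (last alpha s) s'.
Proof.
move=> ws; rewrite pnorm_cat // pnorm_col; apply: sum_prod_le => x.
  exact: col_sum_ge0.
exact: row_sum_ge0.
Qed.

(** c is the least row sum of the fixed path s', positive because there is no zero row, and
    independent of s. *)
Lemma pnorm_cat_ger beta s' : wpath beta s' -> exists2 c, 0 < c &
  forall alpha s, wpath alpha s -> last alpha s = beta ->
  c * pnorm alpha s <= pnorm alpha (s ++ s').
Proof.
move=> ws'; have [c c0 cP] := @seq_lower_bound _ (cv_nbrs beta) (row_sum beta s')
  (fun x => row_sum_gt0 ws').
exists c => // alpha s ws ls; rewrite pnorm_cat // pnorm_col ls mulr_sumr.
rewrite big_seq [leRHS]big_seq; apply: ler_sum => x xb.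
by rewrite mulrC ler_wpM2l ?col_sum_ge0 // cP.
Qed.

Lemma pnorm_cat_gel alpha s : wpath alpha s -> exists2 c, 0 < c &
  forall s', wpath (last alpha s) s' ->
  c * pnorm (last alpha s) s' <= pnorm alpha (s ++ s').
Proof.
move=> ws; have [c c0 cP] := @seq_lower_bound _ _ (col_sum alpha s)
  (fun x => col_sum_gt0 ws).
exists c => // s' ws'; rewrite pnorm_cat // mulr_sumr.
rewrite big_seq [leRHS]big_seq; apply: ler_sum => x xb.
by rewrite ler_wpM2r ?row_sum_ge0 // cP.
Qed.

(** c is the least entry of the kernel of u. It does not depend on the outer paths, which u thus
    decouples up to a bounded factor. *)
Lemma pnorm_cat_pos beta u : wpath beta u -> pos_pker W beta u ->
  exists2 c, 0 < c & forall alpha s s', wpath alpha s -> last alpha s = beta ->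
  wpath (last beta u) s' ->
  c * (pnorm alpha s * pnorm (last beta u) s') <= pnorm alpha (s ++ u ++ s').
Proof.
move=> wu pu; pose X := [seq (x, y) | x <- cv_nbrs beta, y <- cv_nbrs (last beta u)].
have [|c c0 cP] := @seq_lower_bound _ X (fun xy => pker beta u xy.1 xy.2).
  by move=> xy /allpairsP[[x y] /= [xb yl ->]]; apply: pu.
exists c => // alpha s s' ws ls ws'; rewrite pnorm_cat // ls pnorm_col ls.
rewrite mulrCA mulr_suml big_seq [leRHS]big_seq; apply: ler_sum => x xb.
rewrite ler_wpM2l ?col_sum_ge0 // /row_sum last_cat.
have -> : \sum_(y <- cv_nbrs (last (last beta u) s')) pker beta (u ++ s') x y =
    \sum_(z <- cv_nbrs (last beta u)) pker beta u x z * row_sum (last beta u) s' z.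
  under eq_bigr do rewrite pker_cat ?(Omega_uniq wu.1) ?wu.2 //.
  by rewrite exchange_big /=; apply: eq_bigr => z _; rewrite mulr_sumr.
rewrite /pnorm mulr_sumr big_seq [leRHS]big_seq; apply: ler_sum => z zl.
rewrite ler_wpM2r ?row_sum_ge0 //.
by apply: (cP (x, z)); apply/allpairsP; exists (x, z).
Qed.

(* The second summand cancels the factors p_0^-1 of the transition matrices. *)
Definition plog alpha s := ln (pnorm alpha s) + (size s)%:R * ln (p ord0).

Lemma ln_ge (a b : R) : 0 < a -> a <= b -> ln a <= ln b.
Proof. by move=> a0 ab; rewrite ler_ln ?posrE // (lt_le_trans a0). Qed.

Lemma plog_cat_le alpha s s' : wpath alpha (s ++ s') ->
  plog alpha (s ++ s') <= plog alpha s + plog (last alpha s) s'.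
Proof.
move=> wss; have [ws ws'] := (wpath_cat _ _ _).1 wss.
have := ln_ge (pnorm_gt0 wss) (pnorm_cat_le s' ws).
rewrite lnM ?posrE ?pnorm_gt0 // /plog size_cat natrD mulrDl; lra.
Qed.

Lemma plog_catr beta s' : wpath beta s' -> exists C, forall alpha s,
  wpath alpha s -> last alpha s = beta ->
  `|plog alpha (s ++ s') - plog alpha s| <= C.
Proof.
move=> ws'; have [c c0 cP] := pnorm_cat_ger ws'.
exists (`|ln c| + `|ln (pnorm beta s')| + `|(size s')%:R * ln (p ord0)|).
move=> alpha s ws ls.
have wss : wpath alpha (s ++ s') by apply/wpath_cat; rewrite ls.
have pa := pnorm_gt0 ws; have pb := pnorm_gt0 ws'.
have h1 := ln_ge (mulr_gt0 c0 pa) (cP _ _ ws ls).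
have h2 := ln_ge (pnorm_gt0 wss) (pnorm_cat_le s' ws).
rewrite lnM ?posrE // in h1; rewrite ls lnM ?posrE // in h2.
rewrite /plog size_cat natrD mulrDl.
set z := _ * ln _; set z' := (size s')%:R * _.
have := ler_norm (- ln c); have := ler_norm (ln (pnorm beta s')).
have := ler_norm z'; have := ler_norm (- z'); rewrite !normrN.
have := normr_ge0 (ln (pnorm beta s')); have := normr_ge0 (ln c).
by move=> *; rewrite ler_norml; apply/andP; split; lra.
Qed.

Lemma plog_catl alpha s : wpath alpha s -> exists C, forall s',
  wpath (last alpha s) s' ->
  `|plog alpha (s ++ s') - plog (last alpha s) s'| <= C.
Proof.
move=> ws; have [c c0 cP] := pnorm_cat_gel ws.
exists (`|ln c| + `|ln (pnorm alpha s)| + `|(size s)%:R * ln (p ord0)|).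
move=> s' ws'; have wss : wpath alpha (s ++ s') by apply/wpath_cat.
have pa := pnorm_gt0 ws; have pb := pnorm_gt0 ws'.
have h1 := ln_ge (mulr_gt0 c0 pb) (cP _ ws').
have h2 := ln_ge (pnorm_gt0 wss) (pnorm_cat_le s' ws).
rewrite lnM ?posrE // in h1; rewrite lnM ?posrE // in h2.
rewrite /plog size_cat natrD mulrDl.
set z := (size s)%:R * ln _; set z' := (size s')%:R * _.
have := ler_norm (- ln c); have := ler_norm (ln (pnorm alpha s)).
have := ler_norm z; have := ler_norm (- z); rewrite !normrN.
have := normr_ge0 (ln (pnorm alpha s)); have := normr_ge0 (ln c).
by move=> *; rewrite ler_norml; apply/andP; split; lra.
Qed.

Lemma plog_cat_pos beta u : wpath beta u -> pos_pker W beta u ->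
  exists C, forall alpha s s', wpath alpha s -> last alpha s = beta ->
  wpath (last beta u) s' ->
  `|plog alpha (s ++ u ++ s') - plog alpha (s ++ u) - plog (last beta u) s'| <= C.
Proof.
move=> wu pu; have [c c0 cP] := pnorm_cat_pos wu pu.
exists (`|ln c| + `|ln (pnorm beta u)|) => alpha s s' ws ls ws'.
have wsu : wpath alpha (s ++ u) by apply/wpath_cat; rewrite ls.
have wsus : wpath alpha (s ++ u ++ s').
  by rewrite catA; apply/wpath_cat; rewrite last_cat ls.
have h := pnorm_gt0 ws; have h' := pnorm_gt0 ws'; have hu := pnorm_gt0 wu.
have h1 := ln_ge (mulr_gt0 c0 (mulr_gt0 h h')) (cP _ _ _ ws ls ws').
have h2 := ln_ge (pnorm_gt0 wsu) (pnorm_cat_le u ws).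
have h3 := @plog_cat_le alpha (s ++ u) s'.
rewrite -catA last_cat ls in h3; have {h3}h3 := h3 wsus.
rewrite lnM ?posrE ?mulr_gt0 // lnM ?posrE // in h1.
rewrite ls lnM ?posrE // in h2.
have := ler_norm (- ln c); rewrite normrN; have := ler_norm (ln (pnorm beta u)).
have := normr_ge0 (ln (pnorm beta u)); have := normr_ge0 (ln c).
move: h3; rewrite /plog !size_cat !natrD !mulrDl => *.
by rewrite ler_norml; apply/andP; split; lra.
Qed.

(** C depends on D only: the masses of its neighbours lie between two positive constants, and the
    descent enters through the kernel alone. *)
Lemma plog_cover_mass n D : D \in net n -> exists C, forall s D',
  desc W n D s D' ->
  `|ln (cover_mass W (n + size s) D') - plog (chr n D) s| <= C.
Proof.
move=> Dn; have Oa : Omega W (chr n D) by exists n, D.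
have [c c0 cP] := @seq_lower_bound _ _ (nbr_mass W n D)
  (fun x (xV : x \in V W n D) => nbr_mass_gt0 xV).
pose c' := \sum_(x <- V W n D) nbr_mass W n D x.
have cP' x : x \in V W n D -> nbr_mass W n D x <= c'.
  move=> xV; rewrite /c' (big_rem x) //= lerDl sumr_ge0 // => y _.
  exact: nbr_mass_ge0.
have c'0 : 0 < c'.
  have [x xV] := nbr_exists Oa; exact: lt_le_trans (nbr_mass_gt0 xV) (cP' _ xV).
exists (`|ln c| + `|ln c'|) => s D' ds.
have [ps D'n _ ls] := descP Dn ds.
have ws : wpath (chr n D) s by [].
have N0 := pnorm_gt0 ws.
have nE : pnorm (chr n D) s = \sum_(x <- V W n D)
    \sum_(y <- V W (n + size s) D') pker (chr n D) s x y.
  by rewrite /pnorm /row_sum -ls.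
rewrite (cover_mass_path Dn ds); set T := \sum_(x <- _) _.
have T1 : c * pnorm (chr n D) s <= T.
  rewrite nE mulr_sumr /T big_seq [leRHS]big_seq; apply: ler_sum => x xV.
  rewrite mulr_sumr; apply: ler_sum => y _.
  by rewrite ler_wpM2r ?pker_ge0 ?cP.
have T2 : T <= c' * pnorm (chr n D) s.
  rewrite nE mulr_sumr /T big_seq [leRHS]big_seq; apply: ler_sum => x xV.
  rewrite mulr_sumr; apply: ler_sum => y _.
  by rewrite ler_wpM2r ?pker_ge0 ?cP'.
have T0 : 0 < T by apply: lt_le_trans T1; rewrite mulr_gt0.
have := ln_ge (mulr_gt0 c0 N0) T1; have := ln_ge T0 T2.
rewrite !lnM ?posrE ?exprn_gt0 // lnXn // /plog mulr_natl.
have := ler_norm (- ln c); rewrite normrN; have := ler_norm (ln c').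
have := normr_ge0 (ln c'); have := normr_ge0 (ln c).
by move=> *; rewrite ler_norml; apply/andP; split; lra.
Qed.

(** A word covering the child has a prefix covering the parent. This monotonicity interpolates
    between the times at which the mass is known. *)
Lemma cover_mass_child n E D : E \in net n -> D \in children W n E ->
  cover_mass W n.+1 D <= cover_mass W n E.
Proof.
move=> En DE; have [Dn DE'] := (childrenP _ En).1 DE.
rewrite /cover_mass wsum_rcons; apply: wsum_le => w sw.
have [cw|ncw] := boolP (covers n w E).
  rewrite -[X in _ <= X%:R]/(nat_of_bool (covers n w E)) cw.
  rewrite [leRHS](_ : _ = \sum_j p j); last by rewrite (weight_sum1 W).
  apply: ler_sum => j _; apply: ler_piMr; first exact/ltW/weight_gt0.
  by rewrite lern1 leq_b1.
rewrite big1 // => j _.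
have [|_] := boolP (_ && _); last by rewrite mulr0.
move=> cw; case/negP: ncw; apply: (covers_in En Dn DE' sw).
apply: (covers_rcons (j := j) sw).
by rewrite /covers S_word_rcons sw.
Qed.

End PathNorm.

(** * Points from concatenated cycles *)

Section Realization.
Context {R : realType} (W : coverIFS R).

Local Notation rho := (ratio W).
Local Notation net := (net_intervals W).
Local Notation chr := (characteristic W).
Local Notation step := (step W).
Local Notation Om0 := (Omega0 W).
Local Notation root := (chr 0 (0, 1)).
Implicit Types (alpha beta : charvec R) (s u : seq (charvec R)).
Implicit Types (D : nat -> R * R) (gamma : nat -> charvec R).

Definition net_branch D := forall n,
  D n \in net n /\ D n.+1 \in children W n (D n).

Lemma desc_branch D N k : net_branch D ->
  desc W N (D N) [seq chr i (D i) | i <- iota N.+1 k] (D (N + k)%N).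
Proof.
move=> DB; elim: k N => [|k IH] N /=; first by rewrite addn0.
by exists (D N.+1); rewrite addnS -addSn; split=> //; case: (DB N).
Qed.

Lemma symbolic_repP x gamma : symbolic_rep W x gamma <->
  exists D, [/\ net_branch D, (forall n, (D n).1 <= x <= (D n).2) &
                forall n, gamma n = chr n (D n)].
Proof.
split=> -[D DP]; exists D.
  split=> n; have [Dn xD DD ge] := DP n => //.
  have [Dn1 _ _ _] := DP n.+1; split=> //; apply/(childrenP _ Dn).
  by split=> //; rewrite DD; have [] := parentP Dn1.
move=> n; case: DP => DB xD ge; have [Dn DE] := DB n.
by split=> //; [rewrite in_itv /= xD|rewrite (childP DE)].
Qed.

Lemma branch_exists gamma : gamma 0%N = root ->
  (forall n, step (gamma n) (gamma n.+1)) ->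
  exists D, net_branch D /\ forall n, gamma n = chr n (D n).
Proof.
move=> g0 gS.
(* The default is never taken: [step_child] supplies a child with the prescribed vector. *)
pose next n E := xget (0, 1)
  [set E' | E' \in children W n E /\ chr n.+1 E' = gamma n.+1].
pose D := fix D n := if n is n'.+1 then next n' (D n') else (0, 1).
have key n : D n \in net n /\ chr n (D n) = gamma n ->
    D n.+1 \in children W n (D n) /\ chr n.+1 (D n.+1) = gamma n.+1.
  case=> Dn cn; rewrite /= /next; case: xgetP => [E -> //|nE].
  have [|E E1 E2] := step_child (beta := gamma n.+1) Dn; first by rewrite cn.
  by case: (nE E).
have all n : D n \in net n /\ chr n (D n) = gamma n.
  elim: n => [|n IH]; first by rewrite root_net g0.
  have [DE cE] := key n IH; split=> //.
  by have [] := (childrenP _ IH.1).1 DE.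
exists D; split=> n; last by have [] := all n.
by split; [have [] := all n|have [] := key n (all n)].
Qed.

Lemma branch_mono D n k : net_branch D ->
  (D n).1 <= (D (n + k)%N).1 /\ (D (n + k)%N).2 <= (D n).2.
Proof.
move=> DB; elim: k => [|k [IH1 IH2]]; first by rewrite addn0.
rewrite addnS; have [Dn DE] := DB (n + k)%N.
have [_ /andP[h1 h2]] := (childrenP _ Dn).1 DE.
by split; lra.
Qed.

Lemma branch_point D : net_branch D ->
  exists x, forall n, (D n).1 <= x <= (D n).2.
Proof.
move=> DB; pose A := [set (D n).1 | n in [set: nat]].
have ubA n : ubound A (D n).2.
  move=> _ [k _ <-]; have [Dk _] := DB (maxn n k).
  have [_ ab _] := net_itv01 Dk.
  have := branch_mono n (maxn n k - n) DB; have := branch_mono k (maxn n k - k) DB.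
  rewrite !subnKC ?leq_maxl ?leq_maxr // => -[h1 h2] [h3 h4].
  exact: le_trans h1 (le_trans (ltW ab) h4).
have A0 : A !=set0 by exists (D 0%N).1; exists 0%N.
exists (sup A) => n; apply/andP; split.
  by apply: ub_le_sup; [exists (D 0%N).2; apply: ubA|exists n].
exact: sup_le_ub.
Qed.

Lemma cover_mass_branch D n k : net_branch D ->
  cover_mass W (n + k) (D (n + k)%N) <= cover_mass W n (D n).
Proof.
move=> DB; elim: k => [|k IH]; first by rewrite addn0.
rewrite addnS; have [Dn DE] := DB (n + k)%N.
exact: le_trans (cover_mass_child Dn DE) IH.
Qed.


Section Concatenation.
Variables (alpha : charvec R) (U : nat -> seq (charvec R)) (L : R).
Hypothesis Oa : Om0 alpha.
Hypothesis U0 : U 0%N = [::].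
Hypothesis UP : forall k, path step alpha (U k) /\ last alpha (U k) = alpha.
Hypothesis US : forall k, exists2 w, w != [::] & U k.+1 = U k ++ w.
Hypothesis Ugrowth : forall e : R, 0 < e -> exists M, forall k,
  `|plog W alpha (U k) - (size (U k))%:R * L| <= e * (size (U k))%:R + M /\
  (size (U k.+1))%:R <= (size (U k))%:R + (e * (size (U k))%:R + M).

Let size_U k : (k <= size (U k))%N.
Proof.
elim: k => // k IH; have [w w0 ->] := US k; rewrite size_cat.
by case: w w0 => //= c w _; rewrite addnS ltnS (leq_trans IH) // leq_addr.
Qed.

Let U_prefix k m : exists w, U (k + m) = U k ++ w.
Proof.
elim: m => [|m [w IH]]; first by exists [::]; rewrite addn0 cats0.
by rewrite addnS; have [w' _ ->] := US (k + m)%N; exists (w ++ w'); rewrite IH catA.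
Qed.

(** The mass along the branch is known at the times given by the lengths of the U k, and squeezed by
    monotonicity in between; the second half of [Ugrowth] makes the gaps sublinear. The measure is
    quantified inside because the point is constructed without it. *)
Lemma concat_point : exists x gamma t,
  [/\ symbolic_rep W x gamma, path step root t, last root t = alpha,
      (forall k i, (i < size (t ++ U k))%N -> gamma i.+1 = nth alpha (t ++ U k) i) &
      forall mu, standard_assumptions W mu -> forall v, v * ln rho = L ->
        has_local_dim mu x v].
Proof.
have [t pt lt] := root_path (Omega0_Omega Oa).
pose pre k := t ++ U k.
have szpre k : (k <= size (pre k))%N.
  by rewrite size_cat (leq_trans (size_U k)) // leq_addl.
(* [pre i] has at least i letters, so its entry of index i - 1 is never the default. *)
pose gamma i := if i is i'.+1 then nth alpha (pre i) i' else root.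
have gammaE k i : (i < size (pre k))%N -> gamma i.+1 = nth alpha (pre k) i.
  move=> ik; rewrite /gamma; case: (leqP k i.+1) => h.
    have [w] := U_prefix k (i.+1 - k); rewrite subnKC // => e.
    by rewrite {1}/pre e catA -/(pre k) nth_cat ik.
  have [w] := U_prefix i.+1 (k - i.+1); rewrite (subnKC (ltnW h)) => e.
  by rewrite {2}/pre e catA -/(pre i.+1) nth_cat szpre.
have ppre k : path step root (pre k).
  by rewrite cat_path pt lt; have [] := UP k.
have gS n : step (gamma n) (gamma n.+1).
  have := pathP alpha (ppre n.+1) => /(_ n (szpre _)).
  rewrite -(gammaE n.+1 n (szpre _)); case: n => // n /=.
  by rewrite -(gammaE n.+2 n) // ltnW.
have [D [DB Dg]] := branch_exists (erefl : gamma 0%N = root) gS.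
have [x xD] := branch_point DB.
exists x, gamma, t; split=> //; first by apply/symbolic_repP; exists D.
move=> mu std v vL; apply/(local_dim_growth std (D := D)).
  by move=> n; split=> //; case: (DB n).
rewrite vL; pose N0 := size t.
have DN0 : D N0 \in net N0 by case: (DB N0).
have cN0 : chr N0 (D N0) = alpha.
  have glast t' : (forall i, (i < size t')%N -> gamma i.+1 = nth alpha t' i) ->
      gamma (size t') = last root t'.
    case/lastP: t' => // t' b H.
    by rewrite size_rcons H ?size_rcons // last_rcons nth_rcons ltnn eqxx.
  rewrite -Dg -lt; apply: glast => i it.
  by have := gammaE 0%N i; rewrite /pre U0 cats0; apply.
have segE k : [seq chr i (D i) | i <- iota N0.+1 (size (U k))] = U k.
  apply: (@eq_from_nth _ alpha); rewrite size_map size_iota // => i ik.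
  rewrite (nth_map 0%N) ?size_iota // nth_iota // -Dg addSn (gammaE k).
    by rewrite nth_cat ltnNge leq_addr /= addKn.
  by rewrite size_cat ltn_add2l.
have [C CP] := plog_cover_mass DN0; rewrite cN0 in CP.
have CU k : `|ln (cover_mass W (N0 + size (U k)) (D (N0 + size (U k))%N)) -
    plog W alpha (U k)| <= C.
  by have := CP _ _ (desc_branch N0 (size (U k)) DB); rewrite size_map size_iota segE.
have Qpos n : 0 < cover_mass W n (D n) by apply: cover_mass_gt0; case: (DB n).
apply: lin_growth_ev => e e0.
(* The error at n comes from the deviations at the two surrounding times and from L times the gap
   between them; up to constants these are at most |L| + 3 times e1 a. The bound e1 <= 1 serves to
   estimate e1 b by e1 a. *)
pose e1 := Num.min 1 (e / (`|L| + 3)).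
have L3 : 0 < `|L| + 3 by rewrite ltr_wpDl.
have e10 : 0 < e1 by rewrite lt_min ltr01 divr_gt0.
have e1le : e1 <= 1 by rewrite ge_min lexx.
have e1e : (`|L| + 3) * e1 <= e.
  by rewrite mulrC -ler_pdivlMr // ge_min lexx orbT.
have [M HM] := Ugrowth e10.
exists N0, (`|L| * (N0%:R + `|M|) + 2 * `|M| + e1 * `|M| + `|C|) => n Nn.
have [k [k1 k2]] : exists k, (size (U k) <= n - N0)%N /\ (n - N0 < size (U k.+1))%N.
  have ex : exists k, (size (U k) <= n - N0)%N by exists 0%N; rewrite U0.
  have bd k : (size (U k) <= n - N0)%N -> (k <= n - N0)%N.
    exact: leq_trans (size_U k).
  have [k kP kmax] := ex_maxnP ex bd; exists k; split=> //.
  by rewrite ltnNge; apply/negP => /kmax; rewrite ltnn.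
have Qup : ln (cover_mass W n (D n)) <=
    ln (cover_mass W (N0 + size (U k)) (D (N0 + size (U k))%N)).
  apply: ln_ge => //; have := cover_mass_branch (N0 + size (U k)) (n - N0 - size (U k)) DB.
  by rewrite -addnA (subnKC k1) (subnKC Nn).
have Qlo : ln (cover_mass W (N0 + size (U k.+1)) (D (N0 + size (U k.+1))%N)) <=
    ln (cover_mass W n (D n)).
  apply: ln_ge => //.
  have := cover_mass_branch n (N0 + size (U k.+1) - n) DB.
  rewrite subnKC // -[X in (X <= _)%N](subnKC Nn) leq_add2l; exact: ltnW.
have [h1 h2] := HM k; have [h3 _] := HM k.+1.
have := CU k; have := CU k.+1.
set a := (size (U k))%:R in h1 h2 *; set b := (size (U k.+1))%:R in h2 h3.
have a0 : 0 <= a by apply: ler0n.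
have ka : N0%:R + a <= n%:R.
  by rewrite -natrD ler_nat -(subnKC Nn) leq_add2l.
have kb : n%:R <= N0%:R + b.
  by rewrite -natrD ler_nat -{1}(subnKC Nn) leq_add2l ltnW.
have Lup : `|(n%:R - a) * L| <= (N0%:R + (e1 * a + `|M|)) * `|L|.
  rewrite normrM ler_wpM2r // ger0_norm ?subr_ge0; last first.
    by apply: le_trans ka; rewrite lerDr.
  have := ler_norm M; lra.
have Llo : `|(b - n%:R) * L| <= (N0%:R + (e1 * a + `|M|)) * `|L|.
  rewrite normrM ler_wpM2r // ler_norml; have := ler_norm M.
  have N00 : 0 <= N0%:R :> R by apply: ler0n.
  have ea : 0 <= e1 * a by rewrite mulr_ge0 // ltW.
  have := normr_ge0 M.
  by move=> *; apply/andP; split; lra.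
have ea : (`|L| + 3) * (e1 * a) <= e * n%:R.
  rewrite mulrA ler_pM // ?mulr_ge0 ?(ltW e10) ?(ltW L3) //.
  by apply: le_trans ka; rewrite lerDr.
have ea0 : 0 <= e1 * a by rewrite mulr_ge0 // ltW.
have eb : e1 * b <= e1 * a + (e1 * a + e1 * `|M|).
  rewrite -!mulrDr ler_wpM2l ?(ltW e10) //; apply: (le_trans h2).
  rewrite lerD2l; apply: lerD; last exact: ler_norm.
  by rewrite ler_piMl.
have := ler_norm M; have := ler_norm C; have := normr_ge0 C; have := normr_ge0 M.
have : 0 <= `|L| * (e1 * a) by rewrite mulr_ge0.
move: Lup Llo h1 h3; rewrite !ler_norml => /andP[? ?] /andP[? ?] /andP[? ?] /andP[? ?].
move=> ? ? ? ? ? /andP[? ?] /andP[? ?].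
by apply/andP; split; lra.
Qed.

End Concatenation.

End Realization.

(** * Good cycles *)

Section Cycles.
Context {R : realType} (W : coverIFS R).

Local Notation rho := (ratio W).
Local Notation net := (net_intervals W).
Local Notation chr := (characteristic W).
Local Notation step := (step W).
Local Notation Om0 := (Omega0 W).
Local Notation plog := (plog W).
Local Notation wpath := (wpath W).
Implicit Types (beta : charvec R) (s u w : seq (charvec R)).

Let rho_gt0 : 0 < rho := ratio_gt0 W.
Let rho_lt1 : rho < 1 := ratio_lt1 W.

Variables (alpha : charvec R) (P : seq (charvec R)).
Hypotheses (Oa : Om0 alpha) (P0 : P != [::]).
Hypotheses (pP : path step alpha P) (lP : last alpha P = alpha).
Hypothesis posP : pos_pker W alpha P.

Let Oa' : Omega W alpha := Omega0_Omega Oa.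

Definition cyc w := path step alpha w /\ last alpha w = alpha.

(** Ending with P makes the kernel positive, as a period needs, and separates what follows from what
    precedes. *)
Definition good w := exists2 u, cyc u & w = u ++ P.

Lemma cyc_cat u w : cyc u -> cyc w -> cyc (u ++ w).
Proof. by case=> pu lu [pw lw]; rewrite /cyc cat_path last_cat lu pu. Qed.

Lemma cyc_wpath w : cyc w -> wpath alpha w.
Proof. by case. Qed.

Lemma good_cyc w : good w -> cyc w.
Proof. by case=> u cu ->; apply: cyc_cat. Qed.

Lemma good_neq0 w : good w -> w != [::].
Proof. by case=> u _ ->; case: u => //; case: P P0. Qed.

Lemma good_catl u w : cyc u -> good w -> good (u ++ w).
Proof.
move=> cu [w' cw' ->]; exists (u ++ w'); last by rewrite catA.
exact: cyc_cat.
Qed.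

Lemma good_pos w : good w -> pos_pker W alpha w.
Proof.
move=> gw; have [pw _] := good_cyc gw; case: gw pw => u [pu lu] -> pw.
by apply: pos_pker_catl => //; rewrite lu.
Qed.

Lemma plog_quasi : exists2 C : R, 0 <= C & forall u w, good u -> cyc w ->
  `|plog alpha (u ++ w) - plog alpha u - plog alpha w| <= C.
Proof.
have wP : wpath alpha P by [].
have [C CP] := plog_cat_pos wP posP; exists `|C| => // _ w [u cu ->] cw.
have := CP alpha u w (cyc_wpath cu) cu.2; rewrite lP => /(_ (cyc_wpath cw)).
by rewrite catA => /le_trans; apply; apply: ler_norm.
Qed.

(* Initial segments of the branch of x are closed up inside the essential class,
   at a bounded cost. *)
Lemma good_approx mu x v : standard_assumptions W mu -> essential W x ->
  has_local_dim mu x v -> forall (e : R) K, 0 < e -> exists w,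
  [/\ good w, (K <= size w)%N &
      `|plog alpha w - (size w)%:R * (v * ln rho)| <= e * (size w)%:R].
Proof.
move=> std [gamma /symbolic_repP[D [DB xD Dg]] [N Ng]] hv e K e0.
have Dnet n : D n \in net n by case: (DB n).
have {}hv : lin_growth (fun n => ln (cover_mass W n (D n))) (v * ln rho).
  by apply/(local_dim_growth std (D := D)) => // n; split.
set L := v * ln rho in hv *.
have ON : Om0 (chr N (D N)) by rewrite -Dg; apply: Ng.
have [t0 [_ pt0 lt0]] := Omega0_connect Oa ON.
have wt0 : wpath alpha t0 by [].
have [C0 C0P] := plog_catl wt0.
have wP : wpath alpha P by [].
have [CP CPP] := plog_catr wP.
(* A return path from beta to alpha whose length and cost are at most c; finiteness of the essential
   class makes c uniform. *)
pose Phi beta (c : R) := exists t, [/\ path step beta t, last beta t = alpha,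
  (size t)%:R <= c & forall a s, wpath a s -> last a s = beta ->
  `|plog a (s ++ t) - plog a s| <= c].
have [C1 C1P] : exists c, forall beta, Om0 beta -> Phi beta c.
  apply: finite_uniform.
  - apply: sub_finite_set (finite_Omega W) => b; exact: Omega0_Omega.
  - move=> b c c' cc' [t [pt lt st tP]]; exists t; split=> //.
      exact: le_trans cc'.
    by move=> a s ws ls; apply: le_trans (tP _ _ ws ls) cc'.
  move=> b Ob; have [t [_ pt lt]] := Omega0_connect Ob Oa.
  have wt : wpath b t by split=> //; exact: Omega0_Omega.
  have [c cP] := plog_catr wt; exists (`|c| + (size t)%:R), t; split=> //.
    by rewrite lerDr.
  move=> a s ws ls; apply: le_trans (cP _ _ ws ls) _.
  by have := ler_norm c; have := ler0n R (size t); lra.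
have [C2 C2P] := plog_cover_mass (Dnet N).
have e2 : 0 < e / 2 by rewrite divr_gt0.
have [M HM] := hv _ e2.
pose B := `|C0| + `|C1| + `|CP| + `|C2| + `|M| + e * N%:R +
  `|L| * ((size t0)%:R + `|C1| + (size P)%:R + N%:R).
have [k [kK kB]] : exists k : nat, (K <= k)%N /\ B <= e / 2 * k%:R.
  exists (maxn K (Num.truncn (B / (e / 2))).+1); split; first exact: leq_maxl.
  rewrite mulrC -ler_pdivrMr //; apply: le_trans (ltW (truncnS_gt _)) _.
  by rewrite ler_nat leq_maxr.
pose s := [seq chr i (D i) | i <- iota N.+1 k].
have ss : size s = k by rewrite size_map size_iota.
have ds := desc_branch N k DB; rewrite -/s in ds.
have [ps _ _ ls] := descP (Dnet N) ds.
have [t [pt lt st tP]] := C1P _ (Omega0_last ON ps).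
(* t0 leads from alpha to the vertex at which the branch of x has become essential, s follows the
   branch, t returns to alpha, and P makes the cycle good. Only s is long. *)
exists (t0 ++ s ++ t ++ P).
have cst : cyc (t0 ++ s ++ t).
  by rewrite /cyc !cat_path !last_cat lt0 pt0 ps pt lt.
have szw : (size (t0 ++ s ++ t ++ P))%:R =
    (size t0)%:R + k%:R + (size t)%:R + (size P)%:R :> R.
  by rewrite !size_cat ss !natrD; ring.
split.
- by exists (t0 ++ s ++ t) => //; rewrite -!catA.
- by rewrite !size_cat ss addnCA (leq_trans kK) // leq_addr.
have ws : wpath (chr N (D N)) s by split=> //; exact: Omega0_Omega.
have wt : wpath (last (chr N (D N)) s) t.
  by split=> //; exact: Omega0_Omega (Omega0_last ON ps).
have wst : wpath (chr N (D N)) (s ++ t) by apply/wpath_cat.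
have lst : last (chr N (D N)) (s ++ t) = alpha by rewrite last_cat.
have wstP : wpath (chr N (D N)) ((s ++ t) ++ P).
  by apply/wpath_cat; rewrite lst.
have := C0P ((s ++ t) ++ P); rewrite lt0 => /(_ wstP).
have := CPP _ _ wst lst.
have := tP _ _ ws erefl.
have := C2P _ _ ds; rewrite ss.
have := HM (N + k)%N; rewrite -catA szw natrD.
set q := ln _; set z1 := plog _ s; set z2 := plog _ (s ++ t).
set z3 := plog _ (s ++ t ++ P); set z4 := plog _ (t0 ++ _).
have Ldiff : `|((size t0)%:R + (size t)%:R + (size P)%:R - N%:R) * L| <=
    `|L| * ((size t0)%:R + `|C1| + (size P)%:R + N%:R).
  rewrite normrM mulrC ler_wpM2l // ler_norml.
  have := ler_norm C1; have := ler0n R (size t); have := ler0n R (size t0).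
  have := ler0n R (size P); have := ler0n R N; have := normr_ge0 C1.
  by move=> *; apply/andP; split; lra.
have := ler_norm C0; have := ler_norm C1; have := ler_norm CP.
have := ler_norm C2; have := ler_norm M.
have eN : 0 <= e * N%:R by rewrite mulr_ge0 // ltW.
have es : 0 <= e * ((size t0)%:R + (size t)%:R + (size P)%:R).
  by rewrite mulr_ge0 ?addr_ge0 // ltW.
move: Ldiff kB; rewrite /B !ler_norml.
move=> /andP[? ?] ? ? ? ? ? ? /andP[? ?] /andP[? ?] /andP[? ?] /andP[? ?] /andP[? ?].
by apply/andP; split; lra.
Qed.

(* (g k - C) / k <= (g j + C) / j for all j and k. *)
Lemma quasi_additive (g : nat -> R) (C : R) :
  (forall j k, (0 < j)%N -> (0 < k)%N -> `|g (j + k)%N - g j - g k| <= C) ->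
  exists l, forall k, (0 < k)%N -> `|g k - k%:R * l| <= C.
Proof.
move=> H.
have mulg k j : (0 < k)%N -> (0 < j)%N ->
    `|g (k * j)%N - k%:R * g j| <= (k%:R - 1) * C.
  case: k => // k _ j0; elim: k => [|k IH].
    by rewrite mul1n mul1r !subrr normr0 mul0r.
  have := H j (k.+1 * j)%N j0; rewrite muln_gt0 j0 => /(_ erefl).
  rewrite -[(j + _)%N]mulSn; move: IH; rewrite !ler_norml -[k.+2%:R]natr1.
  move=> /andP[? ?] /andP[? ?]; apply/andP; split; lra.
have comp j k : (0 < j)%N -> (0 < k)%N -> (g k - C) / k%:R <= (g j + C) / j%:R.
  move=> j0 k0; rewrite ler_pdivrMr ?ltr0n // mulrAC ler_pdivlMr ?ltr0n //.
  have := mulg j k j0 k0; have := mulg k j k0 j0; rewrite mulnC !ler_norml.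
  have C0 : 0 <= C by apply: le_trans (H 1%N 1%N _ _).
  move=> /andP[? ?] /andP[? ?]; lra.
pose A := [set (g k.+1 - C) / k.+1%:R | k in [set: nat]].
have A0 : A !=set0 by exists ((g 1%N - C) / 1%:R), 0%N.
have ubA j : (0 < j)%N -> ubound A ((g j + C) / j%:R).
  by move=> j0 _ [k _ <-]; apply: comp.
exists (sup A) => -[//|k] _.
have k0 : 0 < k.+1%:R :> R by rewrite ltr0n.
have h1 : (g k.+1 - C) / k.+1%:R <= sup A.
  by apply: ub_le_sup; [exists ((g 1%N + C) / 1%:R); apply: ubA|exists k].
have h2 : sup A <= (g k.+1 + C) / k.+1%:R by apply: sup_le_ub => //; apply: ubA.
move: h1 h2; rewrite ler_pdivrMr // ler_pdivlMr // => h1 h2.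
by rewrite ler_norml; apply/andP; split; lra.
Qed.

(** Copies are added on the right, so that each power extends the previous one as [concat_point]
    requires. *)
Fixpoint power w k : seq (charvec R) :=
  if k is k'.+1 then power w k' ++ w else [::].

Lemma size_power w k : size (power w k) = (k * size w)%N.
Proof. by elim: k => //= k IH; rewrite size_cat IH mulSn addnC. Qed.

Lemma power_add w j k : power w (j + k) = power w j ++ power w k.
Proof.
by elim: k => [|k IH]; rewrite ?addn0 ?cats0 // addnS /= IH catA.
Qed.

Lemma power_cyc w k : cyc w -> cyc (power w k).
Proof. by move=> cw; elim: k => [|k IH] //=; apply: cyc_cat. Qed.

Lemma nth_power w k i : (i < k * size w)%N ->
  nth alpha (power w k) i = nth alpha w (i %% size w).
Proof.
elim: k i => // k IH i ik /=; rewrite nth_cat size_power.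
case: ltnP => h; first exact: IH.
rewrite -{2}(subnKC h) modnMDl modn_small //.
by rewrite ltn_subLR // addnC -mulSn.
Qed.

(** For the cycle alpha :: w, the word w omits the first letter and theta^- the last, so they differ
    by a rotation of one place. *)
Lemma nth_belast_shift w i : w != [::] -> last alpha w = alpha ->
  nth alpha w ((size w + i).-1 %% size w) = nth alpha (belast alpha w) (i %% size w).
Proof.
move=> w0 lw; have m0 : (0 < size w)%N by rewrite lt0n size_eq0.
have rm := ltn_pmod i m0; rewrite [in LHS](divn_eq i (size w)).
have -> r : (r < size w)%N -> nth alpha (belast alpha w) r = nth alpha (alpha :: w) r.
  by move=> h; rewrite lastI nth_rcons size_belast h.
case: (i %% size w)%N rm => [|r] rm /=.
  rewrite addn0 -{1}(prednK m0) addSn /= addnC modnMDl modn_small ?prednK //.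
  by rewrite nth_last -[RHS]lw; case: w w0 {lw m0 rm}.
by rewrite !addnS /= addnA -mulSn modnMDl modn_small // ltnW.
by [].
Qed.

(** Quasi-additivity makes the powers of w grow linearly at some rate l, with error C already at the
    first power. Hence the dimension of the repeated cycle is read off [plog alpha w] at a cost
    independent of w. *)
Lemma good_periodic mu (C : R) w : standard_assumptions W mu ->
  (forall u w, good u -> cyc w ->
     `|plog alpha (u ++ w) - plog alpha u - plog alpha w| <= C) ->
  good w -> exists x v, [/\ essential_positive_periodic W x,
    has_local_dim mu x v &
    `|plog alpha w - (size w)%:R * (v * ln rho)| <= C].
Proof.
move=> std HC gw; have cw := good_cyc gw; have w0 := good_neq0 gw.
have gp k : (0 < k)%N -> good (power w k).
  by case: k => // k _; apply: good_catl => //; apply: power_cyc.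
have sw0 : (0 < size w)%N by rewrite lt0n size_eq0.
have Hq j k : (0 < j)%N -> (0 < k)%N -> `|plog alpha (power w (j + k)) -
    plog alpha (power w j) - plog alpha (power w k)| <= C.
  by move=> j0 k0; rewrite power_add; apply: HC; [exact: gp|exact: power_cyc].
have [l lP'] := @quasi_additive (fun k => plog alpha (power w k)) C Hq.
have lnrho : ln rho < 0 by rewrite ln_lt0 // rho_gt0.
pose L := l / (size w)%:R.
have sw : 0 < (size w)%:R :> R by rewrite ltr0n.
have lE : l = (size w)%:R * L by rewrite /L mulrC divfK ?gt_eqF.
have Ug (e : R) : 0 < e -> exists M, forall k,
    `|plog alpha (power w k) - (size (power w k))%:R * L| <=
      e * (size (power w k))%:R + M /\
    (size (power w k.+1))%:R <= (size (power w k))%:R +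
      (e * (size (power w k))%:R + M).
  move=> e0; exists (`|C| + `|plog alpha [::]| + (size w)%:R) => k.
  have ek : 0 <= e * (size (power w k))%:R by rewrite mulr_ge0 // ltW.
  have C0 := normr_ge0 C; have n0 := normr_ge0 (plog alpha [::]).
  split; last by rewrite /= size_cat natrD; lra.
  case: k ek => [|k] ek; first by rewrite /= mul0r subr0; lra.
  have := lP' k.+1 (ltn0Sn k); rewrite lE mulrA -natrM -size_power.
  by move=> /le_trans; apply; have := ler_norm C; lra.
have [x [gamma [t [rep pt lt gE dim]]]] := @concat_point _ W alpha (power w) L Oa
  erefl (fun k => power_cyc k cw) (fun k => ex_intro2 _ _ w w0 erefl) Ug.
exists x, (L / ln rho); split.
- exists alpha, w; split; last by
    move=> i j; rewrite path_transitionE ?cw.2 ?(Omega_uniq Oa') //;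
    apply: (good_pos gw); apply: mem_nth; rewrite ?ltn_ord // -{2}cw.2 ltn_ord.
    split; first by split=> //; [split=> //; exact: cw.1|exact: cw.2].
    (* The period is declared to start one full turn after t, since t may be empty and the
       definition counts from k + 1. *)
    exists gamma, (size t + size w).-1; split=> // i.
    rewrite prednK ?addn_gt0 ?sw0 ?orbT // size_belast.
    have -> : (size t + size w + i = (size t + (size w + i).-1).+1)%N.
      by rewrite -addnA -addnS prednK // addn_gt0 sw0.
    have im : ((size w + i).-1 < i.+2 * size w)%N.
      apply: leq_ltn_trans (leq_pred _) _.
      by rewrite [(i.+2 * _)%N]mulSn ltn_add2l leq_pmulr.
    rewrite (gE i.+2); last by rewrite size_cat size_power ltn_add2l.
    rewrite nth_cat ltnNge leq_addr /= addKn -[power w i.+1 ++ w]/(power w i.+2).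
    by rewrite nth_power // nth_belast_shift // cw.2.
  move=> b; rewrite inE => /predU1P[->//|].
  exact: Omega0_path Oa cw.1 _.
- by apply: dim => //; rewrite divfK // lt_eqF.
by rewrite divfK ?lt_eqF // -lE; have := lP' 1%N erefl; rewrite mul1r.
Qed.

End Cycles.

(** * Mixing good cycles *)

Section Mixing.
Context {R : realType} (W : coverIFS R).

Local Notation rho := (ratio W).
Local Notation step := (step W).
Local Notation Om0 := (Omega0 W).
Local Notation plog := (plog W).


Variables (alpha : charvec R) (P : seq (charvec R)).
Hypotheses (Oa : Om0 alpha) (P0 : P != [::]).
Hypotheses (pP : path step alpha P) (lP : last alpha P = alpha).

Local Notation good := (good W alpha P).
Local Notation cyc := (cyc W alpha).
Implicit Types u w : seq (charvec R).

(** J waits until n has reached b j * (j + 1) for the next j; the term b 0 pays for the initial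
    value. Later b bounds the lengths of the cycles of stage j. *)
Lemma slow_index (b : nat -> R) : (forall j, 0 <= b j) -> exists J : nat -> nat,
  (forall n, b (J n) * (J n).+1%:R <= n%:R + b 0%N) /\
  (forall j0, exists N, forall n, (N <= n)%N -> (j0 <= J n)%N).
Proof.
move=> b0; pose J := fix J n := if n is n'.+1 then
  if b (J n').+1 * (J n').+2%:R <= n'.+1%:R then (J n').+1 else J n' else 0%N.
have Jmono m n : (J m <= J (m + n))%N.
  elim: n => [|n IH]; first by rewrite addn0.
  by rewrite addnS /=; case: ifP => // _; apply: leqW.
exists J; split=> [n|j0].
  elim: n => [|n IH] /=; first by rewrite mulr1 add0r.
  case: ifP => [h|_]; first by apply: (le_trans h); rewrite lerDl.
  by apply: (le_trans IH); rewrite lerD2r ler_nat.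
elim: j0 => [|j0 [N HN]]; first by exists 0%N.
pose K := maxn N (Num.truncn (b j0.+1 * j0.+2%:R)).+1.
exists K.+1 => n Kn.
suff : (j0 < J K.+1)%N by move/leq_trans; apply; rewrite -(subnKC Kn).
have := HN K (leq_maxl _ _); rewrite leq_eqVlt => /predU1P[e|jK].
  rewrite /= -e ifT //; apply: le_trans (ltW (truncnS_gt _)) _.
  by rewrite ler_nat leqW // leq_maxr.
by apply: (leq_trans jK); have := Jmono K 1%N; rewrite addn1.
Qed.

Variable C : R.
Hypothesis C0 : 0 <= C.
Hypothesis HC : forall u w, good u -> cyc w ->
  `|plog alpha (u ++ w) - plog alpha u - plog alpha w| <= C.

(* Concatenating greedily cycles whose mean is almost at most, resp. at least,
   L keeps the accumulated deviation sublinear. *)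
Lemma mixing (L : R) :
  (forall (e : R) K, 0 < e -> exists w, [/\ good w, (K <= size w)%N &
     plog alpha w - (size w)%:R * L <= e * (size w)%:R]) ->
  (forall (e : R) K, 0 < e -> exists w, [/\ good w, (K <= size w)%N &
     - (e * (size w)%:R) <= plog alpha w - (size w)%:R * L]) ->
  exists2 x, essential W x & forall mu, standard_assumptions W mu ->
    forall v, v * ln rho = L -> has_local_dim mu x v.
Proof.
move=> Hlow Hup; pose g w := plog alpha w - (size w)%:R * L.
(* The initial concatenation is empty, hence not good; the second term is the error of joining a
   cycle to it. *)
pose C' := C + `|plog alpha [::]|.
have C'0 : 0 <= C' by rewrite addr_ge0.
have jpos j : 0 < j.+1%:R :> R by rewrite ltr0n.
have jinv j : 0 < j.+1%:R^-1 :> R by rewrite invr_gt0.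
have large j w : ((Num.truncn (C' * j.+1%:R)).+1 <= size w)%N ->
    C' <= j.+1%:R^-1 * (size w)%:R.
  move=> h; rewrite mulrC ler_pdivlMr //; apply: le_trans (ltW (truncnS_gt _)) _.
  by rewrite ler_nat.
(* The cycles [th j] have mean at most L + 1/(j + 1), the cycles [ph j] below at least L - 1/(j +
   1); both are so long that a junction costs at most 1/(j + 1) per letter. *)
have /boolp.choice[th thP] : forall j, exists w, [/\ good w,
    C' <= j.+1%:R^-1 * (size w)%:R & g w <= j.+1%:R^-1 * (size w)%:R].
  move=> j; have [w [gw sw hw]] :=
    Hlow _ (Num.truncn (C' * j.+1%:R)).+1 (jinv j).
  by exists w; split=> //; apply: large.
have /boolp.choice[ph phP] : forall j, exists w, [/\ good w,
    C' <= j.+1%:R^-1 * (size w)%:R & - (j.+1%:R^-1 * (size w)%:R) <= g w].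
  move=> j; have [w [gw sw hw]] :=
    Hup _ (Num.truncn (C' * j.+1%:R)).+1 (jinv j).
  by exists w; split=> //; apply: large.
pose b j := (size (th j))%:R + (size (ph j))%:R + `|g (th j)| + `|g (ph j)|.
have b_ge0 j : 0 <= b j by rewrite !addr_ge0.
have [J [Jb Jinf]] := slow_index b_ge0.
pose sel j (neg : bool) := if neg then ph j else th j.
have good_sel j neg : good (sel j neg).
  by rewrite /sel; case: neg; [case: (phP j)|case: (thP j)].
have size_sel j neg : (size (sel j neg))%:R <= b j.
  have := normr_ge0 (g (th j)); have := normr_ge0 (g (ph j)).
  have := ler0n R (size (th j)); have := ler0n R (size (ph j)).
  by rewrite /b /sel; case: neg; lra.
have g_sel j neg : `|g (sel j neg)| <= b j.
  have := normr_ge0 (g (th j)); have := normr_ge0 (g (ph j)).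
  have := ler0n R (size (th j)); have := ler0n R (size (ph j)).
  by rewrite /b /sel; case: neg; lra.
have C_sel j neg : C' <= j.+1%:R^-1 * (size (sel j neg))%:R.
  by rewrite /sel; case: neg; [case: (phP j)|case: (thP j)].
(* The sign of the deviation decides which kind of cycle comes next, the length of u how accurate it
   is. By the choice of J the new cycle is eventually a small fraction of u. *)
pose next u := sel (J (size u)) (g u <= 0).
pose U := fix U k := if k is k'.+1 then U k' ++ next (U k') else [::].
have US k : U k.+1 = U k ++ next (U k) by [].
have cyc0 : cyc [::] by [].
have U_good k : k = 0%N \/ good (U k).
  elim: k => [|k IH]; first by left.
  right; rewrite US; apply: good_catl; last exact: good_sel.
  case: IH => [k0|gU]; first by rewrite k0.
  exact (good_cyc pP lP gU).
have U_cyc k : cyc (U k).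
  case: (U_good k) => [k0|gU]; first by rewrite k0.
  exact (good_cyc pP lP gU).
have g_cat k w : good w -> `|g (U k ++ w) - g (U k) - g w| <= C'.
  move=> gw; have cw : cyc w by exact (good_cyc pP lP gw).
  have -> : g (U k ++ w) - g (U k) - g w =
      plog alpha (U k ++ w) - plog alpha (U k) - plog alpha w.
    by rewrite /g size_cat natrD; ring.
  case: (U_good k) => [->|gU].
    by rewrite /= addrAC subrr add0r normrN /C' lerDr.
  by apply: le_trans (HC gU cw) _; rewrite lerDl.
pose n k : R := (size (U k))%:R.
have nS k : n k.+1 = n k + (size (next (U k)))%:R by rewrite /n US size_cat natrD.
have n_ge0 k : 0 <= n k by apply: ler0n.
have bJ m : b (J m) <= m%:R + b 0%N.
  by apply: le_trans (Jb m); rewrite ler_peMr // ler1n.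
(* Either the new cycle carries the deviation across 0, which leaves at most one cycle's worth of
   it, or the deviation grows by at most 2/(j + 1) per letter, one part for the mean and one for the
   junction. *)
have gstep k : let j := J (size (U k)) in
    `|g (U k.+1)| <= b j + C' \/
    `|g (U k.+1)| <= `|g (U k)| + 2 * (j.+1%:R^-1 * (n k.+1 - n k)).
  move=> j; set w := next (U k); have gw : good w by apply: good_sel.
  have := g_cat k w gw; rewrite -/w -US.
  have -> : n k.+1 - n k = (size w)%:R by rewrite nS addrC addKr.
  have := C_sel j (g (U k) <= 0); rewrite -/(next (U k)) -/w.
  have := g_sel j (g (U k) <= 0); rewrite -/(next (U k)) -/w.
  set z := j.+1%:R^-1 * _.
  have sgn : (g (U k) <= 0 /\ - z <= g w) \/ (0 <= g (U k) /\ g w <= z).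
    rewrite /z /w /next /sel -/j; case: (leP (g (U k)) 0) => h.
      by left; split=> //; case: (phP j).
    by right; split; [exact: ltW|case: (thP j)].
  rewrite ler_norml => /andP[h1 h2] h3; rewrite ler_norml => /andP[h4 h5].
  case: sgn => -[s1 s2].
    have := ler_norm (- g (U k)); rewrite normrN => h6.
    have [s|s] := leP 0 (g (U k) + g w).
      by left; rewrite ler_norml; apply/andP; split; lra.
    by right; rewrite ler_norml; apply/andP; split; lra.
  have h6 := ler_norm (g (U k)).
  have [s|s] := leP 0 (g (U k) + g w).
    by right; rewrite ler_norml; apply/andP; split; lra.
  by left; rewrite ler_norml; apply/andP; split; lra.
pose M0 := b 0%N + C' + `|g [::]|.
have b00 := b_ge0 0%N.
have nmono k : n k <= n k.+1 by rewrite nS lerDl.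
(* For the steps at which U k is still too short for J to match the given e. *)
have crude k : `|g (U k)| <= 2 * n k + M0.
  elim: k => [|k IH].
    by rewrite /M0; have := n_ge0 0%N; have -> : U 0%N = [::] by []; lra.
  have := bJ (size (U k)); rewrite -/(n k) => hb.
  have h := nmono k; have h0 := n_ge0 k; have hg := normr_ge0 (g [::]).
  case: (gstep k) => hs; apply: (le_trans hs); first by rewrite /M0; lra.
  have : (J (size (U k))).+1%:R^-1 * (n k.+1 - n k) <= 1 * (n k.+1 - n k).
    by rewrite ler_wpM2r ?subr_ge0 // invf_le1 // ler1n.
  by move: IH; set z := _^-1 * _; lra.
have lenb k : n k.+1 <= n k + b (J (size (U k))) by rewrite nS lerD2l size_sel.
have Ug (e : R) : 0 < e -> exists M, forall k,
    `|plog alpha (U k) - (size (U k))%:R * L| <= e * (size (U k))%:R + M /\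
    (size (U k.+1))%:R <= (size (U k))%:R + (e * (size (U k))%:R + M).
  move=> e0; have e2 : 0 < e / 2 by rewrite divr_gt0.
  have [N HN] := Jinf (Num.truncn ((e / 2)^-1)).+1.
  have small m : (N <= m)%N -> (J m).+1%:R^-1 <= e / 2.
    move=> /HN h; rewrite invf_ple ?posrE //.
    apply: le_trans (ltW (truncnS_gt _)) _; by rewrite ler_nat leqW.
  pose Me := 2 * N%:R + 2 * b 0%N + e * b 0%N.
  have N0 : 0 <= N%:R :> R by apply: ler0n.
  have eb0 : 0 <= e * b 0%N by rewrite mulr_ge0 // ltW.
  have be k : b (J (size (U k))) <= e * n k + Me.
    have en : 0 <= e * n k by rewrite mulr_ge0 // ltW.
    have [h|h] := leqP N (size (U k)).
      have : b (J (size (U k))) <= (n k + b 0%N) * (J (size (U k))).+1%:R^-1.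
        by rewrite ler_pdivlMr // Jb.
      have : (n k + b 0%N) * (J (size (U k))).+1%:R^-1 <= (n k + b 0%N) * (e / 2).
        by rewrite ler_wpM2l ?addr_ge0 // small.
      by move=> h1 h2; have := le_trans h2 h1; rewrite /Me; lra.
    have := bJ (size (U k)); have : n k <= N%:R by rewrite /n ler_nat ltnW.
    by rewrite -/(n k) /Me; lra.
  exists (Me + C' + M0 + 4 * N%:R + 2 * b 0%N) => k; rewrite -/(n k) -/(n k.+1).
  have M00 : 0 <= M0 by rewrite /M0 !addr_ge0.
  split; last by have := lenb k; have := be k; lra.
  rewrite -/(g (U k)); have Me0 : 0 <= Me by rewrite /Me; lra.
  elim: k => [|k IH].
    have := crude 0%N; have -> : n 0%N = 0 by []; lra.
  have en : 0 <= e * n k by rewrite mulr_ge0 // ltW.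
  have en1 : e * n k <= e * n k.+1 by rewrite ler_wpM2l // ltW.
  have [h|h] := leqP N (size (U k)).
    case: (gstep k) => hs; apply: (le_trans hs); first by have := be k; lra.
    have : (J (size (U k))).+1%:R^-1 * (n k.+1 - n k) <= e / 2 * (n k.+1 - n k).
      by rewrite ler_wpM2r ?subr_ge0 // small.
    by move: IH; set z := _^-1 * _; lra.
  have := crude k.+1; have := lenb k; have := bJ (size (U k)).
  have : n k <= N%:R by rewrite /n ler_nat ltnW.
  by rewrite -/(n k); lra.
have Uneq k : exists2 w, w != [::] & U k.+1 = U k ++ w.
  by exists (next (U k)) => //; apply: good_neq0 P0 _ _; apply: good_sel.
have [x [gamma [t [rep pt lt gE dim]]]] := concat_point Oa erefl U_cyc Uneq Ug.
exists x => //; exists gamma => //; exists (size t).+1 => -[|j] // jt.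
have kU k : (k <= size (U k))%N.
  elim: k => // k IH; have [w w0 ->] := Uneq k; rewrite size_cat.
  by case: w w0 => //= c w _; rewrite addnS ltnS (leq_trans IH) // leq_addr.
have jU : (j - size t < size (U j.+1))%N.
  by apply: leq_trans (kU _); rewrite ltnS leq_subr.
rewrite (gE j.+1 j); last by rewrite size_cat -ltn_subLR.
rewrite nth_cat ltnNge -ltnS jt /=.
by apply: Omega0_path Oa (U_cyc j.+1).1 _ (mem_nth _ jU).
Qed.

End Mixing.

(** * Boundedness of the dimensions and the two inclusions *)

Section Main.
Context {R : realType} (W : coverIFS R).
Variable mu : probability (measurableTypeR R) R.
Hypothesis std : standard_assumptions W mu.

Local Notation rho := (ratio W).
Local Notation p := (@weight R W).

Let rho_gt0 : 0 < rho := ratio_gt0 W.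
Let lnrho : ln rho < 0.
Proof. by rewrite ln_lt0 // rho_gt0 (ratio_lt1 W). Qed.

Lemma periodic_essential x : essential_positive_periodic W x -> essential W x.
Proof.
case=> alpha [s [[cs [gamma [k [rep gE]]]] sO _]]; exists gamma => //.
exists k.+1 => j kj; rewrite -(subnKC kj) gE; apply: sO.
have s0 : (0 < size s)%N by case: cs => s0 _ _; rewrite lt0n size_eq0.
by apply: mem_belast; apply: mem_nth; rewrite size_belast ltn_pmod.
Qed.

Lemma lin_growth_ge (a : nat -> R) (L c : R) : lin_growth a L ->
  (forall n, a n <= n%:R * c) -> L <= c.
Proof.
move=> H ac; rewrite leNgt; apply/negP => cL.
have e0 : 0 < (L - c) / 2 by rewrite divr_gt0 ?subr_gt0.
have [M HM] := H _ e0; pose n := (Num.truncn (M / ((L - c) / 2))).+1.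
have : M < n%:R * ((L - c) / 2) by rewrite -ltr_pdivrMr // truncnS_gt.
by have := ac n; have := HM n; rewrite ler_norml => /andP[? ?]; lra.
Qed.

Lemma lin_growth_opp (a : nat -> R) (L : R) : lin_growth a L ->
  lin_growth (fun n => - a n) (- L).
Proof.
move=> H e e0; have [M HM] := H e e0; exists M => n.
by rewrite mulrN opprK addrC distrC.
Qed.

(** From p_0^n <= Q_n <= 1. Boundedness gives the infimum and supremum of the periodic dimensions
    their usual meaning. *)
Lemma dim_bounds x v : essential W x -> has_local_dim mu x v ->
  0 <= v <= ln (p ord0) / ln rho.
Proof.
case=> gamma /symbolic_repP[D [DB xD _]] _ hv.
have Dnet n : D n \in net_intervals W n by case: (DB n).
have hL : lin_growth (fun n => ln (cover_mass W n (D n))) (v * ln rho).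
  by apply/(local_dim_growth std (D := D)) => // n; split.
have up : v * ln rho <= 0.
  apply: lin_growth_ge hL _ => n; rewrite mulr0 -(ln1 R); apply: ln_ge.
    exact: cover_mass_gt0.
  rewrite -(wsum_cst W n 1); apply: wsum_le => w _; by rewrite lern1 leq_b1.
have lo : - (v * ln rho) <= - ln (p ord0).
  apply: lin_growth_ge (lin_growth_opp hL) _ => n; rewrite mulrN lerN2.
  rewrite mulr_natl -lnXn ?weight_gt0 //; apply: ln_ge.
    by rewrite exprn_gt0 ?weight_gt0.
  exact: cover_mass_ge.
apply/andP; split; first by rewrite -(nmulr_lle0 _ lnrho).
by rewrite ler_ndivlMr // -lerN2.
Qed.

Lemma essential_dims :
  let dims := [set v : R | exists2 x : R, essential_positive_periodic W x &
                                          has_local_dim mu x v] in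
  [set v : R | exists2 x : R, essential W x & has_local_dim mu x v] =
  [set` `[inf dims, sup dims]].
Proof.
move=> dims.
have [alpha Oa] : exists alpha, Omega0 W alpha.
  by case: (Omega0_essential W) => -[[alpha Oa] _ _] _; exists alpha.
have [P [P0 pP lP posP]] := positive_cycle Oa.
have [C C0 HC] := plog_quasi Oa pP lP posP.
have approx (x v : R) := @good_approx _ W alpha P Oa pP mu x v std.
have per w := @good_periodic _ W alpha P Oa P0 pP lP posP mu C w std HC.
have lb : has_lbound dims.
  by exists 0 => v [x /periodic_essential ex /(dim_bounds ex)/andP[]].
have ub : has_ubound dims.
  by exists (ln (p ord0) / ln rho) => v
    [x /periodic_essential ex /(dim_bounds ex)/andP[]].
have close (x v e : R) : essential W x -> has_local_dim mu x v -> 0 < e ->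
    exists2 v', dims v' & `|v - v'| <= e.
  move=> ex xv e0.
  (* Half of the tolerance is for the good cycle that follows x, half for the constant C of its
     periodic point, which is negligible once the cycle is longer than C / e1. The factor - ln rho
     converts dimensions to logarithmic means. *)
  pose e1 := e * - ln rho / 2.
  have l0 : 0 < - ln rho by rewrite oppr_gt0.
  have e10 : 0 < e1 by rewrite divr_gt0 ?mulr_gt0.
  have [w [gw sw hw]] := approx x v ex xv e1 (Num.truncn (C / e1)).+1 e10.
  have [x' [v' [px dv' hv']]] := per w gw.
  exists v'; first by exists x'.
  have s0 : 0 < (size w)%:R :> R by rewrite ltr0n (leq_trans _ sw).
  have Cs : C <= e1 * (size w)%:R.
    rewrite mulrC -ler_pdivrMr //; apply: le_trans (ltW (truncnS_gt _)) _.
    by rewrite ler_nat.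
  have sl : 0 < (size w)%:R * - ln rho by rewrite mulr_gt0.
  rewrite -(ler_pM2r sl) -{1}(gtr0_norm sl) -normrM.
  have -> : e * ((size w)%:R * - ln rho) = 2 * (e1 * (size w)%:R).
    by rewrite /e1; field.
  move: hw hv'; rewrite !ler_norml.
  by move=> /andP[? ?] /andP[? ?]; apply/andP; split; lra.
have ne : dims !=set0.
  have [w gw] : exists w, good W alpha P w by exists P, [::].
  by have [x [v [px dv _]]] := per w gw; exists v; exists x.
apply/seteqP; split=> v /=.
  case=> x ex xv; rewrite in_itv /=; apply/andP; split.
    apply/ler_addgt0Pr => e e0; have [v' dv' h] := close x v e ex xv e0.
    apply: le_trans (ge_inf lb dv') _; move: h; rewrite ler_norml => /andP[? ?]; lra.
  apply/ler_addgt0Pr => e e0; have [v' dv' h] := close x v e ex xv e0.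
  have := ub_le_sup ub dv'; move: h; rewrite ler_norml => /andP[? ?]; lra.
rewrite in_itv /= => /andP[v1 v2].
have l0 : 0 < - ln rho by rewrite oppr_gt0.
have [||x ex xv] := @mixing _ W alpha P Oa P0 pP lP C C0 HC (v * ln rho);
  last by exists x => //; apply: xv.
(* As ln rho is negative, large dimensions are small logarithmic means: the cycles with mean almost
   at most L come from periodic points near the supremum, the others from near the infimum. *)
- move=> e K e0; pose e1 := e / 2 / - ln rho.
  have e10 : 0 < e1 by rewrite !divr_gt0.
  have [v' [x px xv'] h] := sup_adherent e10 (conj ne ub).
  have e2 : 0 < e / 2 by rewrite divr_gt0.
  have [w [gw sw hw]] := approx x v' (periodic_essential px) xv' _ K e2.
  exists w; split=> //; move: hw; rewrite ler_norml => /andP[_ hw].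
  have : (v - v') * - ln rho <= e1 * - ln rho by rewrite ler_wpM2r ?(ltW l0) //; lra.
  rewrite /e1 divfK ?gt_eqF // => h'.
  have : (size w)%:R * ((v - v') * - ln rho) <= (size w)%:R * (e / 2).
    by rewrite ler_wpM2l.
  lra.
move=> e K e0; pose e1 := e / 2 / - ln rho.
have e10 : 0 < e1 by rewrite !divr_gt0.
have [v' [x px xv'] h] := inf_adherent e10 (conj ne lb).
have e2 : 0 < e / 2 by rewrite divr_gt0.
have [w [gw sw hw]] := approx x v' (periodic_essential px) xv' _ K e2.
exists w; split=> //; move: hw; rewrite ler_norml => /andP[hw _].
have : (v' - v) * - ln rho <= e1 * - ln rho by rewrite ler_wpM2r ?(ltW l0) //; lra.
rewrite /e1 divfK ?gt_eqF // => h'.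
have : (size w)%:R * ((v' - v) * - ln rho) <= (size w)%:R * (e / 2).
  by rewrite ler_wpM2l.
lra.
Qed.

End Main.

Theorem corollary5p8 (R : realType) (W : weightedIFS R)
    (mu : probability (measurableTypeR R) R)
    (hmu : standard_assumptions W mu) :
  let dims := [set v : R | exists2 x : R, essential_positive_periodic W x &
                                          has_local_dim mu x v] in
  [set v : R | exists2 x : R, essential W x & has_local_dim mu x v] =
  [set` `[inf dims, sup dims]].
Proof. exact: (@essential_dims R (CoverIFS (standard_unit_cover hmu)) mu hmu). Qed.
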